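(* Let $A,B\in M_d(\mathbb{C})$ be Hermitian. Define a function $\omega_{A,B}:\mathbb{R}^2\to\mathbb{R}$ by $$\omega_{A,B}(a,b):=\frac{1}{2\pi}\sum_{i=1}^d\big|\Im(\lambda_i((A-aI)(B-bI)))\big|.$$ Then $\omega_{A,B}$ is continuous and compactly supported on $\operatorname{Conv}(\lambda(A))\times\operatorname{Conv}(\lambda(B))$, and for any $k,l\in\mathbb{N}$, we have $$\int_{\mathbb{R}^2} a^kb^l\,\omega_{A,B}(a,b)\,da\,db=\frac{1}{(k+l+2)(k+l+3)}\sum_{n=1}^{\min(k,l)+2}\frac{(-1)^{n-1}}{\binom{k+l+1}{n-1}}\sum_{\substack{i_1,\ldots,i_n,j_1,\ldots,j_n\ge1\\ i_1+\cdots+i_n=k+2\\ j_1+\cdots+j_n=l+2}}\operatorname{tr}\big(A^{i_1}B^{j_1}\cdots A^{i_n}B^{j_n}\big).$$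
   Context: $\mathbb{N}=\{0,1,2,\dots\}$. For $C\in M_d(\mathbb{C})$, $\lambda(C)=\{\lambda_1(C),\dots,\lambda_d(C)\}$ denotes the eigenvalues of $C$ repeated with algebraic multiplicity; $\operatorname{Conv}$ is the convex hull; $\operatorname{tr}$ is the (unnormalized) trace. *)

(* Defs.v *)
From HB Require Import structures.
From mathcomp Require Import all_boot all_order all_algebra.
From mathcomp Require Import sesquilinear spectral complex.
From mathcomp Require Import all_classical all_reals all_analysis.

Set Implicit Arguments.
Unset Strict Implicit.
Unset Printing Implicit Defensive.

Import Order.TTheory GRing.Theory Num.Theory.
Import numFieldNormedType.Exports.

Local Open Scope classical_set_scope.
Local Open Scope ring_scope.
Local Open Scope complex_scope.

Section Defs.
Variable R : realType.

(* The roots of the characteristic polynomial, each repeated according to its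
   algebraic multiplicity; see [char_poly_eigvals]. *)
Definition eigvals (d : nat) (C : 'M[R[i]]_d) : seq R[i] :=
  sval (closed_field_poly_normal (char_poly C)).

Lemma char_poly_eigvals (d : nat) (C : 'M[R[i]]_d) :
  char_poly C = \prod_(z <- eigvals C) ('X - z%:P).
Proof.
rewrite /eigvals; case: closed_field_poly_normal => s /= {1}->.
by rewrite (monicP (char_poly_monic C)) scale1r.
Qed.

(* For s = [::] no weights sum to 1, so the hull is empty. *)
Definition conv_hull (s : seq R[i]) : set R[i] :=
  [set z | exists w : 'I_(size s) -> R,
     [/\ forall m, 0 <= w m, \sum_m w m = 1 & z = \sum_m (w m)%:C * s`_m]].

Definition omega (d : nat) (A B : 'M[R[i]]_d) (p : R * R) : R :=
  (2 * pi)^-1 *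
  \sum_(z <- eigvals ((A - (p.1)%:C%:M) *m (B - (p.2)%:C%:M))) `|complex.Im z|.

Definition fsupport (f : R * R -> R) : set (R * R) :=
  closure [set p | f p != 0].

(* Tuples of n positive integers with sum s: every part is at most s, so ranging
   over 'I_s.+1 loses none of them. *)
Definition composition (s n : nat) (c : {ffun 'I_n -> 'I_s.+1}) : bool :=
  [forall m, (0 < c m)%N] && ((\sum_m c m)%N == s).

(* The factors of the product are taken in increasing order of the index. *)
Definition word (d : nat) (A B : 'M[R[i]]_d) (s t n : nat)
    (i : {ffun 'I_n -> 'I_s.+1}) (j : {ffun 'I_n -> 'I_t.+1}) : 'M[R[i]]_d :=
  \prod_(m < n) (A ^+ i m *m B ^+ j m).

End Defs.

Notation lebesgue_measure2 R :=
  ((@lebesgue_measure R) \x (@lebesgue_measure R))%E (only parsing).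

(* Main.v *)
Require Import Defs.
From mathcomp Require Import all_boot all_order all_algebra.
From mathcomp Require Import sesquilinear spectral complex.
From mathcomp Require Import all_classical all_reals all_analysis.
From mathcomp Require Import measurable_realfun ring lra zify.
Import Order.TTheory GRing.Theory Num.Theory.
Import numFieldNormedType.Exports.
Local Open Scope classical_set_scope.
Local Open Scope ring_scope.
Local Open Scope complex_scope.
Set Implicit Arguments.
Unset Strict Implicit.
Unset Printing Implicit Defensive.

Section weight.
Variable R : realType.
Local Notation mu := (@lebesgue_measure R).

Definition hw (x : R) : R := (1 + x ^+ 2)^-1.

Lemma hw_gt0 x : 0 < hw x.
Proof. by rewrite invr_gt0 ltr_wpDr// sqr_ge0. Qed.

Lemma hw_ge0 x : 0 <= hw x. Proof. exact/ltW/hw_gt0. Qed.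

Lemma measurable_hw : measurable_fun setT hw.
Proof. by apply: continuous_measurable_fun; exact: continuous_oneDsqrV. Qed.

Lemma integrable_hw : mu.-integrable setT (EFin \o hw).
Proof.
apply/integrableP; split; first by apply/measurable_EFinP; exact: measurable_hw.
rewrite (eq_integral (fun x : measurableTypeR R => (hw x)%:E)); last first.
  by move=> x _ /=; rewrite ger0_norm ?hw_ge0.
rewrite (@ge0_symfun_integralT _ hw).
- rewrite (_ : [set x : R | 0 <= x] = `[0, +oo[%classic); last first.
    by apply/seteqP; split => x /=; rewrite in_itv/= andbT.
  by rewrite integral0y_oneDsqr -EFinM ltry.
- exact: hw_ge0.
- exact: continuous_oneDsqrV.
- by move=> x /=; rewrite /hw sqrrN.
Qed.

(* functions dominated by the weight *)
Definition Dom (f : R -> R) :=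
  measurable_fun setT f /\ exists C, forall x, `|f x| <= C * hw x.

Lemma Dom_integrable (f : R -> R) : Dom f -> mu.-integrable setT (EFin \o f).
Proof.
move=> [mf [C fC]].
apply: (@le_integrable _ _ _ mu _ measurableT _ (EFin \o (fun x => C * hw x))).
- exact/measurable_EFinP.
- move=> x _ /=; rewrite lee_fin (le_trans (fC x))// ler_norm//.
- rewrite (_ : EFin \o _ = (fun x => C%:E * (EFin \o hw) x)%E)//.
  exact: integrableZl integrable_hw.
Qed.

Lemma Dom_bound (f : R -> R) (C : R) : measurable_fun setT f -> (forall x, `|f x| <= C * hw x) ->
  `|\int[mu]_x f x| <= C * \int[mu]_x hw x.
Proof.
move=> mf fC.
have Df : Dom f by split => //; exists C.
have iC : mu.-integrable setT (EFin \o (fun x => C * hw x)).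
  rewrite (_ : EFin \o _ = (fun x => C%:E * (EFin \o hw) x)%E)//.
  exact: integrableZl integrable_hw.
apply: (le_trans (le_normr_Rintegral measurableT (Dom_integrable Df))).
rewrite -RintegralZl//; last exact: integrable_hw.
apply: le_Rintegral => //.
have := integrable_abse (Dom_integrable Df).
by rewrite (_ : _ \o _ = EFin \o (fun x => `|f x|)).
Qed.

Lemma Dom_cvg (f_ : nat -> R -> R) (f : R -> R) (C : R) :
  (forall n, measurable_fun setT (f_ n)) ->
  (forall n x, `|f_ n x| <= C * hw x) ->
  (forall x, f_ ^~ x @ \oo --> f x) ->
  (\int[mu]_x f_ n x) @[n --> \oo] --> \int[mu]_x f x.
Proof.
move=> mf fC ff.
have iC : mu.-integrable setT (EFin \o (fun x => C * hw x)).
  rewrite (_ : EFin \o _ = (fun x => C%:E * (EFin \o hw) x)%E)//.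
  exact: integrableZl integrable_hw.
have H := @dominated_cvg _ _ _ mu setT measurableT (fun n => EFin \o f_ n)
  (EFin \o f) (EFin \o (fun x => C * hw x)).
have {}H : (\int[mu]_x (f_ n x)%:E)%E @[n --> \oo] --> (\int[mu]_x (f x)%:E)%E.
  apply: H => //.
  - by move=> n; apply/measurable_EFinP; exact: mf.
  - by move=> x _; apply: cvg_EFin; [exact: nearW|exact: ff].
  - by move=> n x _; rewrite /= lee_fin.
have mff : measurable_fun setT f.
  by apply: (measurable_fun_cvg mf) => x _; exact: ff.
have fb x : `|f x| <= C * hw x.
  have nf : `|f_ n x| @[n --> \oo] --> `|f x| by apply: cvg_norm; exact: ff.
  by apply: (cvgr_to_le nf); exact: nearW.
have /fineK fE : (\int[mu]_x (f x)%:E)%E \is a fin_num.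
  apply: integrable_fin_num => //; apply: (@Dom_integrable f).
  by split => //; exists C.
by apply: fine_cvg; rewrite fE.
Qed.
End weight.

Notation cm := Normc.normc.

Section complex_modulus.
Variable R : realType.
Implicit Types (z w : R[i]) (x y : R).
Local Notation re := (@complex.Re R).
Local Notation im := (@complex.Im R).

Lemma reD z w : re (z + w) = re z + re w. Proof. by case: z w => a b []. Qed.
Lemma imD z w : im (z + w) = im z + im w. Proof. by case: z w => a b []. Qed.
Lemma reN z : re (- z) = - re z. Proof. by case: z. Qed.
Lemma imN z : im (- z) = - im z. Proof. by case: z. Qed.
Lemma reM z w : re (z * w) = re z * re w - im z * im w.
Proof. by case: z w => a b []. Qed.
Lemma imM z w : im (z * w) = re z * im w + im z * re w.
Proof. by case: z w => a b []. Qed.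
Lemma reV z : re z^-1 = re z / (re z ^+ 2 + im z ^+ 2). Proof. by case: z. Qed.
Lemma imV z : im z^-1 = - im z / (re z ^+ 2 + im z ^+ 2).
Proof. by case: z => a b; rewrite mulNr. Qed.
Lemma re_sum I (r : seq I) P (F : I -> R[i]) :
  re (\sum_(i <- r | P i) F i) = \sum_(i <- r | P i) re (F i).
Proof. by apply: (big_morph re reD). Qed.
Lemma complex_ext z w : re z = re w -> im z = im w -> z = w.
Proof. by case: z w => a b [c d] /= -> ->. Qed.

Lemma cm0 : cm (0 : R[i]) = 0. Proof. exact: Normc.normc0. Qed.
Lemma cm1 : cm (1 : R[i]) = 1. Proof. exact: Normc.normc1. Qed.
Lemma cmM z w : cm (z * w) = cm z * cm w. Proof. exact: Normc.normcM. Qed.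
Lemma cmV z : cm z^-1 = (cm z)^-1. Proof. exact: Normc.normcV. Qed.
Lemma cm_norm z : (cm z)%:C = `|z|. Proof. by case: z. Qed.
Lemma cmD z w : cm (z + w) <= cm z + cm w.
Proof. exact: le_normcD. Qed.
Lemma cmN z : cm (- z) = cm z. Proof. exact: normcN. Qed.
Lemma cmX z n : cm (z ^+ n) = cm z ^+ n.
Proof. by elim: n => [|n IH]; rewrite ?cm1// !exprS cmM IH. Qed.
Lemma cm_ge0 z : 0 <= cm z.
Proof. by case: z => a b; rewrite sqrtr_ge0. Qed.
Lemma cm_eq0 z : (cm z == 0) = (z == 0).
Proof.
by apply/eqP/eqP => [/Normc.eq0_normc//|->]; rewrite cm0.
Qed.
Lemma cm_gt0 z : (0 < cm z) = (z != 0).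
Proof. by rewrite lt_def cm_ge0 cm_eq0 andbT. Qed.
Lemma cm_real x : cm x%:C = `|x|.
Proof. by rewrite /= expr0n/= addr0 sqrtr_sqr. Qed.
Lemma cm_sq z : cm z ^+ 2 = re z ^+ 2 + im z ^+ 2.
Proof. by case: z => a b; rewrite sqr_sqrtr// addr_ge0// sqr_ge0. Qed.
Lemma cm_conj z : cm z^*%C = cm z.
Proof. by case: z => a b /=; rewrite sqrrN. Qed.
Lemma re_le_cm z : `|re z| <= cm z.
Proof.
by rewrite -ler_sqr ?nnegrE ?cm_ge0// cm_sq real_normK ?num_real// lerDl sqr_ge0.
Qed.
Lemma im_le_cm z : `|im z| <= cm z.
Proof.
by rewrite -ler_sqr ?nnegrE ?cm_ge0// cm_sq real_normK ?num_real// lerDr sqr_ge0.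
Qed.
Lemma cm_le z : cm z <= `|re z| + `|im z|.
Proof.
rewrite -ler_sqr ?nnegrE ?cm_ge0 ?addr_ge0// cm_sq sqrrD !real_normK ?num_real//.
by rewrite lerD2r lerDl mulrn_wge0// mulr_ge0.
Qed.
Lemma cm_sum I (r : seq I) P (F : I -> R[i]) :
  cm (\sum_(i <- r | P i) F i) <= \sum_(i <- r | P i) cm (F i).
Proof.
elim/big_rec2: _ => [|i y z _ h]; first by rewrite cm0.
by rewrite (le_trans (cmD _ _))// lerD2l.
Qed.
Lemma cm_prod I (r : seq I) P (F : I -> R[i]) :
  cm (\prod_(i <- r | P i) F i) = \prod_(i <- r | P i) cm (F i).
Proof. by elim/big_rec2: _ => [|i y z _ <-]; [exact: cm1|exact: cmM]. Qed.
End complex_modulus.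

Section complex_measurable.
Variable R : realType.
Local Notation re := (@complex.Re R).
Local Notation im := (@complex.Im R).

Lemma measurable_funVr : measurable_fun setT (@GRing.inv R).
Proof.
rewrite -(setvU [set 0 : R]) setUC; apply/measurable_funU => //.
  exact: measurableC.
split; first exact: measurable_fun_set1.
apply: open_continuous_measurable_fun; first exact/closed_openC/closed_eq.
move=> x; rewrite inE/= => /eqP x0; apply: inv_continuous => //.
Qed.

Context d (T : measurableType d).
Implicit Types (f g : T -> R[i]).

Definition cmeas f := measurable_fun setT (fun x => re (f x)) /\
   measurable_fun setT (fun x => im (f x)).

Lemma cmeas_ext f g : f =1 g -> cmeas f -> cmeas g.
Proof. by move=> /funext ->. Qed.

Lemma cmeas_cst c : cmeas (fun _ => c).
Proof. by split; exact: measurable_cst. Qed.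

Lemma cmeas_real (f : T -> R) : measurable_fun setT f -> cmeas (fun x => (f x)%:C).
Proof. by move=> mf; split => //=; exact: measurable_cst. Qed.

Lemma cmeasD f g : cmeas f -> cmeas g -> cmeas (fun x => f x + g x).
Proof.
move=> [f1 f2] [g1 g2]; split.
  by under eq_fun do rewrite reD; exact: measurable_funD.
by under eq_fun do rewrite imD; exact: measurable_funD.
Qed.

Lemma cmeasM f g : cmeas f -> cmeas g -> cmeas (fun x => f x * g x).
Proof.
move=> [f1 f2] [g1 g2]; split.
  under eq_fun do rewrite reM.
  by apply: measurable_funB; exact: measurable_funM.
under eq_fun do rewrite imM.
by apply: measurable_funD; exact: measurable_funM.
Qed.

Lemma cmeasN f : cmeas f -> cmeas (fun x => - f x).
Proof.
move=> mf; apply: (cmeas_ext _ (cmeasM (cmeas_cst (-1)) mf)) => x /=.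
by rewrite mulN1r.
Qed.

Lemma cmeasB f g : cmeas f -> cmeas g -> cmeas (fun x => f x - g x).
Proof. by move=> mf mg; apply: cmeasD => //; exact: cmeasN. Qed.

Lemma cmeasV f : cmeas f -> cmeas (fun x => (f x)^-1).
Proof.
move=> [f1 f2].
have m : measurable_fun setT (fun x => (re (f x) ^+ 2 + im (f x) ^+ 2)^-1).
  apply: (measurableT_comp measurable_funVr).
  by apply: measurable_funD; exact: measurable_funX.
split.
  by under eq_fun do rewrite reV; exact: measurable_funM.
under eq_fun do rewrite imV mulNr.
by apply: measurable_funN; exact: measurable_funM.
Qed.

Lemma cmeas_sum I (r : seq I) P (F : I -> T -> R[i]) :
  (forall i, cmeas (F i)) -> cmeas (fun x => \sum_(i <- r | P i) F i x).
Proof.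
move=> mF; elim: r => [|i r IH].
  by under eq_fun do rewrite big_nil; exact: cmeas_cst.
under eq_fun do rewrite big_cons.
by case: (P i) => //; exact: cmeasD.
Qed.

Lemma cmeas_prod I (r : seq I) P (F : I -> T -> R[i]) :
  (forall i, cmeas (F i)) -> cmeas (fun x => \prod_(i <- r | P i) F i x).
Proof.
move=> mF; elim: r => [|i r IH].
  by under eq_fun do rewrite big_nil; exact: cmeas_cst.
under eq_fun do rewrite big_cons.
by case: (P i) => //; exact: cmeasM.
Qed.

Lemma cmeasX f n : cmeas f -> cmeas (fun x => f x ^+ n).
Proof.
move=> mf; elim: n => [|n IH].
  by under eq_fun do rewrite expr0; exact: cmeas_cst.
by under eq_fun do rewrite exprS; exact: cmeasM.
Qed.

Lemma cmeas_conj f : cmeas f -> cmeas (fun x => (f x)^*%C).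
Proof.
move=> [f1 f2]; split.
  by rewrite [X in measurable_fun _ X](_ : _ = (fun x => re (f x)))//;
    apply/funext => x; case: (f x).
rewrite [X in measurable_fun _ X](_ : _ = (fun x => - im (f x))).
  exact: measurable_funN.
by apply/funext => x; case: (f x).
Qed.

End complex_measurable.

Section complex_integral.
Variable R : realType.
Local Notation re := (@complex.Re R).
Local Notation im := (@complex.Im R).
Local Notation mu := (@lebesgue_measure R).
Implicit Types (f g : R -> R[i]).

Definition cint f : R[i] := Complex (\int[mu]_x re (f x)) (\int[mu]_x im (f x)).

Definition cDom f := cmeas f /\ exists C : R, forall x, cm (f x) <= C * hw x.

Lemma cDom_re f : cDom f -> Dom (fun x => re (f x)).
Proof.
move=> [[m1 m2] [C fC]]; split => //; exists C => x.
exact: le_trans (re_le_cm _) (fC x).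
Qed.

Lemma cDom_im f : cDom f -> Dom (fun x => im (f x)).
Proof.
move=> [[m1 m2] [C fC]]; split => //; exists C => x.
exact: le_trans (im_le_cm _) (fC x).
Qed.

Lemma eq_cint f g : f =1 g -> cint f = cint g.
Proof. by move=> /funext ->. Qed.

Lemma cDom_ext f g : f =1 g -> cDom f -> cDom g.
Proof. by move=> /funext ->. Qed.

Lemma cDom0 : cDom (fun=> 0).
Proof.
by split; [exact: cmeas_cst | exists 0 => x; rewrite cm0 mul0r].
Qed.

Lemma cDomD f g : cDom f -> cDom g -> cDom (fun x => f x + g x).
Proof.
move=> [mf [C fC]] [mg [D gD]]; split; first exact: cmeasD.
by exists (C + D) => x; rewrite mulrDl (le_trans (cmD _ _))// lerD.
Qed.

Lemma cDomM (f : R -> R[i]) g (M : R) : cmeas f -> (forall x, cm (f x) <= M) ->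
  cDom g -> cDom (fun x => f x * g x).
Proof.
move=> mf fM [mg [D gD]]; split; first exact: cmeasM.
by exists (M * D) => x; rewrite -mulrA cmM ler_pM ?cm_ge0.
Qed.

Lemma cDomZ c g : cDom g -> cDom (fun x => c * g x).
Proof.
by move=> Dg; apply: (@cDomM (fun=> c) g (cm c)) => //; exact: cmeas_cst.
Qed.

Lemma cDomN g : cDom g -> cDom (fun x => - g x).
Proof.
by move=> /(cDomZ (-1)); apply: cDom_ext => x; rewrite mulN1r.
Qed.

Lemma cDomB f g : cDom f -> cDom g -> cDom (fun x => f x - g x).
Proof. by move=> Df Dg; apply: cDomD => //; exact: cDomN. Qed.

Lemma cDom_sum I (r : seq I) (P : pred I) (F : I -> R -> R[i]) :
  (forall i, P i -> cDom (F i)) -> cDom (fun x => \sum_(i <- r | P i) F i x).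
Proof.
move=> mF; elim: r => [|i r IH].
  by under eq_fun do rewrite big_nil; exact: cDom0.
under eq_fun do rewrite big_cons.
by case Pi : (P i) => //; apply: cDomD => //; exact: mF.
Qed.

Lemma cDom_conj f : cDom f -> cDom (fun x => (f x)^*%C).
Proof.
move=> [mf [C fC]]; split; first exact: cmeas_conj.
by exists C => x; rewrite cm_conj.
Qed.

Lemma cintD f g : cDom f -> cDom g ->
  cint (fun x => f x + g x) = cint f + cint g.
Proof.
move=> Df Dg; apply: complex_ext; [rewrite reD /=|rewrite imD /=].
  under eq_fun do rewrite reD.
  by rewrite RintegralD//; apply: Dom_integrable; exact: cDom_re.
under eq_fun do rewrite imD.
by rewrite RintegralD//; apply: Dom_integrable; exact: cDom_im.
Qed.

Lemma cintZ c f : cDom f -> cint (fun x => c * f x) = c * cint f.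
Proof.
move=> Df.
have i1 := Dom_integrable (cDom_re Df); have i2 := Dom_integrable (cDom_im Df).
have j1 r : mu.-integrable setT (EFin \o (fun x => r * re (f x))).
  rewrite (_ : _ \o _ = (fun x => r%:E * (EFin \o (fun x => re (f x))) x)%E)//.
  exact: integrableZl.
have j2 r : mu.-integrable setT (EFin \o (fun x => r * im (f x))).
  rewrite (_ : _ \o _ = (fun x => r%:E * (EFin \o (fun x => im (f x))) x)%E)//.
  exact: integrableZl.
apply: complex_ext; [rewrite reM /=|rewrite imM /=].
  under eq_fun do rewrite reM.
  by rewrite RintegralB// !RintegralZl.
under eq_fun do rewrite imM.
by rewrite RintegralD// !RintegralZl.
Qed.

Lemma cint0 : cint (fun=> 0) = 0.
Proof.
rewrite -[RHS](mul0r (cint (fun=> 0))) -(cintZ _ cDom0).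
by apply: eq_cint => x; rewrite mul0r.
Qed.

Lemma cintN f : cDom f -> cint (fun x => - f x) = - cint f.
Proof.
move=> Df; rewrite -mulN1r -cintZ//; apply: eq_cint => x; by rewrite mulN1r.
Qed.

Lemma cintB f g : cDom f -> cDom g ->
  cint (fun x => f x - g x) = cint f - cint g.
Proof. by move=> Df Dg; rewrite cintD ?cintN//; exact: cDomN. Qed.

Lemma cint_sum I (r : seq I) (P : pred I) (F : I -> R -> R[i]) :
  (forall i, P i -> cDom (F i)) ->
  cint (fun x => \sum_(i <- r | P i) F i x) = \sum_(i <- r | P i) cint (F i).
Proof.
move=> mF; elim: r => [|i r IH].
  by under eq_fun do rewrite big_nil; rewrite big_nil cint0.
under eq_fun do rewrite big_cons.
rewrite big_cons; case Pi : (P i) => //.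
by rewrite cintD ?IH//; [exact: mF|exact: cDom_sum].
Qed.

Lemma cint_bound f (C : R) : cmeas f -> (forall x, cm (f x) <= C * hw x) ->
  cm (cint f) <= C * (2 * \int[mu]_x hw x).
Proof.
move=> [mf1 mf2] fC; apply: (le_trans (cm_le _)) => /=.
rewrite mulrCA mulr_natl mulr2n lerD//; apply: Dom_bound => // x.
  exact: le_trans (re_le_cm _) (fC x).
exact: le_trans (im_le_cm _) (fC x).
Qed.

Lemma cint_cvg (f_ : nat -> R -> R[i]) f (C : R) :
  (forall n, cmeas (f_ n)) -> (forall n x, cm (f_ n x) <= C * hw x) ->
  (forall x, re (f_ n x) @[n --> \oo] --> re (f x)) ->
  (forall x, im (f_ n x) @[n --> \oo] --> im (f x)) ->
  (re (cint (f_ n)) @[n --> \oo] --> re (cint f)) /\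
  (im (cint (f_ n)) @[n --> \oo] --> im (cint f)).
Proof.
move=> mf fC f1 f2; split => /=; apply: Dom_cvg => //.
- by move=> n; have [] := mf n.
- by move=> n x; exact: le_trans (re_le_cm _) (fC n x).
- by move=> n; have [] := mf n.
- by move=> n x; exact: le_trans (im_le_cm _) (fC n x).
Qed.

(* two variables *)
Definition cDom2 (f : R * R -> R[i]) := cmeas f /\
  exists C : R, forall b t, cm (f (b, t)) <= C * (hw b * hw t).

Definition Dom2 (f : R * R -> R) := measurable_fun setT f /\
  exists C : R, forall b t, `|f (b, t)| <= C * (hw b * hw t).

Lemma cmeas_slice1 (f : R * R -> R[i]) b : cmeas f -> cmeas (fun t => f (b, t)).
Proof.
by move=> [f1 f2]; split;
  [apply: (measurableT_comp f1)|apply: (measurableT_comp f2)].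
Qed.

Lemma cDom2_slice1 (f : R * R -> R[i]) b : cDom2 f -> cDom (fun t => f (b, t)).
Proof.
move=> [mf [C fC]]; split; first exact: cmeas_slice1.
exists (C * hw b) => t; by rewrite -mulrA.
Qed.

Lemma Dom2_integrable (f : R * R -> R) : Dom2 f -> (mu \x mu)%E.-integrable setT (EFin \o f).
Proof.
move=> [mf [C fC]].
have mF : measurable_fun setT (EFin \o f) by apply/measurable_EFinP.
apply/(@integrable12ltyP _ _ _ _ R mu mu _ mF).
have K0 : 0 <= \int[mu]_x hw x by apply: Rintegral_ge0 => x _; exact: hw_ge0.
have C0 : 0 <= C.
  have := le_trans (normr_ge0 _) (fC 0 0).
  by rewrite pmulr_lge0// mulr_gt0// hw_gt0.
apply: (@le_lt_trans _ _ (\int[mu]_x (C * (\int[mu]_x hw x) * hw x)%:E)%E).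
  apply: ge0_le_integral => //.
  - by move=> x _; exact: integral_ge0.
  - have h : measurable_fun setT (fubini_F mu
        (fun z : measurableTypeR R * measurableTypeR R => `|(EFin \o f) z|%E)).
      by apply: measurable_fun_fubini_tonelli_F => //; exact: measurableT_comp.
    exact: h.
  - apply/measurable_EFinP; apply: measurable_funM => //; exact: measurable_hw.
  - move=> b _.
    have <- : (\int[mu]_t ((C * hw b) * hw t)%:E = (C * (\int[mu]_x hw x) * hw b)%:E)%E.
      rewrite (_ : (fun t => _) = (fun t => (C * hw b)%:E * (EFin \o @hw R) t)%E)//.
      rewrite integralZl//; last exact: integrable_hw.
      rewrite [in RHS]mulrAC [in RHS]EFinM; congr (_ * _)%E.
      by rewrite /Rintegral fineK//; apply: integrable_fin_num => //; exact: integrable_hw.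
    apply: ge0_le_integral => //.
    + apply: measurableT_comp => //; apply/measurable_EFinP.
      exact: (measurableT_comp mf).
    + apply/measurable_EFinP; apply: measurable_funM => //; exact: measurable_hw.
    + by move=> t _; rewrite /= lee_fin -mulrA.
rewrite (_ : (fun x => _) = (fun x => (C * (\int[mu]_x hw x))%:E * (EFin \o @hw R) x)%E)//.
rewrite integralZl//; last exact: integrable_hw.
rewrite -[ltLHS]fineK ?ltry// fin_numM//.
by apply: integrable_fin_num => //; exact: integrable_hw.
Qed.

Lemma Dom2_Fubini (f : R * R -> R) : Dom2 f ->
  [/\ Dom (fun b => \int[mu]_t f (b, t)),
   \int[mu]_b \int[mu]_t f (b, t) = \int[mu]_t \int[mu]_b f (b, t) &
   \int[mu]_b \int[mu]_t f (b, t) = \int[(mu \x mu)%E]_z f z].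
Proof.
move=> Df; have If := Dom2_integrable Df.
have [mf [C fC]] := Df.
have F1 b : (\int[mu]_t (f (b, t))%:E = (\int[mu]_t f (b, t))%:E)%E.
  rewrite /Rintegral fineK//; apply: integrable_fin_num => //.
  apply: (@Dom_integrable R (fun t => f (b, t))).
  split; first exact: (measurableT_comp mf).
  by exists (C * hw b) => t; rewrite -mulrA.
have F2 t : (\int[mu]_b (f (b, t))%:E = (\int[mu]_b f (b, t))%:E)%E.
  rewrite /Rintegral fineK//; apply: integrable_fin_num => //.
  apply: (@Dom_integrable R (fun b => f (b, t))).
  split; first exact: (measurableT_comp mf).
  by exists (C * hw t) => b; rewrite -mulrA [hw t * _]mulrC.
have Fe1 : (fun b => \int[mu]_t (f (b, t))%:E)%E = (fun b => (\int[mu]_t f (b, t))%:E).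
  by apply/funext.
have Fe2 : (fun t => \int[mu]_b (f (b, t))%:E)%E = (fun t => (\int[mu]_b f (b, t))%:E).
  by apply/funext.
split.
- split.
    apply/measurable_EFinP.
    have := measurable_fubini_F If.
    by rewrite /fubini_F Fe1.
  exists (C * \int[mu]_x hw x) => b.
  rewrite mulrAC; apply: Dom_bound; first exact: (measurableT_comp mf).
  by move=> t; rewrite -mulrA.
- have := Fubini If; rewrite /= Fe1 Fe2 => h.
  by rewrite /Rintegral h.
- have := integral12_prod_meas1 If; rewrite /fubini_F /= Fe1 => h.
  by rewrite /Rintegral h.
Qed.

Lemma cDom2_re (f : R * R -> R[i]) : cDom2 f -> Dom2 (fun x => re (f x)).
Proof.
move=> [[m1 m2] [C fC]]; split => //; exists C => b t.
exact: le_trans (re_le_cm _) (fC b t).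
Qed.

Lemma cDom2_im (f : R * R -> R[i]) : cDom2 f -> Dom2 (fun x => im (f x)).
Proof.
move=> [[m1 m2] [C fC]]; split => //; exists C => b t.
exact: le_trans (im_le_cm _) (fC b t).
Qed.

Lemma cFubini (f : R * R -> R[i]) : cDom2 f ->
  cint (fun b => cint (fun t => f (b, t))) = cint (fun t => cint (fun b => f (b, t))).
Proof.
move=> Df; apply: complex_ext => /=.
  by have [_ -> _] := Dom2_Fubini (cDom2_re Df).
by have [_ -> _] := Dom2_Fubini (cDom2_im Df).
Qed.

Lemma cDom2_int (f : R * R -> R[i]) : cDom2 f -> cDom (fun b => cint (fun t => f (b, t))).
Proof.
move=> Df.
have [[m1 _] _ _] := Dom2_Fubini (cDom2_re Df).
have [[m2 _] _ _] := Dom2_Fubini (cDom2_im Df).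
have [mf [C fC]] := Df.
split; first by split.
exists (C * (2 * \int[mu]_x hw x)) => b; rewrite mulrAC.
apply: cint_bound; first exact: cmeas_slice1.
by move=> t; rewrite -mulrA.
Qed.

End complex_integral.

Section ftc_line.
Variable R : realType.
Local Notation re := (@complex.Re R).
Local Notation im := (@complex.Im R).
Local Notation mu := (@lebesgue_measure R).

Lemma Rint_FTC (G f : R -> R) (L1 L2 : R) :
  (forall t : R, is_derive t (1 : R) G (f t)) -> continuous f -> Dom f ->
  G n%:R @[n --> \oo] --> L1 -> G (- n%:R) @[n --> \oo] --> L2 ->
  \int[mu]_x f x = L1 - L2.
Proof.
move=> dG cf [mf [C fC]] G1 G2.
have C0 : 0 <= C.
  by have := le_trans (normr_ge0 _) (fC 0); rewrite pmulr_lge0// hw_gt0.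
pose I (n : nat) : set R := `[- n.+1%:R, n.+1%:R]%classic.
have E n : \int[mu]_x (f \_ (I n)) x = G n.+1%:R - G (- n.+1%:R).
  rewrite -Rintegral_mkcond /Rintegral.
  rewrite (@continuous_FTC2 _ f G)//.
  - by rewrite (lt_trans (y := 0))// ?ltr0n// oppr_lt0 ltr0n.
  - exact: continuous_subspaceT.
  - have cG : continuous G.
      move=> x; apply: differentiable_continuous; apply/derivable1_diffP.
      exact: ex_derive.
    split.
    + by move=> x _; exact: ex_derive.
    + by apply: cvg_at_right_filter; exact: cG.
    + by apply: cvg_at_left_filter; exact: cG.
  - by move=> x _; rewrite derive1E derive_val.
have H : (\int[mu]_x (f \_ (I n)) x) @[n --> \oo] --> \int[mu]_x f x.
  apply: (@Dom_cvg R _ _ C).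
  - move=> n; apply/(measurable_restrictT _ _).1; first exact: measurable_itv.
    exact: measurable_funTS.
  - by move=> n x; rewrite /patch; case: ifP => _ //; rewrite normr0 mulr_ge0// hw_ge0.
  - move=> x; apply: cvg_near_cst.
    exists (Num.bound x) => // n /= xn.
    rewrite /patch mem_set// /I /= in_itv/= -ler_norml.
    rewrite (le_trans (ltW (archi_boundP (normr_ge0 _))))// ler_nat.
    apply: leq_trans (leqnSn _); apply: leq_trans xn.
    by rewrite /Num.bound normr_id.
have H' : (\int[mu]_x (f \_ (I n)) x) @[n --> \oo] --> L1 - L2.
  under eq_fun do rewrite E.
  apply: cvgB.
    by rewrite (cvg_shiftS (fun n => G n%:R)).
  by rewrite (cvg_shiftS (fun n => G (- n%:R))).
exact: (cvg_unique _ H H').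
Qed.

Definition cder (f f' : R -> R[i]) := forall t,
  is_derive t (1:R) (fun t => re (f t)) (re (f' t)) /\
  is_derive t (1:R) (fun t => im (f t)) (im (f' t)).

Definition ccont (f : R -> R[i]) :=
  continuous (fun t => re (f t)) /\ continuous (fun t => im (f t)).

Lemma cder_cont f f' : cder f f' -> ccont f.
Proof.
move=> df; split => t; have [d1 d2] := df t; apply: differentiable_continuous;
  apply/derivable1_diffP; exact: ex_derive.
Qed.

Lemma ccont_meas f : ccont f -> cmeas f.
Proof. by move=> [c1 c2]; split; exact: continuous_measurable_fun. Qed.

Lemma cder_ext f g f' g' : f =1 g -> f' =1 g' -> cder f f' -> cder g g'.
Proof. by move=> /funext -> /funext ->. Qed.

Lemma cder_cst c : cder (fun=> c) (fun=> 0).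
Proof. by move=> t; split; apply: is_derive_cst. Qed.

Lemma cder_id : cder (fun t => t%:C) (fun=> 1).
Proof. by move=> t; split => /=; [exact: is_derive_id|exact: is_derive_cst]. Qed.

Lemma cderD f g f' g' : cder f f' -> cder g g' ->
  cder (fun t => f t + g t) (fun t => f' t + g' t).
Proof.
move=> df dg t; have [f1 f2] := df t; have [g1 g2] := dg t; split.
  under eq_fun do rewrite reD.
  by apply: is_derive_eq (is_deriveD f1 g1) _; rewrite reD.
under eq_fun do rewrite imD.
by apply: is_derive_eq (is_deriveD f2 g2) _; rewrite imD.
Qed.

Lemma cderM f g f' g' : cder f f' -> cder g g' ->
  cder (fun t => f t * g t) (fun t => f' t * g t + f t * g' t).
Proof.
move=> df dg t; have [f1 f2] := df t; have [g1 g2] := dg t; split.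
  under eq_fun do rewrite reM.
  apply: is_derive_eq (is_deriveB (is_deriveM f1 g1) (is_deriveM f2 g2)) _.
  by rewrite reD !reM /GRing.scale/=; ring.
under eq_fun do rewrite imM.
apply: is_derive_eq (is_deriveD (is_deriveM f1 g2) (is_deriveM f2 g1)) _.
by rewrite imD !imM /GRing.scale/=; ring.
Qed.

Lemma cderN f f' : cder f f' -> cder (fun t => - f t) (fun t => - f' t).
Proof.
move=> /(cderM (cder_cst (-1))); apply: cder_ext => t.
  by rewrite mulN1r.
by rewrite mul0r add0r mulN1r.
Qed.

Lemma cderV (f f' : R -> R[i]) : (forall t, f t != 0) -> cder f f' ->
  cder (fun t => (f t)^-1) (fun t => - (f' t) * (f t)^-1 ^+ 2).
Proof.
move=> f0 df t; have [f1 f2] := df t.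
have q0 : re (f t) ^+ 2 + im (f t) ^+ 2 != 0.
  by rewrite -cm_sq sqrf_eq0 cm_eq0.
have dq : is_derive t (1:R) (fun t => (re (f t) ^+ 2 + im (f t) ^+ 2)^-1)
    (- (re (f t) ^+ 2 + im (f t) ^+ 2) ^- 2 * (2 * re (f t) * re (f' t) + 2 * im (f t) * im (f' t))).
  have := @is_deriveV R (fun t => (re (f t) ^+ 2 + im (f t) ^+ 2)) t _ 1 q0
   (is_deriveD (is_deriveX 2 f1) (is_deriveX 2 f2)).
  by move=> h; apply: is_derive_eq h _; rewrite /GRing.scale/= !expr1; ring.
have k1 (a b a' b' : R) : a ^+ 2 + b ^+ 2 != 0 ->
    a * (- (a ^+ 2 + b ^+ 2) ^- 2 * (2 * a * a' + 2 * b * b')) + (a ^+ 2 + b ^+ 2)^-1 * a' =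
    re (- (Complex a' b') * (Complex a b)^-1 ^+ 2).
  move=> ab; rewrite !(expr2 (_^-1)) !(reM, imM, reN, imN, reV, imV) /=.
  by field.
have k2 (a b a' b' : R) : a ^+ 2 + b ^+ 2 != 0 ->
    - b * (- (a ^+ 2 + b ^+ 2) ^- 2 * (2 * a * a' + 2 * b * b')) - (a ^+ 2 + b ^+ 2)^-1 * b' =
    im (- (Complex a' b') * (Complex a b)^-1 ^+ 2).
  move=> ab; rewrite !(expr2 (_^-1)) !(reM, imM, reN, imN, reV, imV) /=.
  by field.
have cE (z : R[i]) : z = Complex (re z) (im z) by case: z.
split.
  under eq_fun do rewrite reV.
  apply: is_derive_eq (is_deriveM f1 dq) _.
  by rewrite [in RHS](cE (f t)) [in RHS](cE (f' t)) -k1.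
under eq_fun do rewrite imV.
apply: is_derive_eq (is_deriveM (is_deriveN f2) dq) _.
rewrite [in RHS](cE (f t)) [in RHS](cE (f' t)) -k2//.
by rewrite /GRing.scale/= mulrN.
Qed.

Lemma cint_FTC G f L1 L2 : cder G f -> ccont f -> cDom f ->
  (re (G n%:R) @[n --> \oo] --> re L1) -> (im (G n%:R) @[n --> \oo] --> im L1) ->
  (re (G (- n%:R)) @[n --> \oo] --> re L2) -> (im (G (- n%:R)) @[n --> \oo] --> im L2) ->
  cint f = L1 - L2.
Proof.
move=> dG [c1 c2] Df h1 h2 h3 h4; apply: complex_ext.
  rewrite reD reN; apply: (@Rint_FTC (fun t => re (G t))) => //.
    by move=> t; have [] := dG t.
  exact: cDom_re.
rewrite imD imN; apply: (@Rint_FTC (fun t => im (G t))) => //.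
  by move=> t; have [] := dG t.
exact: cDom_im.
Qed.

(* vanishing at infinity *)
Lemma cint_FTC0 G f (C : R) : cder G f -> ccont f -> cDom f ->
  (forall t, cm (G t) * `|t| <= C) -> cint f = 0.
Proof.
move=> dG cf Df GC.
have k0 : C * (n%:R^-1) @[n --> \oo] --> (0:R).
  rewrite -[X in _ --> X](mulr0 C); apply: cvgMl_tmp.
  by rewrite -cvg_shiftS; exact: cvg_harmonic.
have H (g : R -> R) : (forall t, `|g t| <= cm (G t)) ->
    (g n%:R @[n --> \oo] --> (0:R)) /\ (g (- n%:R) @[n --> \oo] --> (0:R)).
  move=> gG; split; apply/norm_cvg0P; apply: (squeeze_cvgr _ (cvg_cst 0) k0);
  (near=> n; rewrite normr_ge0/=; apply: (le_trans (gG _));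
   rewrite ler_pdivlMr; last by near: n; exists 1%N => // m /= m1; rewrite ltr0n).
    by have := GC n%:R; rewrite normr_nat.
  by have := GC (- n%:R); rewrite normrN normr_nat.
have [a1 a2] := H (fun t => re (G t)) (fun t => re_le_cm _).
have [b1 b2] := H (fun t => im (G t)) (fun t => im_le_cm _).
by rewrite (@cint_FTC G f 0 0)// subr0.
Unshelve. all: end_near. Qed.

End ftc_line.

Section kernel_integrals.
Variable R : realType.
Local Notation re := (@complex.Re R).
Local Notation im := (@complex.Im R).
Local Notation mu := (@lebesgue_measure R).
Implicit Types (z : R[i]) (s : seq R[i]) (t : R).

Definition nonreal z := im z != 0.

Definition kfun s t : R[i] := \prod_(z <- s) (t%:C - z)^-1.
Definition kap s : R[i] := cint (kfun s).

Lemma kfun_cons z s t : kfun (z :: s) t = (t%:C - z)^-1 * kfun s t.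
Proof. by rewrite /kfun big_cons. Qed.

Lemma kfun_nil t : kfun [::] t = 1. Proof. by rewrite /kfun big_nil. Qed.

Lemma kap_perm s s' : perm_eq s s' -> kap s = kap s'.
Proof. by move=> ss'; apply: eq_cint => t; exact: perm_big. Qed.

Lemma line_neq0 z t : nonreal z -> t%:C - z != 0.
Proof.
move=> nz; apply/eqP => /(congr1 im); rewrite imD imN sub0r => /eqP.
by rewrite oppr_eq0 (negPf nz).
Qed.

Lemma line_inv_le z t : nonreal z -> cm (t%:C - z)^-1 <= `|im z|^-1.
Proof.
move=> nz; rewrite cmV lef_pV2 ?posrE ?normr_gt0// ?cm_gt0 ?line_neq0//.
have := im_le_cm (t%:C - z).
by rewrite imD imN sub0r normrN.
Qed.

Lemma line_inv_sq z : nonreal z ->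
  exists2 C : R, 0 <= C & forall t, cm (t%:C - z)^-1 ^+ 2 <= C * hw t.
Proof.
move=> nz.
have y0 : 0 < im z ^+ 2 by rewrite exprn_even_gt0.
have P0 : 0 <= (1 + 2 * re z ^+ 2) / im z ^+ 2.
  by rewrite divr_ge0 ?(ltW y0)// addr_ge0// mulr_ge0// sqr_ge0.
exists (2 + (1 + 2 * re z ^+ 2) / im z ^+ 2); first by rewrite addr_ge0.
move=> t; rewrite cmV exprVn cm_sq reD imD reN imN /= sub0r sqrrN.
set x := re z in P0 *; set y := im z in y0 P0 *.
have q0 : 0 < (t - x) ^+ 2 + y ^+ 2 by rewrite ltr_wpDl// sqr_ge0.
rewrite /hw ler_pdivlMr ?ltr_wpDr ?sqr_ge0// mulrC ler_pdivrMr//.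
have -> : (2 + (1 + 2 * x ^+ 2) / y ^+ 2) * ((t - x) ^+ 2 + y ^+ 2) =
  (1 + t ^+ 2) + ((t - 2 * x) ^+ 2 + 2 * y ^+ 2 + (1 + 2 * x ^+ 2) / y ^+ 2 * (t - x) ^+ 2).
  by field; rewrite /y -[_ != 0]/(nonreal z).
by rewrite lerDl !addr_ge0 ?sqr_ge0// mulr_ge0 ?sqr_ge0.
Qed.

Lemma line_cder z : cder (fun t => t%:C - z) (fun=> 1).
Proof.
by apply: (cder_ext _ _ (cderD (@cder_id R) (cder_cst (- z)))) => t //; rewrite addr0.
Qed.

Lemma line_inv_cder z : nonreal z ->
  cder (fun t => (t%:C - z)^-1) (fun t => - (t%:C - z)^-1 ^+ 2).
Proof.
move=> nz; apply: (cder_ext _ _ (cderV _ (line_cder z))) => //.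
  by move=> t; rewrite mulN1r.
by move=> t; exact: line_neq0.
Qed.

Lemma line_inv_cmeas z : nonreal z -> cmeas (fun t => (t%:C - z)^-1).
Proof.
by move=> nz; apply: ccont_meas; exact: cder_cont (line_inv_cder nz).
Qed.

Lemma kfun_cder s : all nonreal s ->
  cder (kfun s) (fun t => - (\sum_(z <- s) (t%:C - z)^-1) * kfun s t).
Proof.
elim: s => [_|z s IH /= /andP[nz ns]].
  apply: (cder_ext _ _ (cder_cst 1)) => t; first by rewrite kfun_nil.
  by rewrite big_nil oppr0 mul0r.
apply: (cder_ext _ _ (cderM (line_inv_cder nz) (IH ns))) => t.
  by rewrite kfun_cons.
by rewrite big_cons kfun_cons; ring.
Qed.

Lemma kfun_meas s : all nonreal s -> cmeas (kfun s).
Proof. by move=> /kfun_cder /cder_cont /ccont_meas. Qed.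

Lemma kfun_bounded s : all nonreal s -> exists2 M : R, 0 <= M & forall t, cm (kfun s t) <= M.
Proof.
elim: s => [_|z s IH /= /andP[nz ns]].
  by exists 1 => // t; rewrite kfun_nil cm1.
have [M M0 sM] := IH ns.
exists (`|im z|^-1 * M); first by rewrite mulr_ge0// invr_ge0.
by move=> t; rewrite kfun_cons cmM ler_pM ?cm_ge0// line_inv_le.
Qed.

Lemma kfun_Dom s : all nonreal s -> (1 < size s)%N -> cDom (kfun s).
Proof.
case: s => [//|z1 [//|z2 s]] /= /and3P[n1 n2 ns] _.
have [M M0 sM] := kfun_bounded ns.
apply: (@cDom_ext R (fun t => kfun s t * ((t%:C - z1)^-1 * (t%:C - z2)^-1))).
  by move=> t; rewrite !kfun_cons mulrC mulrA.
apply: (cDomM (kfun_meas ns) sM); split.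
  by apply: cmeasM; exact: line_inv_cmeas.
have [C1 C10 h1] := line_inv_sq n1; have [C2 C20 h2] := line_inv_sq n2.
exists (C1 + C2) => t; rewrite cmM mulrDl (le_trans _ (lerD (h1 t) (h2 t)))//.
set a := cm _; set b := cm _.
have := sqr_ge0 (a - b); have : 0 <= a * b by rewrite mulr_ge0// cm_ge0.
by rewrite sqrrB; nra.
Qed.

Lemma pfun_split (p : {poly R[i]}) z s : nonreal z ->
  exists2 p1 : {poly R[i]}, size p1 = (size p).-1 &
  forall t, p.[t%:C] * kfun (z :: s) t = p.[z] * kfun (z :: s) t + p1.[t%:C] * kfun s t.
Proof.
move=> nz; exists (p %/ ('X - z%:P)).
  by rewrite size_divp ?polyXsubC_eq0// size_XsubC subn1.
move=> t; rewrite {1}(divp_eq p ('X - z%:P)) modp_XsubC hornerD hornerM hornerXsubC hornerC.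
rewrite mulrDl addrC; congr (_ + _).
by rewrite kfun_cons -!mulrA; congr (_ * _); rewrite mulrA mulfV ?mul1r// line_neq0.
Qed.

Lemma pfun_Dom (p : {poly R[i]}) s : all nonreal s -> (size p < size s)%N ->
  cDom (fun t => p.[t%:C] * kfun s t).
Proof.
elim: s p => [//|z s IH] p /= /andP[nz ns] ps.
have [p1 p1s pE] := pfun_split p s nz.
have [p0|] := posnP (size p).
  apply: (cDom_ext _ (@cDom0 R)) => t.
  by move: p0 => /eqP; rewrite size_poly_eq0 => /eqP ->; rewrite horner0 mul0r.
move=> p0; apply: (@cDom_ext R (fun t => p.[z] * kfun (z :: s) t + p1.[t%:C] * kfun s t)).
  by move=> t; rewrite pE.
apply: cDomD; first by apply: cDomZ; apply: kfun_Dom; [rewrite /= nz|exact: leq_ltn_trans p0 ps].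
by apply: IH => //; rewrite p1s prednK.
Qed.

(* rate of decay *)
Lemma cvg0_decay (g : R -> R) (C : R) : (forall t, `|g t| * `|t| <= C) ->
  (g n%:R @[n --> \oo] --> (0:R)) /\ (g (- n%:R) @[n --> \oo] --> (0:R)).
Proof.
move=> gC.
have k0 : C * (n%:R^-1) @[n --> \oo] --> (0:R).
  rewrite -[X in _ --> X](mulr0 C); apply: cvgMl_tmp.
  by rewrite -cvg_shiftS; exact: cvg_harmonic.
split; apply/norm_cvg0P; apply: (squeeze_cvgr _ (cvg_cst 0) k0);
  (near=> n; rewrite normr_ge0/=;
   rewrite ler_pdivlMr; last by near: n; exists 1%N => // m /= m1; rewrite ltr0n).
  by have := gC n%:R; rewrite normr_nat.
by have := gC (- n%:R); rewrite normrN normr_nat.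
Unshelve. all: end_near. Qed.

Lemma cvg_atan_line (x y : R) : y != 0 ->
  (atan ((n%:R - x) / y) @[n --> \oo] --> Num.sg y * (pi / 2)) /\
  (atan ((- n%:R - x) / y) @[n --> \oo] --> - (Num.sg y * (pi / 2))).
Proof.
have pos (u v : R) : 0 < v -> atan ((n%:R - u) / v) @[n --> \oo] --> pi / 2.
  move=> v0; apply: (cvg_comp (fun n : nat => (n%:R - u) / v) atan); last exact: cvgy_atan.
  apply/cvgryPge => A; near=> n.
  rewrite ler_pdivlMr// lerBrDr; near: n; exact: nbhs_infty_ger.
have gen (u v : R) : v != 0 -> atan ((n%:R - u) / v) @[n --> \oo] --> Num.sg v * (pi / 2).
  move=> v0; have [vn|vp|v00] := ltgtP v 0.
  - rewrite ltr0_sg// mulN1r.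
    rewrite (_ : (fun n => _) = (fun n : nat => - atan ((n%:R - u) / (- v)))).
      by apply: cvgN; apply: pos; rewrite oppr_gt0.
    by apply/funext => n; rewrite -atanN invrN mulrN opprK.
  - by rewrite gtr0_sg// mul1r; exact: pos.
  - by rewrite v00 eqxx in v0.
move=> y0; split; first exact: gen.
rewrite (_ : (fun n => _) = (fun n : nat => - atan ((n%:R - (- x)) / y))).
  by apply: cvgN; exact: gen.
by apply/funext => n; rewrite -atanN opprK -mulNr opprD.
Unshelve. all: end_near. Qed.

Definition lineG z t : R[i] :=
  Complex (ln ((t - re z) ^+ 2 + im z ^+ 2) / 2) (atan ((t - re z) / im z)).

Lemma lineG_cder z : nonreal z -> cder (lineG z) (fun t => (t%:C - z)^-1).
Proof.
move=> nz t; set x := re z; set y := im z.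
have y0 : y != 0 := nz.
have q0 : 0 < (t - x) ^+ 2 + y ^+ 2.
  by rewrite ltr_wpDl ?sqr_ge0// exprn_even_gt0.
have dl : is_derive t (1:R) (fun t : R => t - x) 1.
  by apply: is_derive_eq (is_deriveB (is_derive_id t 1) (is_derive_cst x t 1)) _; rewrite subr0.
have dq : is_derive t (1:R) (fun t : R => (t - x) ^+ 2 + y ^+ 2) (2 * (t - x)).
  apply: is_derive_eq (is_deriveD (is_deriveX 2 dl) (is_derive_cst (y ^+ 2) t 1)) _.
  by rewrite /GRing.scale/= expr1; ring.
split.
  have dln : is_derive ((t - x) ^+ 2 + y ^+ 2) (1:R) (@ln R) ((t - x) ^+ 2 + y ^+ 2)^-1.
    exact: is_derive1_ln.
  have h := @is_derive1_comp R (@ln R) (fun t => (t - x) ^+ 2 + y ^+ 2) t _ _ dln dq.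
  have h2 := is_deriveM h (is_derive_cst (2^-1 : R) t 1).
  apply: is_derive_eq h2 _.
  rewrite reV reD imD reN imN /= sub0r sqrrN -/x -/y /GRing.scale/=.
  by field; exact: lt0r_neq0.
have dlv : is_derive t (1:R) (fun t : R => (t - x) / y) y^-1.
  apply: is_derive_eq (is_deriveM dl (is_derive_cst (y^-1) t 1)) _.
  by rewrite /GRing.scale/=; ring.
have da : is_derive ((t - x) / y) (1:R) (@atan R) (1 + ((t - x) / y) ^+ 2)^-1.
  exact: is_derive1_atan.
apply: is_derive_eq (@is_derive1_comp R (@atan R) (fun t => (t - x) / y) t _ _ da dlv) _.
rewrite imV reD imD reN imN /= sub0r sqrrN -/x -/y opprK.
field.
by apply/andP; split; [exact: lt0r_neq0 q0|exact: y0].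
Qed.

Definition sgI z : R := Num.sg (im z).

Lemma kap2 z1 z2 : nonreal z1 -> nonreal z2 -> z1 != z2 ->
  kap [:: z1; z2] = (pi * (sgI z1 - sgI z2)) *i / (z1 - z2).
Proof.
move=> n1 n2 z12.
have d0 : z1 - z2 != 0 by rewrite subr_eq0.
pose f t := (t%:C - z1)^-1 - (t%:C - z2)^-1.
have fE t : f t = (z1 - z2) * kfun [:: z1; z2] t.
  have a0 := line_neq0 t n1; have b0 := line_neq0 t n2.
  rewrite /f !kfun_cons kfun_nil mulr1; field.
  by rewrite a0 b0.
have Dk : cDom (kfun [:: z1; z2]) by apply: kfun_Dom => //=; rewrite n1 n2.
have Df : cDom f by apply: (cDom_ext _ (cDomZ (z1 - z2) Dk)) => t; rewrite fE.
pose G t := lineG z1 t - lineG z2 t.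
have dG : cder G f by apply: cderD; [|apply: cderN]; exact: lineG_cder.
have cf : ccont f.
  apply: cder_cont; apply: cderD; [|apply: cderN]; exact: line_inv_cder.
pose q z t := (t - re z) ^+ 2 + im z ^+ 2.
have q0 z t : nonreal z -> 0 < q z t.
  by move=> nz; rewrite /q ltr_wpDl ?sqr_ge0// exprn_even_gt0.
have [C C0 hC] := line_inv_sq n2.
have reG t : re (G t) = ln (q z1 t / q z2 t) / 2.
  by rewrite /G /lineG reD reN /= -/(q z1 t) -/(q z2 t) ln_div ?posrE ?q0// mulrBl.
pose g t := q z1 t / q z2 t - 1.
have gdec : exists K : R, forall t, `|g t| * `|t| <= K.
  pose a := 2 * (re z2 - re z1); pose b := re z1 ^+ 2 + im z1 ^+ 2 - re z2 ^+ 2 - im z2 ^+ 2.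
  exists (2 * (`|a| + `|b|) * C) => t.
  have gE : g t = (a * t + b) / q z2 t.
    rewrite /g -[X in _ - X](@divff _ (q z2 t)) ?lt0r_neq0 ?q0//.
    by rewrite -mulrBl; congr (_ / _); rewrite /q /a /b; ring.
  have qV0 : 0 <= (q z2 t)^-1 by rewrite invr_ge0 ltW// q0.
  rewrite gE normrM (ger0_norm qV0).
  have qV : (q z2 t)^-1 <= C * hw t.
    have := hC t; rewrite cmV exprVn cm_sq reD imD reN imN /= sub0r sqrrN.
    by [].
  apply: (@le_trans _ _ (`|a * t + b| * `|t| * (C * hw t))).
    rewrite mulrAC ler_wpM2l// mulr_ge0//.
  have hp : 0 < 1 + t ^+ 2 by rewrite ltr_wpDr ?sqr_ge0.
  rewrite /hw mulrA ler_pdivrMr// [leRHS]mulrAC ler_wpM2r//.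
  apply: (@le_trans _ _ ((`|a| * `|t| + `|b|) * `|t|)).
    by rewrite ler_wpM2r// -normrM ler_normD.
  have tt : t ^+ 2 = `|t| ^+ 2 by rewrite real_normK ?num_real.
  rewrite tt. have ha := normr_ge0 a; have hb := normr_ge0 b; have ht := normr_ge0 t.
  have t1 : `|t| <= 1 + `|t| ^+ 2 by nra.
  set u := `|t| in ht t1 *; set va := `|a| in ha *; set vb := `|b| in hb *.
  have e1 : va * u * u <= va * (1 + u ^+ 2).
    by rewrite -mulrA ler_wpM2l// expr2 lerDr.
  have e2 : vb * u <= vb * (1 + u ^+ 2) by rewrite ler_wpM2l.
  have e3 : 0 <= (va + vb) * (1 + u ^+ 2) by rewrite mulr_ge0 ?addr_ge0 ?sqr_ge0.
  by lra.
have [K gK] := gdec.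
have [g1 g2] := cvg0_decay gK.
have lim (u : nat -> R) : g (u n) @[n --> \oo] --> (0:R) ->
    re (G (u n)) @[n --> \oo] --> (0:R).
  move=> gu.
  have r1 : q z1 (u n) / q z2 (u n) @[n --> \oo] --> (1:R).
    rewrite (_ : (fun n => _) = (fun n => g (u n) + 1)); last first.
      by apply/funext => n; rewrite /g subrK.
    by rewrite -[X in _ --> X]add0r; apply: cvgD => //; exact: cvg_cst.
  have r2 : ln (q z1 (u n) / q z2 (u n)) @[n --> \oo] --> ln (1:R).
    by apply: (cvg_comp _ _ r1); exact: continuous_ln.
  under eq_fun do rewrite reG.
  suff : ln (q z1 (u n) / q z2 (u n)) / 2 @[n --> \oo] --> ln (1:R) / 2 by rewrite ln1 mul0r.
  exact: cvgMr_tmp.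
have [a11 a12] := cvg_atan_line (re z1) n1.
have [a21 a22] := cvg_atan_line (re z2) n2.
have H := @cint_FTC R G f (Complex 0 (pi / 2 * (sgI z1 - sgI z2)))
  (Complex 0 (- (pi / 2 * (sgI z1 - sgI z2)))) dG cf Df.
have {}H : cint f = (pi * (sgI z1 - sgI z2)) *i.
  rewrite H.
  - apply: complex_ext; rewrite ?reD ?imD ?reN ?imN /=; first by rewrite subr0.
    by field.
  - exact: lim.
  - rewrite (_ : (fun n => _) = (fun n : nat => atan ((n%:R - re z1) / im z1) - atan ((n%:R - re z2) / im z2))); last first.
      by apply/funext => n; rewrite /G imD imN.
    by rewrite /= mulrC mulrBl; exact: cvgB.
  - exact: lim.
  - rewrite (_ : (fun n => _) = (fun n : nat => atan ((- n%:R - re z1) / im z1) - atan ((- n%:R - re z2) / im z2))); last first.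
      by apply/funext => n; rewrite /G imD imN.
    by rewrite /= mulrC mulrBl opprD; exact: cvgB.
have := cintZ (z1 - z2) Dk; rewrite -(eq_cint fE) H => ->.
by rewrite mulrAC mulfV// mul1r.
Qed.

Lemma kap_rec z1 z2 s : nonreal z1 -> nonreal z2 -> all nonreal s -> (0 < size s)%N ->
  (z1 - z2) * kap [:: z1, z2 & s] = kap (z1 :: s) - kap (z2 :: s).
Proof.
move=> n1 n2 ns s0.
rewrite /kap -cintZ; last by apply: kfun_Dom => //=; rewrite n1 n2.
rewrite -cintB; [|by apply: kfun_Dom => //=; rewrite ?n1 ?n2..].
apply: eq_cint => t; rewrite !kfun_cons.
have a0 := line_neq0 t n1; have b0 := line_neq0 t n2.
by field; rewrite a0 b0.
Qed.

Lemma kfun_nseq n z t : kfun (nseq n z) t = (t%:C - z)^-1 ^+ n.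
Proof. by rewrite /kfun big_nseq; elim: n => //= n ->; rewrite exprS. Qed.

Lemma kap_nseq n z : nonreal z -> kap (nseq n.+2 z) = 0.
Proof.
move=> nz.
have nzs k : all nonreal (nseq k z) by rewrite all_nseq nz orbT.
have [M M0 hM] := kfun_bounded (nzs n).
apply: (@cint_FTC0 R (fun t => - n.+1%:R^-1 * kfun (nseq n.+1 z) t) _
   (cm (n.+1%:R^-1 : R[i]) * ((1 + cm z / `|im z|) * M))).
- apply: (cder_ext _ _ (cderM (cder_cst _) (kfun_cder (nzs _)))) => t //.
  rewrite mul0r add0r !kfun_nseq big_nseq iter_addr_0 [in RHS]exprS.
  set u := (_ - _)^-1; set v := u ^+ n.+1.
  have n0 : (n.+1%:R : R[i]) != 0 by rewrite pnatr_eq0.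
  by rewrite mulNr mulNr mulrN opprK -[u *+ _]mulr_natr mulrCA -mulrA mulVKf.
- exact: cder_cont (kfun_cder (nzs _)).
- by apply: kfun_Dom => //; rewrite size_nseq.
move=> t; rewrite cmM cmN -mulrA ler_wpM2l ?cm_ge0//.
rewrite kfun_cons cmM mulrAC ler_pM ?mulr_ge0 ?cm_ge0//.
have tz : `|t| <= cm (t%:C - z) + cm z.
  by rewrite -cm_real; have := cmD (t%:C - z) z; rewrite subrK.
have c0 : 0 < cm (t%:C - z) by rewrite cm_gt0 line_neq0.
apply: (le_trans (ler_wpM2l (cm_ge0 _) tz)).
rewrite mulrDr {1}cmV mulVf ?lt0r_neq0// lerD2l mulrC ler_wpM2l ?cm_ge0//.
exact: line_inv_le.
Qed.

End kernel_integrals.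

Section nodes_induction.
Variable T : eqType.

Lemma seq_nseq_or_distinct (s : seq T) : (1 < size s)%N ->
  (exists n z, s = nseq n.+2 z) \/
  exists z1 z2 s', z1 != z2 /\ perm_eq s [:: z1, z2 & s'].
Proof.
case: s => [//|z s] /= s0; have [/all_pred1P sE|] := boolP (all (pred1 z) s).
  by left; case: s sE s0 => // a s /= -> _; exists (size s), z.
rewrite -has_predC => /hasP [y ys /= yz]; right.
exists z, y, (rem y s); split; first by rewrite eq_sym.
by rewrite perm_cons perm_to_rem.
Qed.

Lemma nodes_ind (P : seq T -> Prop) :
  (forall s s', perm_eq s s' -> P s -> P s') ->
  (forall n z, P (nseq n.+2 z)) ->
  (forall z1 z2, z1 != z2 -> P [:: z1; z2]) ->
  (forall z1 z2 s, z1 != z2 -> (0 < size s)%N -> P (z1 :: s) -> P (z2 :: s) ->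
     P [:: z1, z2 & s]) ->
  forall s, (1 < size s)%N -> P s.
Proof.
move=> Pperm Pn P2 Prec s; move: {2}(size s) (leqnn (size s)) => n.
elim: n s => [[]//|n IH] s sn s1.
have [[k [z ->]]//|[z1 [z2 [s' [z12 ps]]]]] := seq_nseq_or_distinct s1.
apply: (Pperm _ _ (_ : perm_eq [:: z1, z2 & s'] s)); first by rewrite perm_sym.
have := perm_size ps => /= sE; have [s'0|s'0] := posnP (size s').
  by rewrite (size0nil s'0); exact: P2.
by apply: Prec => //; apply: IH => //=; lia.
Qed.

End nodes_induction.

Section kernel_integrals2.
Variable R : realType.
Local Notation re := (@complex.Re R).
Local Notation im := (@complex.Im R).
Implicit Types (z : R[i]) (s : seq R[i]) (t : R).

Lemma kap_same s (e : R) : all (@nonreal R) s -> all (fun z => sgI z == e) s ->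
  (1 < size s)%N -> kap s = 0.
Proof.
move=> ns es s1; move: s s1 ns es; apply: nodes_ind.
- move=> s s' ss' h; rewrite -!(perm_all _ ss') => ns es.
  by rewrite -(kap_perm ss') h.
- by move=> n z /=/andP[nz _] _; exact: kap_nseq.
- move=> z1 z2 z12 /= /and3P[n1 n2 _] /and3P[/eqP e1 /eqP e2 _].
  by rewrite kap2// e1 e2 subrr mulr0 mul0r.
- move=> z1 z2 s z12 s0 h1 h2 /= /and3P[n1 n2 ns] /and3P[e1 e2 es].
  apply: (mulfI (_ : z1 - z2 != 0)); first by rewrite subr_eq0.
  by rewrite kap_rec// h1 ?h2 /= ?n1 ?n2 ?e1 ?e2// subrr mulr0.
Qed.

Lemma pkap_same (p : {poly R[i]}) s (e : R) : all (@nonreal R) s ->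
  all (fun z => sgI z == e) s -> (size p < size s)%N ->
  cint (fun t => p.[t%:C] * kfun s t) = 0.
Proof.
elim: s p => [//|z s IH] p /= ns0 es0 ps.
have /andP[nz ns] := ns0; have /andP[ez es] := es0.
have [p1 p1s pE] := pfun_split p s nz.
have [p0|p0] := posnP (size p).
  rewrite -(@cint0 R); apply: eq_cint => t.
  by move: p0 => /eqP; rewrite size_poly_eq0 => /eqP ->; rewrite horner0 mul0r.
have s1 : (1 < size (z :: s))%N by exact: leq_ltn_trans p0 ps.
have ps1 : (size p1 < size s)%N by rewrite p1s prednK.
rewrite (eq_cint pE) cintD.
- rewrite cintZ; last exact: kfun_Dom.
  by rewrite -/(kap _) (@kap_same _ e) ?mulr0 ?add0r ?IH.
- by apply: cDomZ; exact: kfun_Dom.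
- exact: pfun_Dom.
Qed.

Lemma nonreal_pos z : 0 < im z -> nonreal z.
Proof. by move=> z0; rewrite /nonreal gt_eqF. Qed.

Lemma nonreal_neg z : im z < 0 -> nonreal z.
Proof. by move=> z0; rewrite /nonreal lt_eqF. Qed.

Lemma kap_pole u v n : im u < 0 -> 0 < im v ->
  kap (u :: nseq n.+1 v) = - (2 * pi) *i / (u - v) ^+ n.+1.
Proof.
move=> u0 v0.
have nu := nonreal_neg u0; have nv := nonreal_pos v0.
have uv : u - v != 0.
  by apply/eqP => /(congr1 im); rewrite imD imN /= => /eqP; rewrite subr_eq0 => /eqP uv; lra.
elim: n => [|n IH].
  have uv' : u != v by rewrite -subr_eq0.
  rewrite -[nseq 1 v]/[:: v] (kap2 nu nv uv') /sgI (ltr0_sg u0) (gtr0_sg v0) expr1.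
  congr (_ / _).
  by apply: complex_ext; rewrite /= ?oppr0//; ring.
have nsv k : all (@nonreal R) (nseq k v) by rewrite all_nseq nv orbT.
have h := kap_rec nu nv (nsv n.+1) isT.
have k0 : kap (v :: nseq n.+1 v) = 0 by exact: kap_nseq.
move: h; rewrite k0 subr0 IH => h.
apply: (mulfI uv); rewrite -[nseq n.+2 v]/(v :: nseq n.+1 v) h.
by rewrite (exprS _ n.+1) invfM mulrCA mulVKf.
Qed.

Lemma pkap_pole (p : {poly R[i]}) u v n : im u < 0 -> 0 < im v -> (size p <= n.+1)%N ->
  cint (fun t => p.[t%:C] * kfun (u :: nseq n.+1 v) t) =
  - (2 * pi) *i * p.[u] / (u - v) ^+ n.+1.
Proof.
move=> u0 v0 pn.
have nu := nonreal_neg u0; have nv := nonreal_pos v0.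
have nsv k : all (@nonreal R) (nseq k v) by rewrite all_nseq nv orbT.
have [p1 p1s pE] := pfun_split p (nseq n.+1 v) nu.
have Dk : cDom (kfun (u :: nseq n.+1 v)) by apply: kfun_Dom => //=; rewrite nu nv nsv.
have [p0|p0] := posnP (size p).
  move: p0 => /eqP; rewrite size_poly_eq0 => /eqP ->; rewrite horner0 mulr0 mul0r.
  by rewrite -(@cint0 R); apply: eq_cint => t; rewrite horner0 mul0r.
have ps1 : (size p1 < size (nseq n.+1 v))%N by rewrite size_nseq p1s prednK.
rewrite (eq_cint pE) cintD; [|exact: cDomZ|exact: pfun_Dom].
rewrite cintZ// -/(kap _) kap_pole// (@pkap_same _ _ (sgI v)) ?addr0 //.
  by ring.
by rewrite all_nseq eqxx orbT.
Qed.

(* homogeneity *)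
Definition rnodes (w : R[i]) (xs : seq R) := [seq - (w * x%:C) | x <- xs].

Lemma im_rnode w (x : R) : im (- (w * x%:C)) = - (x * im w).
Proof. by rewrite imN imM /= mulr0 add0r mulrC. Qed.

Lemma rnode_nonreal w (x : R) : 0 < im w -> x != 0 -> nonreal (- (w * x%:C)).
Proof.
by move=> w0 x0; rewrite /nonreal im_rnode oppr_eq0 mulf_eq0 negb_or x0 gt_eqF.
Qed.

Lemma rnodes_nonreal w xs : 0 < im w -> all (fun x => x != 0) xs ->
  all (@nonreal R) (rnodes w xs).
Proof.
move=> w0 /allP xs0; apply/allP => z /mapP [x xin ->].
by apply: rnode_nonreal => //; exact: xs0.
Qed.

Lemma kap_homog w w' xs : 0 < im w -> 0 < im w' -> all (fun x => x != 0) xs ->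
  (1 < size xs)%N ->
  w ^+ (size xs).-1 * kap (rnodes w xs) = w' ^+ (size xs).-1 * kap (rnodes w' xs).
Proof.
move=> w0 w'0 xs0 s1; move: xs s1 xs0; apply: nodes_ind.
- move=> s s' ss' h; rewrite -!(perm_all _ ss') => ns.
  by rewrite -(perm_size ss') -!(kap_perm (perm_map _ ss')) h.
- move=> n z /=/andP[nz _].
  have gen v : 0 < im v -> kap (rnodes v (nseq n.+2 z)) = 0.
    by move=> v0; rewrite /rnodes map_nseq; apply: kap_nseq; exact: rnode_nonreal.
  by rewrite !gen// !mulr0.
- move=> x1 x2 x12 /= /and3P[n1 n2 _].
  have gen v : 0 < im v -> v ^+ 1 * kap (rnodes v [:: x1; x2]) =
      - ((pi * (Num.sg x2 - Num.sg x1)) *i / (x1%:C - x2%:C)).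
    move=> v0.
    have v00 : v != 0 by apply/eqP => ve; rewrite ve /= ltxx in v0.
    have d0 : x1%:C - x2%:C != 0 :> R[i] by rewrite subr_eq0; apply: contra x12 => /eqP/complexI ->.
    have sgE x : sgI (- (v * x%:C)) = - Num.sg x.
      by rewrite /sgI im_rnode sgrN sgrM (gtr0_sg v0) mulr1.
    rewrite kap2.
    + rewrite !sgE expr1.
      rewrite (_ : - Num.sg x1 - - Num.sg x2 = Num.sg x2 - Num.sg x1); last by ring.
      rewrite (_ : - (v * x1%:C) - - (v * x2%:C) = - v * (x1%:C - x2%:C)); last by ring.
      by rewrite invfM invrN mulNr !mulrN [_ * (v^-1 * _)]mulrCA mulVKf.
    + exact: rnode_nonreal.
    + exact: rnode_nonreal.
    + by rewrite eqr_opp; apply: contra x12 => /eqP /(mulfI v00)/complexI ->.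
  by rewrite !gen.
- move=> x1 x2 s x12 s0 h1 h2 /= /and3P[n1 n2 ns].
  have d0 : x1%:C - x2%:C != 0 :> R[i] by rewrite subr_eq0; apply: contra x12 => /eqP/complexI ->.
  have {}h1 := h1 _; have {}h2 := h2 _.
  have gen v : 0 < im v -> - (x1%:C - x2%:C) * (v ^+ (size s).+1 * kap (rnodes v [:: x1, x2 & s]))
    = v ^+ size s * kap (rnodes v (x1 :: s)) - v ^+ size s * kap (rnodes v (x2 :: s)).
    move=> v0; rewrite -mulrBr -kap_rec ?rnodes_nonreal ?size_map//.
    + by rewrite /rnodes /= exprS; ring.
    + exact: rnode_nonreal.
    + exact: rnode_nonreal.
  apply: (mulfI (_ : - (x1%:C - x2%:C) != 0 :> R[i])); first by rewrite oppr_eq0.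
  rewrite !gen//; congr (_ - _).
    by apply: h1; rewrite /= n1.
  by apply: h2; rewrite /= n2.
Qed.

(* integration by parts *)
Lemma kap_parts s : all (@nonreal R) s -> (1 < size s)%N ->
  cDom (fun t => t%:C * (\sum_(z <- s) (t%:C - z)^-1) * kfun s t) /\
  cint (fun t => t%:C * (\sum_(z <- s) (t%:C - z)^-1) * kfun s t) = kap s.
Proof.
move=> ns s1.
have Dk := kfun_Dom ns s1.
have Ds : cDom (fun t => t%:C * (\sum_(z <- s) (t%:C - z)^-1) * kfun s t).
  apply: (@cDom_ext R (fun t => \sum_(z <- s | z \in s) ('X).[t%:C] * kfun (z :: s) t)).
    move=> t; rewrite -big_seq -mulrA mulr_suml mulr_sumr.
    by apply: eq_bigr => z _; rewrite hornerX kfun_cons.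
  apply: cDom_sum => z zs; apply: pfun_Dom; last by rewrite size_polyX.
  by rewrite /= ns (allP ns).
split => //.
apply/eqP; rewrite -subr_eq0 -oppr_eq0 opprB -cintB//; apply/eqP.
have [M M0 sM] : exists2 M : R, 0 <= M & forall t, (1 + t ^+ 2) * cm (kfun s t) <= M.
  have [_ [C hC]] := Dk; exists C.
    by have := le_trans (cm_ge0 _) (hC 0); rewrite pmulr_lge0// hw_gt0.
  move=> t; rewrite mulrC -ler_pdivlMr; first exact: hC.
  by rewrite ltr_wpDr ?sqr_ge0.
apply: (@cint_FTC0 R (fun t => t%:C * kfun s t) _ M).
- apply: (cder_ext _ _ (cderM (@cder_id R) (kfun_cder ns))) => t //.
  by ring.
- have [h hs] : exists h, cder (fun t => \sum_(z <- s) (t%:C - z)^-1) h.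
    elim: s ns {s1 Dk Ds sM} => [_|z s IH /= /andP[nz ns]].
      by exists (fun=> 0); apply: (cder_ext _ _ (cder_cst 0)) => t //; rewrite big_nil.
    have [h hs] := IH ns; exists (fun t => - (t%:C - z)^-1 ^+ 2 + h t).
    apply: (cder_ext _ _ (cderD (line_inv_cder nz) hs)) => t //.
    by rewrite big_cons.
  have kd := kfun_cder ns.
  exact: cder_cont (cderD kd (cderN (cderM (cderM (@cder_id R) hs) kd))).
- exact: cDomB.
- move=> t; apply: (le_trans _ (sM t)); rewrite cmM cm_real.
  rewrite mulrAC -expr2 real_normK ?num_real//.
  by rewrite ler_wpM2r ?cm_ge0// lerDr.
Qed.

End kernel_integrals2.

Section eigenvalue_lists.
Variable R : realType.
Local Notation C := R[i].
Local Notation re := (@complex.Re R).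
Local Notation im := (@complex.Im R).

Lemma poly_eq_nat (F : numFieldType) (p q : {poly F}) :
  (forall n : nat, p.[n.+1%:R] = q.[n.+1%:R]) -> p = q.
Proof.
move=> pq; apply/eqP; rewrite -subr_eq0; apply/eqP.
apply: (@roots_geq_poly_eq0 _ _ [seq (n.+1%:R : F) | n <- iota 0 (size (p - q))]).
- by apply/allP => x /mapP [n _ ->]; rewrite /root hornerD hornerN pq subrr.
- rewrite map_inj_uniq ?iota_uniq// => a b /eqP.
  by rewrite eqr_nat eqSS => /eqP.
- by rewrite size_map size_iota.
Qed.

Lemma horner_char_poly (F : comNzRingType) d (M : 'M[F]_d) x :
  (char_poly M).[x] = \det (x%:M - M).
Proof.
rewrite /char_poly -[LHS]/(horner_eval x _) -det_map_mx; congr (\det _).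
apply/matrixP => i j; rewrite !mxE /= /horner_eval hornerD hornerN hornerC.
by rewrite hornerMn hornerX.
Qed.

Variable d : nat.
Implicit Types (M : 'M[C]_d) (s : seq C).

Lemma detN M : \det (- M) = (-1) ^+ d * \det M.
Proof. by rewrite -scaleN1r detZ. Qed.

Lemma det_eigvals M x : \det (x%:M - M) = \prod_(z <- eigvals M) (x - z).
Proof.
rewrite -horner_char_poly char_poly_eigvals horner_prod.
by apply: eq_bigr => z _; rewrite hornerXsubC.
Qed.

Lemma size_eigvals M : size (eigvals M) = d.
Proof.
have := size_char_poly M; rewrite char_poly_eigvals size_prod_XsubC.
by move=> [].
Qed.

Lemma eigvals_perm M s :
  (forall n : nat, \det (n.+1%:R%:M - M) = \prod_(z <- s) (n.+1%:R - z)) ->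
  perm_eq (eigvals M) s.
Proof.
move=> h; apply: prod_XsubC_eq; apply: poly_eq_nat => n.
rewrite -char_poly_eigvals horner_char_poly h horner_prod.
by apply: eq_bigr => z _; rewrite hornerXsubC.
Qed.

Lemma trace_eigvals M : \tr M = \sum_(z <- eigvals M) z.
Proof.
have := size_eigvals M; case: d M => [|n] M sM.
  by rewrite (size0nil sM) big_nil /mxtrace big_ord0.
have := char_poly_trace M isT; rewrite char_poly_eigvals /=.
have := @coefPn_prod_XsubC _ (eigvals M); rewrite sM => /(_ isT) /= ->.
by move=> /oppr_inj.
Qed.

Lemma eigvals_shift M x : perm_eq (eigvals (M - x%:M)) [seq z - x | z <- eigvals M].
Proof.
apply: eigvals_perm => n; rewrite opprB addrA -raddfD det_eigvals big_map.
by apply: eq_bigr => z _; rewrite opprB addrA.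
Qed.

Lemma eigvals_neq0 M z : M \in unitmx -> z \in eigvals M -> z != 0.
Proof.
rewrite unitmxE unitfE => M0 zM; apply: contra M0 => /eqP z0.
have := det_eigvals M 0; rewrite (big_rem z zM) /= z0 subrr mul0r.
rewrite raddf0 sub0r detN => /eqP; rewrite mulf_eq0 signr_eq0 orFb => /eqP ->.
by rewrite eqxx.
Qed.

Lemma eigvals_inv M : M \in unitmx ->
  perm_eq (eigvals (invmx M)) [seq z^-1 | z <- eigvals M].
Proof.
move=> Mu; apply: eigvals_perm => n; rewrite big_map.
set x : C := n.+1%:R; have x0 : x != 0 by rewrite pnatr_eq0.
clearbody x.
have detM : \det M = \prod_(z <- eigvals M) z.
  have := det_eigvals M 0; rewrite raddf0 sub0r detN.
  under eq_bigr do rewrite sub0r -mulN1r.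
  rewrite big_split /= big_const_seq iter_mulr_1 count_predT size_eigvals.
  by move/(mulfI _); apply; rewrite signr_eq0.
have -> : x%:M - invmx M = (- x) *: (invmx M *m (x^-1%:M - M)).
  rewrite mulmxBr mulVmx// mul_mx_scalar scalerBr scalerA mulNr mulfV//.
  by rewrite scaleN1r scaleNr opprK addrC scalemx1.
rewrite detZ det_mulmx det_inv detM det_eigvals -prodfV -big_split /=.
have -> : (- x) ^+ d = \prod_(z <- eigvals M) (- x).
  by rewrite big_const_seq iter_mulr_1 count_predT size_eigvals.
rewrite -big_split /= big_seq [RHS]big_seq; apply: eq_bigr => z zM.
have z0 := eigvals_neq0 Mu zM.
by field; rewrite x0 z0.
Qed.

Lemma trace_resolvent M x : M - x%:M \in unitmx ->
  \tr (invmx (M - x%:M)) = \sum_(z <- eigvals M) (z - x)^-1.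
Proof.
move=> u; rewrite trace_eigvals.
transitivity (\sum_(z <- [seq z^-1 | z <- eigvals (M - x%:M)]) z).
  exact: perm_big (eigvals_inv u).
rewrite big_map.
transitivity (\sum_(z <- [seq z - x | z <- eigvals M]) z^-1).
  exact: perm_big (eigvals_shift M x).
by rewrite big_map.
Qed.

Lemma unit_shift M x : (M - x%:M \in unitmx) = (x \notin eigvals M).
Proof.
rewrite unitmxE unitfE -opprB detN mulf_eq0 signr_eq0 /= det_eigvals.
rewrite -has_pred1 prodf_seq_eq0; congr (~~ _).
by apply: eq_has => z /=; rewrite subr_eq0 eq_sym.
Qed.

Definition eigIm M : R := \sum_(z <- eigvals M) `|im z|.

Lemma eigIm_similar M N (P : 'M[C]_d) : P \in unitmx -> M = P *m N *m invmx P ->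
  eigIm M = eigIm N.
Proof.
move=> Pu ->; apply: perm_big; apply: eigvals_perm => n.
rewrite -det_eigvals.
have -> : n.+1%:R%:M - P *m N *m invmx P = P *m (n.+1%:R%:M - N) *m invmx P.
  by rewrite mulmxBr mulmxBl mul_mx_scalar -scalemxAl mulmxV// scalemx1.
rewrite !det_mulmx mulrC mulrA -det_mulmx mulVmx// det1 mul1r //.
Qed.

Lemma eigIm_scale M (c : R) : c != 0 -> eigIm (c%:C *: M) = `|c| * eigIm M.
Proof.
move=> c0; rewrite /eigIm mulr_sumr.
transitivity (\sum_(z <- [seq c%:C * z | z <- eigvals M]) `|im z|); last first.
  by rewrite big_map; apply: eq_bigr => z _; rewrite imM /= mul0r addr0 normrM.
apply: perm_big; apply: eigvals_perm => n; rewrite big_map.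
have cc0 : c%:C != 0 by rewrite (_ : 0 = 0%:C)// (inj_eq (@complexI R)).
have -> : n.+1%:R%:M - c%:C *: M = c%:C *: ((n.+1%:R / c%:C)%:M - M).
  by rewrite scalerBr scale_scalar_mx mulrC divfK.
rewrite detZ det_eigvals.
have -> : c%:C ^+ d = \prod_(z <- eigvals M) c%:C.
  by rewrite big_const_seq iter_mulr_1 count_predT size_eigvals.
rewrite -big_split; apply: eq_bigr => z _ /=.
by rewrite mulrBr mulrC divfK.
Qed.

End eigenvalue_lists.

Section mnorm.
Variable R : realType.
Local Notation C := R[i].

Definition mnorm m n (M : 'M[C]_(m, n)) : R := \sum_i \sum_j cm (M i j).

Lemma mnorm_ge0 m n (M : 'M[C]_(m, n)) : 0 <= mnorm M.
Proof. by apply: sumr_ge0 => i _; apply: sumr_ge0 => j _; exact: cm_ge0. Qed.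

Lemma mnorm_entry m n (M : 'M[C]_(m, n)) i j : cm (M i j) <= mnorm M.
Proof.
rewrite /mnorm (bigD1 i)//= (bigD1 j)//= -addrA lerDl addr_ge0//.
  by apply: sumr_ge0 => k _; exact: cm_ge0.
by apply: sumr_ge0 => k _; apply: sumr_ge0 => l _; exact: cm_ge0.
Qed.

Lemma mnormD m n (M N : 'M[C]_(m, n)) : mnorm (M + N) <= mnorm M + mnorm N.
Proof.
rewrite /mnorm -big_split; apply: ler_sum => i _.
rewrite -big_split; apply: ler_sum => j _.
by rewrite mxE; exact: cmD.
Qed.

Lemma mnormZ m n a (M : 'M[C]_(m, n)) : mnorm (a *: M) = cm a * mnorm M.
Proof.
rewrite /mnorm mulr_sumr; apply: eq_bigr => i _.
by rewrite mulr_sumr; apply: eq_bigr => j _; rewrite mxE cmM.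
Qed.

Lemma mnormN m n (M : 'M[C]_(m, n)) : mnorm (- M) = mnorm M.
Proof. by rewrite -scaleN1r mnormZ cmN cm1 mul1r. Qed.

Lemma mnormM m n p (M : 'M[C]_(m, n)) (N : 'M[C]_(n, p)) :
  mnorm (M *m N) <= mnorm M * mnorm N.
Proof.
apply: (@le_trans _ _ (\sum_i \sum_k \sum_j cm (M i j) * cm (N j k))).
  apply: ler_sum => i _; apply: ler_sum => k _; rewrite mxE.
  apply: (le_trans (cm_sum _ _ _)); apply: ler_sum => j _; by rewrite cmM.
rewrite {1}/mnorm mulr_suml; apply: ler_sum => i _.
rewrite exchange_big mulr_suml; apply: ler_sum => j _ /=.
rewrite -mulr_sumr ler_wpM2l ?cm_ge0// /mnorm [leRHS](bigD1 j)//= lerDl.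
by apply: sumr_ge0 => k _; apply: sumr_ge0 => l _; exact: cm_ge0.
Qed.

Lemma mnorm_tr n (M : 'M[C]_n) : cm (\tr M) <= mnorm M.
Proof.
apply: (le_trans (cm_sum _ _ _)); apply: ler_sum => i _.
rewrite (bigD1 i)//= lerDl; apply: sumr_ge0 => k _; exact: cm_ge0.
Qed.

Lemma mnorm_eq0 m n (M : 'M[C]_(m, n)) : mnorm M = 0 -> M = 0.
Proof.
move=> M0; apply/matrixP => i j; rewrite mxE; apply/eqP; rewrite -cm_eq0.
by rewrite eq_le cm_ge0 andbT -M0 mnorm_entry.
Qed.

Lemma eigvals_eigenvector d (M : 'M[C]_d) z : z \in eigvals M ->
  exists2 v : 'rV[C]_d, v *m M = z *: v & v != 0.
Proof.
move=> zM; apply/eigenvalueP; rewrite eigenvalue_root_char char_poly_eigvals.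
by rewrite root_prod_XsubC.
Qed.

Lemma eigvals_le d (M : 'M[C]_d) z : z \in eigvals M -> cm z <= mnorm M.
Proof.
move=> /eigvals_eigenvector [v vM v0].
have v1 : 0 < mnorm v.
  by rewrite lt_def mnorm_ge0 andbT; apply: contra v0 => /eqP/mnorm_eq0 ->.
by rewrite -(ler_pM2r v1) -mnormZ -vM mulrC mnormM.
Qed.

Lemma eigIm_ge0 d (M : 'M[C]_d) : 0 <= eigIm M.
Proof. exact: sumr_ge0. Qed.

Lemma eigIm_le d (M : 'M[C]_d) : eigIm M <= d%:R * mnorm M.
Proof.
rewrite /eigIm big_seq.
apply: (@le_trans _ _ (\sum_(z <- eigvals M | z \in eigvals M) mnorm M)).
  by apply: ler_sum => z zM; exact: le_trans (im_le_cm z) (eigvals_le zM).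
by rewrite -big_seq big_const_seq count_predT size_eigvals iter_addr_0 mulr_natl.
Qed.

End mnorm.

Section roots_continuity.
Variable R : realType.
Local Notation C := R[i].
Local Notation re := (@complex.Re R).
Local Notation im := (@complex.Im R).
Local Notation P s := (\prod_(z <- s) ('X - z%:P) : {poly C}).

Lemma divided_coef_le (D : {poly C}) mu (eta M : R) n : (size D <= n)%N ->
  0 <= M -> 0 <= eta -> cm mu <= M ->
  (forall k, cm ((('X - mu%:P) * D)`_k) <= eta) ->
  forall k, cm D`_k <= eta * \sum_(i < n) M ^+ i.
Proof.
move=> sD M0 eta0 muM hD k.
have gen j : forall k, (n <= k + j)%N -> cm D`_k <= eta * \sum_(i < j) M ^+ i.
  elim: j => [|j IH] {}k kj.
    by rewrite nth_default ?cm0 ?big_ord0 ?mulr0// (leq_trans sD)// -(addn0 k).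
  have -> : D`_k = (('X - mu%:P) * D)`_k.+1 + mu * D`_k.+1.
    by rewrite mulrBl coefB coefXM coefCM /= subrK.
  rewrite big_ord_recl expr0 mulrDr mulr1 (le_trans (cmD _ _))// lerD//.
  rewrite cmM; apply: (@le_trans _ _ (M * (eta * \sum_(i < j) M ^+ i))).
    by apply: ler_pM; rewrite ?cm_ge0//; apply: IH; rewrite addSnnS.
  rewrite mulrCA mulr_sumr ler_wpM2l//; apply: ler_sum => i _.
  by rewrite -exprS.
by apply: gen; rewrite leq_addl.
Qed.

Lemma horner_cm_le (q : {poly C}) z (delta M : R) n : (size q <= n)%N ->
  cm z <= M -> (forall k, cm q`_k <= delta) -> cm q.[z] <= delta * \sum_(i < n) M ^+ i.
Proof.
move=> sq zM hq; rewrite (horner_coef_wide _ sq) mulr_sumr.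
apply: (le_trans (cm_sum _ _ _)); apply: ler_sum => i _.
rewrite cmM cmX ler_pM ?cm_ge0 ?exprn_ge0 ?cm_ge0//.
by rewrite lerXn2r ?nnegrE ?(le_trans (cm_ge0 _) zM) ?cm_ge0.
Qed.

Lemma exists_pos_lower (T : eqType) (s : seq T) (Q : T -> R -> Prop) :
  (forall x, x \in s -> exists2 d : R, 0 < d & forall d', 0 < d' -> d' <= d -> Q x d') ->
  exists2 d : R, 0 < d & forall x, x \in s -> Q x d.
Proof.
move=> h.
suff [d d0 hd] : exists2 d : R, 0 < d & forall x, x \in s -> forall d', 0 < d' -> d' <= d -> Q x d'.
  by exists d => // x xs; exact: (hd x xs).
elim: s h => [_|x s IH h]; first by exists 1.
have [d1 d10 h1] := h x (mem_head _ _).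
have [|d2 d20 h2] := IH.
  by move=> y ys; apply: h; rewrite inE ys orbT.
exists (Num.min d1 d2); first by rewrite lt_min d10.
move=> y; rewrite inE => /predU1P[->|ys] d' d'0; rewrite le_min => /andP[a b].
  exact: h1.
exact: (h2 y ys).
Qed.

Lemma roots_continuous n : forall (s : seq C) (M e : R), size s = n -> 0 < e -> 0 <= M ->
  exists2 delta : R, 0 < delta & forall s', size s' = n ->
    (forall z, z \in s' -> cm z <= M) ->
    (forall k, cm ((P s' - P s)`_k) <= delta) ->
    `|\sum_(z <- s') `|im z| - \sum_(z <- s) `|im z| | <= e.
Proof.
elim: n => [|n IH] s M e sn e0 M0.
  exists 1 => // s' s'0 _ _.
  by rewrite (size0nil sn) (size0nil s'0) !big_nil subrr normr0 ltW.
have e20 : 0 < e / 2 by rewrite divr_gt0.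
have [d0 d00 hd0] : exists2 d : R, 0 < d & forall l, l \in s -> forall s', size s' = n ->
    (forall z, z \in s' -> cm z <= M) ->
    (forall k, cm ((P s' - P (rem l s))`_k) <= d) ->
    `|\sum_(z <- s') `|im z| - \sum_(z <- rem l s) `|im z| | <= e / 2.
  apply: exists_pos_lower => l ls.
  have [|d dp hd] := IH (rem l s) M (e / 2) _ e20 M0.
    by rewrite size_rem// sn.
  exists d => // d' _ d'd s' s'n s'M h.
  by apply: hd => // k; exact: le_trans (h k) d'd.
pose S := \sum_(i < n) M ^+ i.
have S0 : 0 <= S by apply: sumr_ge0 => i _; exact: exprn_ge0.
pose B := \sum_(l <- s) \sum_(k < n.+1) cm (P (rem l s))`_k.
have B0 : 0 <= B by apply: sumr_ge0 => l _; apply: sumr_ge0 => k _; exact: cm_ge0.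
have hB l k : l \in s -> cm (P (rem l s))`_k <= B.
  move=> ls; rewrite /B (big_rem l ls) /=.
  have [kn|kn] := ltnP k n.+1.
    rewrite (bigD1 (Ordinal kn))//= -addrA lerDl addr_ge0//.
      by apply: sumr_ge0 => i _; exact: cm_ge0.
    by apply: sumr_ge0 => i _; apply: sumr_ge0 => j _; exact: cm_ge0.
  rewrite nth_default ?cm0; last by rewrite size_prod_XsubC size_rem// sn.
  by rewrite addr_ge0//; apply: sumr_ge0 => i _ //; try (apply: sumr_ge0 => j _); exact: cm_ge0.
pose rho := Num.min (e / 2) (d0 / (2 * (1 + B) * (1 + S))).
have BS : 0 < 2 * (1 + B) * (1 + S) by rewrite !mulr_gt0// ltr_wpDr.
have rho0 : 0 < rho by rewrite lt_min e20 divr_gt0.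
pose S2 := \sum_(i < n.+2) M ^+ i.
have S20 : 0 <= S2 by apply: sumr_ge0 => i _; exact: exprn_ge0.
pose delta := Num.min (d0 / (2 * (1 + S))) (rho ^+ n.+1 / (1 + S2)).
have delta0 : 0 < delta.
  by rewrite lt_min !divr_gt0 ?mulr_gt0 ?exprn_gt0// ltr_wpDr.
exists delta => // -[//|mu s'] [s'n] s'M hs'.
have muM : cm mu <= M by apply: s'M; exact: mem_head.
have Pmu : cm (P s).[mu] <= delta * S2.
  have -> : cm (P s).[mu] = cm (P (mu :: s') - P s).[mu].
    rewrite hornerD hornerN [in RHS]big_cons [in RHS]hornerM hornerXsubC subrr mul0r.
    by rewrite sub0r cmN.
  apply: horner_cm_le => //.
  apply: (leq_trans (size_polyD _ _)); rewrite size_polyN geq_max.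
  by rewrite !size_prod_XsubC sn /= s'n !leqnn.
have [l ls lmu] : exists2 l, l \in s & cm (mu - l) <= rho.
  apply/hasP; apply: contraT; rewrite -all_predC => /allP hs.
  rewrite -(ltxx (cm (P s).[mu])).
  apply: (le_lt_trans Pmu).
  apply: (@lt_le_trans _ _ (rho ^+ n.+1)).
    apply: (@le_lt_trans _ _ (rho ^+ n.+1 / (1 + S2) * S2)).
      by rewrite ler_wpM2r// ge_min lexx orbT.
    rewrite mulrAC ltr_pdivrMr ?ltr_wpDr// mulrDr mulr1 ltrDr exprn_gt0//.
  rewrite horner_prod cm_prod -sn.
  have -> : rho ^+ size s = \prod_(z <- s) rho.
    by rewrite big_const_seq count_predT iter_mulr_1.
  rewrite !big_seq; apply: ler_prod => z zs; rewrite (ltW rho0)/= hornerXsubC.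
  by have := hs z zs; rewrite /= -ltNge => /ltW.
have Ps : P s = ('X - l%:P) * P (rem l s) by rewrite (big_rem l ls).
have h2 := hd0 l ls s' s'n _ _.
rewrite big_cons (big_rem l ls) /= opprD addrACA.
apply: (le_trans (ler_normD _ _)); rewrite [leRHS](splitr e) lerD//.
  apply: (@le_trans _ _ rho); last by rewrite ge_min lexx.
  apply: le_trans lmu; apply: (le_trans (ler_dist_dist _ _)).
  by rewrite -imN -imD; exact: im_le_cm.
apply: h2; first by move=> z zs'; apply: s'M; rewrite inE zs' orbT.
move=> k.
have eta0 : 0 <= delta + rho * B by rewrite addr_ge0 ?mulr_ge0// ltW.
apply: (@le_trans _ _ ((delta + rho * B) * S)).
  apply: (@divided_coef_le _ mu) => //.
    have lc r : size r = n -> (P r)`_n = 1.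
      move=> rn; have := monic_prod_XsubC r predT id => /monicP.
      by rewrite lead_coefE size_prod_XsubC rn.
    have rn : size (rem l s) = n by rewrite size_rem// sn.
    apply/leq_sizeP => j; rewrite leq_eqVlt coefB => /predU1P[<-|nj].
      by rewrite !lc ?subrr//; case: s'n.
    by rewrite !nth_default ?subrr// size_prod_XsubC ?rn//; case: s'n => ->.
  move=> j.
  have -> : ('X - mu%:P) * (P s' - P (rem l s)) =
      (P (mu :: s') - P s) + (mu - l)%:P * P (rem l s).
    rewrite big_cons Ps polyCB; ring.
  rewrite coefD coefCM (le_trans (cmD _ _))// lerD// cmM ler_pM ?cm_ge0//.
  exact: hB.
have S1 : 0 < 1 + S by rewrite ltr_wpDr.
have B1 : 0 < 1 + B by rewrite ltr_wpDr.
have k1 : delta * (1 + S) <= d0 / 2.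
  apply: (@le_trans _ _ (d0 / (2 * (1 + S)) * (1 + S))).
    by rewrite ler_wpM2r ?(ltW S1)// ge_min lexx.
  by rewrite invfM mulrA divfK// lt0r_neq0.
have k2 : rho * (1 + B) * (1 + S) <= d0 / 2.
  apply: (@le_trans _ _ (d0 / (2 * (1 + B) * (1 + S)) * (1 + B) * (1 + S))).
    by rewrite !ler_wpM2r ?(ltW S1) ?(ltW B1)// ge_min lexx orbT.
  rewrite le_eqVlt; apply/orP; left; apply/eqP; field.
  by rewrite !lt0r_neq0.
rewrite [leRHS](splitr d0) mulrDl lerD//.
  by apply: le_trans k1; rewrite ler_wpM2l ?(ltW delta0)// lerDr.
apply: le_trans k2; apply: ler_pM => //; rewrite ?mulr_ge0 ?(ltW rho0)//.
  by rewrite ler_wpM2l ?(ltW rho0)// lerDr.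
by rewrite lerDr.
Qed.

End roots_continuity.

Section complex_limits.
Variable R : realType.
Local Notation C := R[i].
Local Notation re := (@complex.Re R).
Local Notation im := (@complex.Im R).
Variables (T : Type) (F : set_system T).
Context {FF : ProperFilter F}.

Definition ccvg (f : T -> C) (l : C) :=
  (re (f t) @[t --> F] --> re l) /\ (im (f t) @[t --> F] --> im l).

Lemma ccvg_cst c : ccvg (fun=> c) c.
Proof. by split; exact: cvg_cst. Qed.

Lemma ccvgD f g l m : ccvg f l -> ccvg g m -> ccvg (fun t => f t + g t) (l + m).
Proof.
move=> [f1 f2] [g1 g2]; split.
  by under eq_fun do rewrite reD; rewrite reD; exact: cvgD.
by under eq_fun do rewrite imD; rewrite imD; exact: cvgD.
Qed.

Lemma ccvgM f g l m : ccvg f l -> ccvg g m -> ccvg (fun t => f t * g t) (l * m).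
Proof.
move=> [f1 f2] [g1 g2]; split.
  by under eq_fun do rewrite reM; rewrite reM; apply: cvgB; exact: cvgM.
by under eq_fun do rewrite imM; rewrite imM; apply: cvgD; exact: cvgM.
Qed.

Lemma ccvgN f l : ccvg f l -> ccvg (fun t => - f t) (- l).
Proof.
move=> [f1 f2]; split.
  by under eq_fun do rewrite reN; rewrite reN; exact: cvgN.
by under eq_fun do rewrite imN; rewrite imN; exact: cvgN.
Qed.

Lemma ccvg_sum I (r : seq I) (Q : pred I) (f : I -> T -> C) (l : I -> C) :
  (forall i, ccvg (f i) (l i)) ->
  ccvg (fun t => \sum_(i <- r | Q i) f i t) (\sum_(i <- r | Q i) l i).
Proof.
move=> fl; elim: r => [|i r IH].
  by rewrite big_nil; under [X in ccvg X _]eq_fun do rewrite big_nil; exact: ccvg_cst.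
rewrite big_cons; under [X in ccvg X _]eq_fun do rewrite big_cons.
by case: (Q i) => //; exact: ccvgD.
Qed.

Lemma ccvg_near f l (e : R) : ccvg f l -> 0 < e -> \forall t \near F, cm (f t - l) <= e.
Proof.
move=> [f1 f2] e0; have e2 : 0 < e / 2 by rewrite divr_gt0.
have /cvgrPdist_le h1 := f1; have /cvgrPdist_le h2 := f2.
near=> t; apply: (le_trans (cm_le _)).
rewrite [leRHS](splitr e) reD imD reN imN lerD// distrC; near: t.
  exact: h1.
exact: h2.
Unshelve. all: end_near. Qed.

Definition pcvg (f : T -> {poly C}) (l : {poly C}) := forall k, ccvg (fun t => (f t)`_k) l`_k.

Lemma pcvg_cst p : pcvg (fun=> p) p.
Proof. by move=> k; exact: ccvg_cst. Qed.

Lemma pcvgD f g l m : pcvg f l -> pcvg g m -> pcvg (fun t => f t + g t) (l + m).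
Proof.
by move=> fl gm k; rewrite coefD; under [X in ccvg X _]eq_fun do rewrite coefD; exact: ccvgD.
Qed.

Lemma pcvgM f g l m : pcvg f l -> pcvg g m -> pcvg (fun t => f t * g t) (l * m).
Proof.
move=> fl gm k; rewrite coefM; under [X in ccvg X _]eq_fun do rewrite coefM.
by apply: ccvg_sum => i; exact: ccvgM.
Qed.

Lemma pcvg_sum I (r : seq I) (Q : pred I) (f : I -> T -> {poly C}) (l : I -> {poly C}) :
  (forall i, pcvg (f i) (l i)) ->
  pcvg (fun t => \sum_(i <- r | Q i) f i t) (\sum_(i <- r | Q i) l i).
Proof.
move=> fl; elim: r => [|i r IH].
  by rewrite big_nil; under [X in pcvg X _]eq_fun do rewrite big_nil; exact: pcvg_cst.
rewrite big_cons; under [X in pcvg X _]eq_fun do rewrite big_cons.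
by case: (Q i) => //; exact: pcvgD.
Qed.

Lemma pcvg_prod I (r : seq I) (Q : pred I) (f : I -> T -> {poly C}) (l : I -> {poly C}) :
  (forall i, pcvg (f i) (l i)) ->
  pcvg (fun t => \prod_(i <- r | Q i) f i t) (\prod_(i <- r | Q i) l i).
Proof.
move=> fl; elim: r => [|i r IH].
  by rewrite big_nil; under [X in pcvg X _]eq_fun do rewrite big_nil; exact: pcvg_cst.
rewrite big_cons; under [X in pcvg X _]eq_fun do rewrite big_cons.
by case: (Q i) => //; exact: pcvgM.
Qed.

Definition mcvg m n (f : T -> 'M[C]_(m, n)) (l : 'M[C]_(m, n)) :=
  forall i j, ccvg (fun t => f t i j) (l i j).

Lemma mcvg_cst m n (A : 'M[C]_(m, n)) : mcvg (fun=> A) A.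
Proof. by move=> i j; exact: ccvg_cst. Qed.

Lemma mcvgB m n (f g : T -> 'M[C]_(m, n)) A B :
  mcvg f A -> mcvg g B -> mcvg (fun t => f t - g t) (A - B).
Proof.
move=> fA gB i j; rewrite !mxE; under [X in ccvg X _]eq_fun do rewrite !mxE.
by apply: ccvgD; [exact: fA|apply: ccvgN; exact: gB].
Qed.

Lemma mcvgM m n p (f : T -> 'M[C]_(m, n)) (g : T -> 'M[C]_(n, p)) A B :
  mcvg f A -> mcvg g B -> mcvg (fun t => f t *m g t) (A *m B).
Proof.
move=> fA gB i j; rewrite !mxE; under [X in ccvg X _]eq_fun do rewrite !mxE.
by apply: ccvg_sum => k; exact: ccvgM.
Qed.

Lemma mcvg_scalar n (f : T -> C) (c : C) : ccvg f c -> @mcvg n n (fun t => (f t)%:M) c%:M.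
Proof.
move=> fc i j; rewrite !mxE; under [X in ccvg X _]eq_fun do rewrite !mxE.
by case: (i == j); [rewrite mulr1n; exact: fc|exact: ccvg_cst].
Qed.

Lemma pcvg_char_poly d (f : T -> 'M[C]_d) A : mcvg f A ->
  pcvg (fun t => char_poly (f t)) (char_poly A).
Proof.
move=> fA; rewrite /char_poly /determinant; apply: pcvg_sum => s.
apply: pcvgM; first exact: pcvg_cst.
apply: pcvg_prod => i k; rewrite !mxE coefB coefC.
under [X in ccvg X _]eq_fun do rewrite !mxE coefB coefC.
apply: ccvgD; first exact: ccvg_cst.
by apply: ccvgN; case: (k == 0%N); [exact: fA|exact: ccvg_cst].
Qed.

Lemma near_forall_lt (n : nat) (Q : nat -> T -> Prop) :
  (forall k, \forall t \near F, Q k t) -> \forall t \near F, forall k, (k < n)%N -> Q k t.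
Proof.
move=> h; elim: n => [|n IH]; first exact: nearW.
near=> t => k; rewrite ltnS leq_eqVlt => /predU1P[->|kn].
  by near: t; exact: h.
by move: k kn; near: t; exact: IH.
Unshelve. all: end_near. Qed.

Lemma eigIm_cvg d (f : T -> 'M[C]_d) A : mcvg f A -> eigIm (f t) @[t --> F] --> eigIm A.
Proof.
move=> fA; apply/cvgrPdist_le => e e0.
have M0 : 0 <= mnorm A + 1 by rewrite addr_ge0// mnorm_ge0.
have [delta d0 hd] := roots_continuous (size_eigvals A) e0 M0.
have near1 : \forall t \near F, mnorm (f t - A) <= 1.
  pose c : R := (d * d)%:R + 1.
  have c0 : 0 < c by rewrite ltr_wpDl.
  have h i j : \forall t \near F, cm (f t i j - A i j) <= c^-1.
    by apply: ccvg_near => //; rewrite invr_gt0.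
  have {}h i : \forall t \near F, forall j, cm (f t i j - A i j) <= c^-1.
    by apply: filter_forall => j; exact: h.
  have {}h : \forall t \near F, forall i j, cm (f t i j - A i j) <= c^-1.
    by apply: filter_forall => i; exact: h.
  near=> t; apply: (@le_trans _ _ (\sum_(i < d) \sum_(j < d) c^-1)).
    apply: ler_sum => i _; apply: ler_sum => j _; rewrite !mxE; move: i j; near: t.
    exact: h.
  rewrite !sumr_const !card_ord -mulrnA -mulr_natr mulrC ler_pdivrMr// mul1r.
  by rewrite /c lerDl.
have near2 : \forall t \near F, forall k, (k < d.+1)%N ->
    cm ((char_poly (f t) - char_poly A)`_k) <= delta.
  apply: near_forall_lt => k.
  have := ccvg_near (pcvg_char_poly fA k) d0.
  by apply: filterS => t; rewrite coefB.
near=> t; rewrite distrC; apply: hd.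
- exact: size_eigvals.
- move=> z /eigvals_le /le_trans; apply.
  have -> : f t = A + (f t - A) by rewrite addrC subrK.
  by apply: (le_trans (mnormD _ _)); rewrite lerD2l; near: t.
- move=> k; rewrite -!char_poly_eigvals; have [kd|kd] := ltnP k d.+1.
    by move: k kd; near: t.
  by rewrite coefB !nth_default ?size_char_poly// subrr cm0 ltW.
Unshelve. all: end_near. Qed.

End complex_limits.

Section diagonalized.
Variables (F : fieldType) (d : nat).
Implicit Types (A P D : 'M[F]_d) (r : 'rV[F]_d).

Lemma conj_diag_shift A P r w : P \in unitmx -> A = invmx P *m diag_mx r *m P ->
  A - w%:M = invmx P *m diag_mx (\row_i (r 0 i - w)) *m P.
Proof.
move=> uP AE; have -> : \row_i (r 0 i - w) = r - const_mx w.
  by apply/rowP => i; rewrite !mxE.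
rewrite raddfB /= diag_const_mx mulmxBr mulmxBl -AE; congr (_ - _).
by rewrite mul_mx_scalar -scalemxAl mulVmx// scalemx1.
Qed.

Lemma conj_diag_inv P r : P \in unitmx -> (forall i, r 0 i != 0) ->
  invmx P *m diag_mx r *m P \in unitmx /\
  invmx (invmx P *m diag_mx r *m P) = invmx P *m diag_mx (\row_i (r 0 i)^-1) *m P.
Proof.
move=> uP r0; set M := invmx P *m diag_mx r *m P.
have e : M *m (invmx P *m diag_mx (\row_i (r 0 i)^-1) *m P) = 1%:M.
  rewrite /M !mulmxA mulmxK// -(mulmxA (invmx P)) mulmx_diag.
  rewrite (_ : \row_j _ = const_mx 1); last by apply/rowP => i; rewrite !mxE mulfV.
  by rewrite diag_const_mx mulmx1 mulVmx.
have [u1 _] := mulmx1_unit e; split => //.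
by rewrite -[LHS]mulmx1 -e mulKmx.
Qed.

Lemma conj_diag_trace P D r : P \in unitmx ->
  \tr (invmx P *m diag_mx r *m P *m D) = \sum_i r 0 i * (P *m D *m invmx P) i i.
Proof.
move=> uP; rewrite -!mulmxA mxtrace_mulC /mxtrace.
apply: eq_bigr => i _.
by rewrite -!mulmxA mul_diag_mx !mxE.
Qed.

Lemma conj_diag_det P r : P \in unitmx -> \det (invmx P *m diag_mx r *m P) = \prod_i r 0 i.
Proof.
move=> uP; rewrite !det_mulmx mulrC mulrA -det_mulmx mulmxV// det1 mul1r det_diag.
by apply: eq_bigr.
Qed.

End diagonalized.

Section hermitian.
Variable R : realType.
Local Notation C := R[i].
Local Notation re := (@complex.Re R).
Local Notation im := (@complex.Im R).

Definition ctr m n (M : 'M[C]_(m, n)) : 'M[C]_(n, m) := map_mx conjc M^T.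

Lemma ctrE m n (M : 'M[C]_(m, n)) : ctr M = (M^t*)%sesqui.
Proof. by apply/matrixP => i j; rewrite !mxE. Qed.

Lemma ctrM m n p (M : 'M[C]_(m, n)) (N : 'M[C]_(n, p)) : ctr (M *m N) = ctr N *m ctr M.
Proof. by rewrite /ctr trmx_mul map_mxM. Qed.

Lemma ctrK m n (M : 'M[C]_(m, n)) : ctr (ctr M) = M.
Proof. by apply/matrixP => i j; rewrite !mxE conjcK. Qed.

Lemma hermP d (M : 'M[C]_d) : M \is hermsymmx <-> ctr M = M.
Proof.
split=> [/is_hermitianmxP h|h].
  by rewrite [in RHS]h expr0 scale1r ctrE.
by apply/is_hermitianmxP; rewrite expr0 scale1r -ctrE h.
Qed.

Lemma herm_spectral d (A : 'M[C]_d) : A \is hermsymmx ->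
  exists (P : 'M[C]_d) (al : 'I_d -> R),
  [/\ P \in unitmx, ctr P = invmx P & A = invmx P *m diag_mx (\row_i (al i)%:C) *m P].
Proof.
move=> hA; have nA := hermitian_normalmx hA.
have /orthomx_spectralP AE := nA.
exists (spectralmx A), (fun i => re (spectral_diag A 0 i)); split.
- exact: spectral_unit.
- by rewrite ctrE; apply/esym; apply: invmx_unitary; exact: spectral_unitarymx.
have -> : \row_i (re (spectral_diag A 0 i))%:C = spectral_diag A; last exact: AE.
apply/rowP => i; rewrite mxE; have /mxOverP/(_ 0 i) := hermitian_spectral_diag_real hA.
by move/RRe_real.
Qed.

Lemma re_conj_eq (z : C) : z^*%C = z -> im z = 0.
Proof. by case: z => a b /= [] h; lra. Qed.

Lemma conj_real_div (a b : C) : a^*%C = a -> b^*%C = b -> im (a / b) = 0.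
Proof. by move=> ha hb; apply: re_conj_eq; rewrite rmorphM /= conjc_inv ha hb. Qed.

Definition qform d (H : 'M[C]_d) (v : 'rV[C]_d) : C := (v *m H *m ctr v) 0 0.

Lemma qform_real d (H : 'M[C]_d) v : ctr H = H -> (qform H v)^*%C = qform H v.
Proof.
move=> hH; rewrite /qform; transitivity ((ctr (v *m H *m ctr v)) 0 0).
  by rewrite /ctr [in RHS]mxE [in RHS]mxE.
by rewrite !ctrM ctrK hH mulmxA.
Qed.

Lemma eigvals_real_definite d (N H : 'M[C]_d) z : ctr N = N -> ctr H = H ->
  (forall v, v != 0 -> qform N v != 0) -> z \in eigvals (N *m H) -> im z = 0.
Proof.
move=> hN hH dN /eigvals_eigenvector [v vz v0].
have e : qform H (v *m N) = z * qform N v.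
  rewrite /qform ctrM hN -(mulmxA v) vz -scalemxAl mxE; congr (_ * _).
  by rewrite mulmxA.
rewrite -(mulfK (dN v v0) z) -e.
by apply: conj_real_div; exact: qform_real.
Qed.

Lemma eigIm_definite_l d (N H : 'M[C]_d) : ctr N = N -> ctr H = H ->
  (forall v, v != 0 -> qform N v != 0) -> eigIm (N *m H) = 0.
Proof.
move=> hN hH dN; rewrite /eigIm big_seq big1// => z zM.
by rewrite (eigvals_real_definite hN hH dN zM) normr0.
Qed.

Lemma definite_unit d (N : 'M[C]_d) : (forall v, v != 0 -> qform N v != 0) -> N \in unitmx.
Proof.
move=> dN; rewrite -row_free_unit -kermx_eq0; apply: contraT => /rowV0Pn [v].
by move=> /sub_kermxP vN v0; have := dN v v0; rewrite /qform vN mul0mx mxE eqxx.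
Qed.

Lemma eigIm_definite_r d (N H : 'M[C]_d) : ctr N = N -> ctr H = H ->
  (forall v, v != 0 -> qform H v != 0) -> eigIm (N *m H) = 0.
Proof.
move=> hN hH dH; have uH := definite_unit dH.
rewrite -(eigIm_definite_l hH hN dH); symmetry.
by apply: (eigIm_similar uH); rewrite mulmxA mulmxK.
Qed.

Lemma qform_diag d (A P : 'M[C]_d) (al : 'I_d -> R) (a : R) v : P \in unitmx -> ctr P = invmx P ->
  A = invmx P *m diag_mx (\row_i (al i)%:C) *m P ->
  qform (A - a%:C%:M) v = (\sum_i (al i - a) * cm ((v *m invmx P) 0 i) ^+ 2)%:C.
Proof.
move=> uP cP AE; set u := v *m invmx P.
have -> : A - a%:C%:M = invmx P *m diag_mx (\row_i (al i - a)%:C) *m P.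
  rewrite (conj_diag_shift _ uP AE); congr (_ *m diag_mx _ *m _).
  by apply/rowP => i; rewrite !mxE rmorphB.
have -> : qform (invmx P *m diag_mx (\row_i (al i - a)%:C) *m P) v =
    (u *m diag_mx (\row_i (al i - a)%:C) *m ctr u) 0 0.
  by rewrite /qform /u ctrM -cP ctrK !mulmxA.
rewrite mxE rmorph_sum; apply: eq_bigr => i _.
rewrite mul_mx_diag !mxE -/(u 0 i) rmorphM rmorphXn /= cm_norm sqr_normc.
by rewrite -mulrA mulrCA.
Qed.

Lemma shift_herm d (A : 'M[C]_d) (a : R) : ctr A = A -> ctr (A - a%:C%:M) = A - a%:C%:M.
Proof.
move=> hA; rewrite -{2}hA; apply/matrixP => i j; rewrite !mxE rmorphB /= eq_sym.
by case: (i == j); rewrite ?mulr1n ?mulr0n ?conjc_real ?conjc0.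
Qed.

Lemma shift_definite d (A P : 'M[C]_d) (al : 'I_d -> R) (a : R) : P \in unitmx -> ctr P = invmx P ->
  A = invmx P *m diag_mx (\row_i (al i)%:C) *m P ->
  ((forall i, al i < a) \/ (forall i, a < al i)) ->
  forall v, v != 0 -> qform (A - a%:C%:M) v != 0.
Proof.
move=> uP cP AE ha v v0; rewrite (qform_diag _ _ uP cP AE).
set u := v *m invmx P.
have [k uk] : exists k, u 0 k != 0.
  apply/existsP; apply: contraT; rewrite negb_exists => /forallP u0.
  have : u = 0 by apply/rowP => i; rewrite [RHS]mxE; apply/eqP; have := u0 i; rewrite negbK.
  move=> /(congr1 (mulmx^~ P)); rewrite /u mulmxKV// mul0mx => ve.
  by rewrite ve eqxx in v0.
have uk2 : 0 < cm (u 0 k) ^+ 2 by rewrite exprn_gt0// cm_gt0.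
rewrite (_ : 0 = 0%:C)// (inj_eq (@complexI R)).
case: ha => ha.
  rewrite lt_eqF// (bigD1 k)//= -[ltRHS]addr0 ltr_leD//.
    by rewrite nmulr_rlt0// subr_lt0.
  by apply: sumr_le0 => i _; rewrite mulr_le0_ge0 ?sqr_ge0// subr_le0 ltW.
rewrite gt_eqF// (bigD1 k)//= -[ltLHS]addr0 ltr_leD//.
  by rewrite mulr_gt0// subr_gt0.
by apply: sumr_ge0 => i _; rewrite mulr_ge0 ?sqr_ge0// subr_ge0 ltW.
Qed.

Lemma eigvals_diag d (A P : 'M[C]_d) (al : 'I_d -> R) : P \in unitmx ->
  A = invmx P *m diag_mx (\row_i (al i)%:C) *m P ->
  perm_eq (eigvals A) [seq (al i)%:C | i <- enum 'I_d].
Proof.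
move=> uP ->; apply: eigvals_perm => n.
rewrite -opprB detN (conj_diag_shift _ uP (erefl _)) conj_diag_det// big_map.
rewrite -[X in (-1) ^+ X](card_ord d) -prodrN big_enum.
by apply: eq_bigr => i _; rewrite !mxE opprB.
Qed.

(* resolvent *)
Lemma resolvent_diag d (H : 'M[C]_d) : ctr H = H -> exists (be : 'I_d -> R) (P : 'M[C]_d),
  [/\ mnorm P <= (d * d)%:R, mnorm (invmx P) <= (d * d)%:R, P \in unitmx &
   forall w, nonreal w -> H - w%:M \in unitmx /\
   invmx (H - w%:M) = invmx P *m diag_mx (\row_i ((be i)%:C - w)^-1) *m P].
Proof.
move=> /hermP /herm_spectral [P [be [uP cP HE]]].
have entry i j : cm (P i j) <= 1.
  have : (P *m ctr P) i i = 1 by rewrite cP mulmxV// mxE eqxx.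
  rewrite mxE => /(congr1 re) /=; rewrite re_sum (bigD1 j)//= => h.
  have sq k : re (P i k * ctr P k i) = cm (P i k) ^+ 2.
    by rewrite !mxE -sqr_normc -cm_norm -rmorphXn.
  rewrite -(@expr_le1 _ 2) ?cm_ge0// -sq -h lerDl.
  by apply: sumr_ge0 => k _; rewrite sq sqr_ge0.
have nrm (M : 'M[C]_d) : (forall i j, cm (M i j) <= 1) -> mnorm M <= (d * d)%:R.
  move=> h; apply: (@le_trans _ _ (\sum_(i < d) \sum_(j < d) 1)).
    by apply: ler_sum => i _; apply: ler_sum => j _.
  by rewrite !sumr_const !card_ord -mulrnA.
exists be, P; split => //.
- exact: nrm.
- by apply: nrm => i j; rewrite -cP !mxE cm_conj.
move=> w nw.
have bw i : (be i)%:C - w != 0 by exact: line_neq0.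
rewrite (conj_diag_shift w uP HE).
have [|u1 u2] := @conj_diag_inv _ _ P (\row_i ((\row_i (be i)%:C) 0 i - w)) uP.
  by move=> i; rewrite !mxE.
split; first exact: u1.
rewrite u2; congr (_ *m diag_mx _ *m _).
by apply/rowP => i; rewrite !mxE.
Qed.

Lemma resolvent_le d (H : 'M[C]_d) w : ctr H = H -> nonreal w ->
  H - w%:M \in unitmx /\ mnorm (invmx (H - w%:M)) <= d%:R ^+ 5 / `|im w|.
Proof.
move=> hH nw; have [be [P [P1 P2 uP hw]]] := resolvent_diag hH.
have [u1 ->] := hw w nw; split => //.
apply: (le_trans (mnormM _ _)).
have d1 : mnorm (diag_mx (\row_i ((be i)%:C - w)^-1)) <= d%:R / `|im w|.
  apply: (@le_trans _ _ (\sum_(i < d) `|im w|^-1)).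
    apply: ler_sum => i _; rewrite (bigD1 i)//= big1 ?addr0.
      by rewrite !mxE eqxx mulr1n line_inv_le.
    by move=> j ji; rewrite !mxE eq_sym (negPf ji) mulr0n cm0.
  by rewrite sumr_const card_ord mulr_natl.
have -> : d%:R ^+ 5 / `|im w| = (d * d)%:R * (d%:R / `|im w|) * (d * d)%:R.
  by rewrite natrM; ring.
apply: ler_pM => //; rewrite ?mnorm_ge0//.
by apply: (le_trans (mnormM _ _)); apply: ler_pM => //; rewrite ?mnorm_ge0.
Qed.

Lemma resolvent_trace d (H D : 'M[C]_d) : ctr H = H -> exists (be : 'I_d -> R) (c : 'I_d -> C),
  forall w, nonreal w -> \tr (invmx (H - w%:M) *m D) = \sum_i c i / ((be i)%:C - w).
Proof.
move=> hH; have [be [P [P1 P2 uP hw]]] := resolvent_diag hH.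
exists be, (fun i => (P *m D *m invmx P) i i) => w nw.
have [_ ->] := hw w nw.
rewrite conj_diag_trace//; apply: eq_bigr => i _.
by rewrite mxE mulrC.
Qed.

End hermitian.

Section scaling.
Variable R : realType.
Local Notation re := (@complex.Re R).
Local Notation im := (@complex.Im R).
Local Notation mu := (@lebesgue_measure R).

Lemma ge0_integral_scale (G : R -> R) (e : R) : 0 < e -> continuous G ->
  (forall x, 0 <= G x) ->
  (\int[mu]_x (G x)%:E = \int[mu]_x (G (e * x) * e)%:E)%E.
Proof.
move=> e0 cG G0.
have dF (x : R) : is_derive x (1:R) (fun x : R => e * x) e.
  apply: is_derive_eq (is_deriveZ e (is_derive_id x (1:R))) _.
  by rewrite /GRing.scale/= mulr1.
have F' : derive1 (fun x : R => e * x) = (fun=> e).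
  by apply/funext => x; rewrite derive1E derive_val.
rewrite (@increasing_ge0_integration_by_substitutionT R (fun x => e * x))//.
- by rewrite F'.
- by move=> x y xy; rewrite ltr_pM2l.
- by rewrite F' => x; exact: cvg_cst.
- by rewrite F'; exact: is_cvg_cst.
- by rewrite F'; exact: is_cvg_cst.
- by apply: gt0_cvgMrNy => //; exact: cvg_id.
- by apply: gt0_cvgMry => //; exact: cvg_id.
Qed.

Lemma Dom_scale (f : R -> R) (e : R) : 0 < e -> Dom f -> Dom (fun x => f (e * x)).
Proof.
move=> e0 [mf [C fC]]; split.
  by apply: (measurableT_comp mf); exact: measurable_funM.
have C0 : 0 <= C.
  by have := le_trans (normr_ge0 _) (fC 0); rewrite pmulr_lge0// hw_gt0.
exists (C * (1 + e ^- 2)) => x; apply: (le_trans (fC _)); rewrite -mulrA ler_wpM2l//.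
have a0 : 0 < 1 + (e * x) ^+ 2 by rewrite ltr_wpDr// sqr_ge0.
have b0 : 0 < 1 + x ^+ 2 by rewrite ltr_wpDr// sqr_ge0.
rewrite /hw -[leLHS]mul1r ler_pdivrMr// mulrAC ler_pdivlMr// mul1r exprMn.
have e2 : 0 < e ^+ 2 by rewrite exprn_gt0.
have -> : (1 + e ^- 2) * (1 + e ^+ 2 * x ^+ 2) = (1 + x ^+ 2) + (e ^+ 2 * x ^+ 2 + e ^- 2).
  by field; rewrite lt0r_neq0.
rewrite lerDl; apply: addr_ge0; last by rewrite invr_ge0 sqr_ge0.
by apply: mulr_ge0; exact: sqr_ge0.
Qed.

Lemma Rint_scale (f : R -> R) (e : R) : 0 < e -> continuous f -> Dom f ->
  \int[mu]_x f x = e * \int[mu]_x f (e * x).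
Proof.
move=> e0 cf Df.
have cn : continuous (fun x => `|f x|).
  by move=> x; apply: cvg_norm; exact: cf.
have Dn : Dom (fun x => `|f x|).
  have [mf [C fC]] := Df; split; first exact: continuous_measurable_fun.
  by exists C => x; rewrite normr_id.
have DD (g : R -> R) : Dom g -> Dom (fun x => `|g x| + g x).
  move=> [mg [C gC]]; split.
    by apply: measurable_funD => //; apply: measurableT_comp.
  exists (C + C) => x; rewrite mulrDl (le_trans (ler_normD _ _))// lerD// normr_id.
  exact: gC.
have key (g : R -> R) : continuous g -> Dom g -> (forall x, 0 <= g x) ->
    \int[mu]_x g x = e * \int[mu]_x g (e * x).
  move=> cg Dg g0; rewrite -RintegralZl//; last exact/Dom_integrable/Dom_scale.
  rewrite /Rintegral (ge0_integral_scale e0 cg g0).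
  by congr fine; apply: eq_integral => x _; rewrite mulrC.
have fE x : f x = (`|f x| + f x) - `|f x| by rewrite addrC addKr.
have c1 : continuous (fun x => `|f x| + f x) by move=> x; apply: cvgD; [exact: cn|exact: cf].
have D1 := DD _ Df.
transitivity (\int[mu]_x ((`|f x| + f x) - `|f x|)).
  by apply: eq_Rintegral => x _; rewrite -fE.
rewrite RintegralB//; [|exact: Dom_integrable..].
rewrite (key _ c1 D1) ?(key _ cn Dn)//; last first.
  by move=> x; rewrite addrC -lerBlDr sub0r lerNl -normrN ler_norm.
rewrite -mulrBr -RintegralB//; [|exact/Dom_integrable/(Dom_scale e0 D1)|exact/Dom_integrable/(Dom_scale e0 Dn)].
by congr (_ * _); apply: eq_Rintegral => x _; rewrite addrC addKr.
Qed.

Lemma cint_scale (f : R -> R[i]) (e : R) : 0 < e -> ccont f -> cDom f ->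
  cint f = e%:C * cint (fun x => f (e * x)).
Proof.
move=> e0 [c1 c2] Df; apply: complex_ext.
  rewrite reM /= mul0r subr0; apply: (Rint_scale e0 c1); exact: cDom_re.
rewrite imM /= mul0r addr0; apply: (Rint_scale e0 c2); exact: cDom_im.
Qed.

(* reflection of the nodes *)
Lemma kap_opp (s : seq R[i]) : all (@nonreal R) s -> (1 < size s)%N ->
  kap [seq - z | z <- s] = (-1) ^+ size s * kap s.
Proof.
have nN (z : R[i]) : nonreal z -> nonreal (- z) by rewrite /nonreal imN oppr_eq0.
have nNs (s' : seq R[i]) : all (@nonreal R) s' -> all (@nonreal R) [seq - z | z <- s'].
  by move=> /allP h; apply/allP => _ /mapP[z zs ->]; apply: nN; exact: h.
move=> ns s1; move: s s1 ns; apply: nodes_ind.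
- move=> s s' ss' h; rewrite -!(perm_all _ ss') => ns.
  by rewrite -(perm_size ss') -(kap_perm ss') -(kap_perm (perm_map _ ss')) h.
- move=> n z ns; have /= /andP[nz _] := ns.
  by rewrite map_nseq !kap_nseq ?mulr0//; exact: nN.
- move=> z1 z2 z12 /= /and3P[n1 n2 _].
  have d0 : z1 - z2 != 0 by rewrite subr_eq0.
  rewrite !kap2 ?eqr_opp//; [|exact: nN..].
  rewrite expr2 mulrNN mulr1 mul1r /sgI !imN !sgrN.
  have -> : - z1 - - z2 = - (z1 - z2) by ring.
  rewrite invrN mulrN -mulNr; congr (_ / _).
  by apply: complex_ext; rewrite /= ?oppr0//; ring.
- move=> z1 z2 s z12 s0 h1 h2 /= /and3P[n1 n2 ns].
  have d0 : z1 - z2 != 0 by rewrite subr_eq0.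
  apply: (mulfI (_ : - (z1 - z2) != 0)); first by rewrite oppr_eq0.
  rewrite [in LHS]opprD kap_rec ?size_map//; [|exact: nN|exact: nN|exact: nNs].
  have e1 : kap [seq - z | z <- z1 :: s] = (-1) ^+ (size s).+1 * kap (z1 :: s).
    by apply: h1; rewrite /= n1.
  have e2 : kap [seq - z | z <- z2 :: s] = (-1) ^+ (size s).+1 * kap (z2 :: s).
    by apply: h2; rewrite /= n2.
  move: e1 e2 => /= -> ->.
  rewrite -mulrBr -kap_rec//.
  by rewrite (exprS _ (size s).+1); ring.
Qed.

End scaling.

Section resolvent_algebra.
Variables (F : fieldType) (d : nat).
Implicit Types (L B D X Y G : 'M[F]_d).

Lemma neumann L B (e : F) n : L \in unitmx -> L + e *: B \in unitmx ->
  invmx (L + e *: B) = \sum_(q < n) (- e) ^+ q *: (invmx L *m (B *m invmx L) ^+ q)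
   + (- e) ^+ n *: (invmx (L + e *: B) *m (B *m invmx L) ^+ n).
Proof.
move=> uL uG; set G := invmx (L + e *: B); set La := invmx L.
have e1 : G = La - e *: (G *m (B *m La)).
  have : G *m (L + e *: B) *m La = La by rewrite mulVmx// mul1mx.
  rewrite mulmxDr mulmxDl mulmxK// -scalemxAr -scalemxAl -mulmxA => h.
  by rewrite -{1}h addrK.
elim: n => [|n IH]; first by rewrite big_ord0 add0r expr0 scale1r expr0 mulmx1.
rewrite {1}IH big_ord_recr /= -addrA; congr (_ + _).
rewrite {1}e1 mulmxBl scalerBr; congr (_ + _).
rewrite -scalemxAl scalerA -scaleNr -mulrN -exprSr; congr (_ *: _).
by rewrite [in RHS]exprS -mulmxE !mulmxA.
Qed.

Lemma resolvent_square Y V (t : F) : (Y - t%:M) *m V = 1%:M ->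
  t *: (Y *m V) = Y *m (Y *m V) - Y.
Proof.
rewrite mulmxBl mul_scalar_mx => h.
have tV : t *: V = Y *m V - 1%:M by rewrite -h opprB addrC subrK.
by rewrite scalemxAr tV mulmxBr mulmx1.
Qed.

(* the identity z^2 / (z^2 - t^2) = (z / (z - t) + z / (z + t)) / 2 rearranged *)
Lemma resolvent_even Y V V' (t : F) :
  (Y - t%:M) *m V = 1%:M -> (Y - (- t)%:M) *m V' = 1%:M ->
  t ^+ 2 *: (Y *m V + Y *m V') = Y *m Y *m (Y *m V + Y *m V') - 2 *: (Y *m Y).
Proof.
move=> h h'; have e := resolvent_square h; have e' := resolvent_square h'.
set U := Y *m V in e *; set U' := Y *m V' in e' *.
have e1 : t *: (U - U') = Y *m (U + U') - 2 *: Y.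
  rewrite scalerBr e -scaleNr e' mulmxDr scaler_nat mulr2n.
  by rewrite addrACA opprD.
have e2 : t *: (U + U') = Y *m (U - U').
  rewrite scalerDr e -[t *: U']opprK -scaleNr e' mulmxBr opprB.
  by rewrite addrA subrK.
rewrite expr2 -scalerA e2 scalemxAr e1 mulmxBr mulmxA; congr (_ - _).
by rewrite -scalemxAr.
Qed.

End resolvent_algebra.

Section matrix_measurable.
Variable R : realType.
Context dd (T : measurableType dd).

Definition mmeas m n (f : T -> 'M[R[i]]_(m, n)) := forall i j, cmeas (fun x => f x i j).

Lemma mmeas_cst m n (A : 'M[R[i]]_(m, n)) : mmeas (fun=> A).
Proof. by move=> i j; exact: cmeas_cst. Qed.

Lemma mmeasB m n (f g : T -> 'M[R[i]]_(m, n)) : mmeas f -> mmeas g -> mmeas (fun x => f x - g x).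
Proof.
move=> mf mg i j; apply: (cmeas_ext _ (cmeasB (mf i j) (mg i j))) => x.
by rewrite !mxE.
Qed.

Lemma mmeasM m n p (f : T -> 'M[R[i]]_(m, n)) (g : T -> 'M[R[i]]_(n, p)) :
  mmeas f -> mmeas g -> mmeas (fun x => f x *m g x).
Proof.
move=> mf mg i j.
apply: (cmeas_ext _ (@cmeas_sum R _ _ _ (index_enum 'I_n) xpredT (fun k x => f x i k * g x k j) _)).
  by move=> x; rewrite mxE.
by move=> k; exact: cmeasM.
Qed.

Lemma mmeasX n (f : T -> 'M[R[i]]_n) k : mmeas f -> mmeas (fun x => f x ^+ k).
Proof.
move=> mf; elim: k => [|k IH].
  by move=> i j; apply: (cmeas_ext _ (@cmeas_cst R _ _ ((1 : 'M[R[i]]_n) i j))) => x; rewrite expr0.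
move=> i j; apply: (cmeas_ext _ (mmeasM mf IH i j)) => x.
by rewrite exprS.
Qed.

Lemma mmeasZ m n (f : T -> R[i]) (g : T -> 'M[R[i]]_(m, n)) : cmeas f -> mmeas g ->
  mmeas (fun x => f x *: g x).
Proof.
move=> mf mg i j; apply: (cmeas_ext _ (cmeasM mf (mg i j))) => x.
by rewrite mxE.
Qed.

Lemma mmeas_scalar n (f : T -> R[i]) : cmeas f -> @mmeas n n (fun x => (f x)%:M).
Proof.
move=> mf i j; case ij : (i == j).
  by apply: (cmeas_ext _ mf) => x; rewrite mxE ij.
by apply: (cmeas_ext _ (@cmeas_cst R _ _ 0)) => x; rewrite mxE ij.
Qed.

Lemma mmeas_det n (f : T -> 'M[R[i]]_n) : mmeas f -> cmeas (fun x => \det (f x)).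
Proof.
move=> mf; rewrite /determinant; apply: cmeas_sum => s.
by apply: cmeasM; [exact: cmeas_cst|exact: cmeas_prod].
Qed.

Lemma mmeas_tr n (f : T -> 'M[R[i]]_n) : mmeas f -> cmeas (fun x => \tr (f x)).
Proof. by move=> mf; rewrite /mxtrace; apply: cmeas_sum => i; exact: mf. Qed.

Lemma mmeas_inv n (f : T -> 'M[R[i]]_n) : (forall x, f x \in unitmx) -> mmeas f ->
  mmeas (fun x => invmx (f x)).
Proof.
move=> uf mf i j.
have mc : cmeas (fun x => cofactor (f x) j i).
  rewrite /cofactor; apply: cmeasM; first exact: cmeas_cst.
  apply: mmeas_det => k l.
  by apply: (cmeas_ext _ (mf (lift j k) (lift i l))) => x; rewrite !mxE.
apply: (cmeas_ext _ (cmeasM (cmeasV (mmeas_det mf)) mc)) => x.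
by rewrite /invmx uf !mxE.
Qed.

End matrix_measurable.

Section complex_limits2.
Variable R : realType.
Local Notation re := (@complex.Re R).
Local Notation im := (@complex.Im R).

Lemma ccvgV (T : Type) (F : set_system T) {FF : ProperFilter F} (f : T -> R[i]) l :
  l != 0 -> ccvg F f l -> ccvg F (fun t => (f t)^-1) l^-1.
Proof.
move=> l0 [f1 f2].
have q0 : re l ^+ 2 + im l ^+ 2 != 0 by rewrite -cm_sq sqrf_eq0 cm_eq0.
have q : (re (f t) ^+ 2 + im (f t) ^+ 2)^-1 @[t --> F] --> (re l ^+ 2 + im l ^+ 2)^-1.
  apply: cvgV => //; apply: cvgD; rewrite expr2; under eq_fun do rewrite expr2;
  by apply: cvgM.
split.
  by under eq_fun do rewrite reV; rewrite reV; exact: cvgM.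
under eq_fun do rewrite imV mulNr; rewrite imV mulNr.
by apply: cvgN; exact: cvgM.
Qed.

Lemma ccvgX (T : Type) (F : set_system T) {FF : ProperFilter F} (f : T -> R[i]) l n :
  ccvg F f l -> ccvg F (fun t => f t ^+ n) (l ^+ n).
Proof.
move=> fl; elim: n => [|n IH].
  by under [X in ccvg _ X _]eq_fun do rewrite expr0; exact: ccvg_cst.
by rewrite exprS; under [X in ccvg _ X _]eq_fun do rewrite exprS; exact: ccvgM.
Qed.

Lemma ccvg_real (T : Type) (F : set_system T) {FF : ProperFilter F} (f : T -> R) (l : R) :
  f t @[t --> F] --> l -> ccvg F (fun t => (f t)%:C) l%:C.
Proof. by move=> fl; split => //=; exact: cvg_cst. Qed.

Lemma ccvg_unique (T : Type) (F : set_system T) {FF : ProperFilter F} (f : T -> R[i]) l m :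
  ccvg F f l -> ccvg F f m -> l = m.
Proof.
by move=> [a1 a2] [b1 b2]; apply: complex_ext;
  [exact: (cvg_unique _ a1 b1)|exact: (cvg_unique _ a2 b2)].
Qed.

Definition epsn (n : nat) : R := n.+1%:R^-1.

Lemma epsn_gt0 n : 0 < epsn n. Proof. by rewrite invr_gt0 ltr0n. Qed.

Lemma epsn_le1 n : epsn n <= 1. Proof. by rewrite invf_le1 ?ltr0n// ler1n. Qed.

Lemma epsn_cvg : epsn n @[n --> \oo] --> (0:R).
Proof. exact: cvg_harmonic. Qed.

(* comparing the orders of magnitude of the terms of an expansion at 0 *)
Lemma expansion_unique m (a : nat -> R[i]) (b : nat -> R[i]) b0 :
  (forall n, \sum_(q < m) a q * (epsn n)%:C ^+ q + (epsn n)%:C ^+ m * b n = 0) ->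
  ccvg \oo b b0 -> b0 = 0.
Proof.
move=> h bb0; have ee : ccvg \oo (fun n => (epsn n)%:C) 0 by exact: ccvg_real epsn_cvg.
elim: m a h => [|m IH] a h.
  apply: (ccvg_unique bb0); rewrite (_ : b = fun=> 0); first exact: ccvg_cst.
  by apply/funext => n; rewrite -(h n) big_ord0 add0r expr0 mul1r.
have e0 n : (epsn n)%:C != 0.
  by rewrite (_ : 0 = 0%:C)// (inj_eq (@complexI R)) lt0r_neq0// epsn_gt0.
have hE n : a 0%N + (epsn n)%:C *
   (\sum_(q < m) a q.+1 * (epsn n)%:C ^+ q + (epsn n)%:C ^+ m * b n) = 0.
  rewrite -[RHS](h n) big_ord_recl expr0 mulr1 -addrA; congr (_ + _).
  rewrite mulrDr mulrA -exprS; congr (_ + _).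
  by rewrite mulr_sumr; apply: eq_bigr => q _; rewrite mulrCA -exprS.
have a00 : a 0%N = 0.
  apply: (@ccvg_unique _ \oo _ (fun=> 0)); last exact: ccvg_cst.
  rewrite [X in ccvg _ X _](_ : _ = fun n => a 0%N + (epsn n)%:C *
   (\sum_(q < m) a q.+1 * (epsn n)%:C ^+ q + (epsn n)%:C ^+ m * b n)); last first.
    by apply/funext => n; rewrite hE.
  rewrite -[X in ccvg _ _ X]addr0; apply: ccvgD; first exact: ccvg_cst.
  rewrite -[X in ccvg _ _ X](mul0r (\sum_(q < m) a q.+1 * 0 ^+ q + 0 ^+ m * b0)); apply: ccvgM => //.
  apply: ccvgD; last by apply: ccvgM => //; exact: ccvgX.
  apply: (@ccvg_sum R nat \oo _ _ (index_enum 'I_m) xpredT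
    (fun q n => a q.+1 * (epsn n)%:C ^+ q) (fun q => a q.+1 * 0 ^+ q)) => q.
  by apply: ccvgM; [exact: ccvg_cst|exact: ccvgX].
apply: (IH (fun q => a q.+1)) => n.
by apply: (mulfI (e0 n)); rewrite mulr0 -[RHS](hE n) a00 add0r.
Qed.

End complex_limits2.

Section pencil.
Variables (R : realType) (d : nat) (x : 'I_d -> R).
Hypothesis x0 : forall i, x i != 0.
Variable B : 'M[R[i]]_d.
Hypothesis hB : ctr B = B.
Local Notation C := R[i].
Local Notation re := (@complex.Re R).
Local Notation im := (@complex.Im R).

Definition diag_x : 'M[C]_d := diag_mx (\row_i (x i)%:C).
Definition diag_xinv : 'M[C]_d := diag_mx (\row_i ((x i)^-1)%:C).

Lemma XmDm : diag_x *m diag_xinv = 1%:M.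
Proof.
rewrite /diag_x /diag_xinv mulmx_diag (_ : \row_j _ = const_mx 1) ?diag_const_mx//.
by apply/rowP => i; rewrite !mxE -rmorphM mulfV.
Qed.

Lemma Xm_unit : diag_x \in unitmx.
Proof. by have [] := mulmx1_unit XmDm. Qed.

Lemma DmXm : diag_xinv *m diag_x = 1%:M.
Proof. exact: mulmx1C XmDm. Qed.

Lemma ctr_diag (r : 'I_d -> R) : ctr (diag_mx (\row_i (r i)%:C)) = diag_mx (\row_i (r i)%:C).
Proof.
apply/matrixP => i j; rewrite !mxE eq_sym; case: eqP => [->|_].
  by rewrite !mulr1n conjc_real.
by rewrite !mulr0n conjc0.
Qed.

Definition pencil (e t : R) : 'M[C]_d := e%:C *: B - t%:C *: diag_xinv.

Lemma Hm_ctr e t : ctr (pencil e t) = pencil e t.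
Proof.
have ctrZ (c : R) (M : 'M[C]_d) : ctr M = M -> ctr (c%:C *: M) = c%:C *: M.
  move=> hM; rewrite -[in RHS]hM; apply/matrixP => i j; rewrite !mxE rmorphM /=.
  by rewrite oppr0.
have ctrBd (M N : 'M[C]_d) : ctr (M - N) = ctr M - ctr N.
  by apply/matrixP => i j; rewrite !mxE rmorphB.
by rewrite /pencil ctrBd (ctrZ e _ hB) (ctrZ t diag_xinv (ctr_diag (fun i => (x i)^-1))).
Qed.

Definition pencil_product (e : R) (w : C) : 'M[C]_d := diag_x *m (e%:C *: B - w%:M).

Lemma Ym_shift e w (t : R) : pencil_product e w - t%:C%:M = diag_x *m (pencil e t - w%:M).
Proof.
rewrite /pencil_product /pencil !mulmxBr addrAC; congr (_ - _); congr (_ - _).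
by rewrite -scalemxAr XmDm scalemx1.
Qed.

Lemma Hm_unit e t w : nonreal w -> pencil e t - w%:M \in unitmx.
Proof. by move=> nw; have [] := resolvent_le (Hm_ctr e t) nw. Qed.

Lemma Ym_unit e w (t : R) : nonreal w -> pencil_product e w - t%:C%:M \in unitmx.
Proof. by move=> nw; rewrite Ym_shift unitmx_mul Xm_unit Hm_unit. Qed.

Lemma Ym_inv e w (t : R) : nonreal w ->
  invmx (pencil_product e w - t%:C%:M) = invmx (pencil e t - w%:M) *m diag_xinv.
Proof.
move=> nw; have u := Ym_unit e t nw.
have h : (pencil_product e w - t%:C%:M) *m (invmx (pencil e t - w%:M) *m diag_xinv) = 1%:M.
  by rewrite Ym_shift !mulmxA mulmxK ?XmDm// Hm_unit.
by rewrite -[LHS]mulmx1 -h mulKmx.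
Qed.

Definition res_trace e w (t : R) : C := \tr (invmx (pencil e t - w%:M) *m diag_xinv).

Definition even_trace e w (t : R) : C := d%:R + 2^-1 * (t%:C * (res_trace e w t - res_trace e w (- t))).

Lemma tau_eig e w t : nonreal w ->
  res_trace e w t = \sum_(z <- eigvals (pencil_product e w)) (z - t%:C)^-1.
Proof.
by move=> nw; rewrite /res_trace -Ym_inv// trace_resolvent// Ym_unit.
Qed.

Lemma eigvals_Ym_line e w z (t : R) : nonreal w -> z \in eigvals (pencil_product e w) -> z - t%:C != 0.
Proof.
move=> nw zY; have := Ym_unit e t nw; rewrite unit_shift; apply: contra.
by rewrite subr_eq0 => /eqP <-.
Qed.

Lemma eigvals_Ym_nonreal e w z : nonreal w -> z \in eigvals (pencil_product e w) -> nonreal z.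
Proof.
move=> nw zY; have := eigvals_Ym_line (re z) nw zY; apply: contra => /eqP z0.
by rewrite subr_eq0; apply/eqP; apply: complex_ext.
Qed.

Lemma even_kernel (z s : C) : z - s != 0 -> z + s != 0 ->
  1 + 2^-1 * (s * ((z - s)^-1 - (z - - s)^-1)) = - z ^+ 2 * ((s - z)^-1 * (s - - z)^-1).
Proof.
move=> a0 b0; have c0 : s - z != 0 by rewrite -oppr_eq0 opprB.
have b1 : s + z != 0 by rewrite addrC.
by rewrite !opprK; field; rewrite ?a0 ?b0 ?c0 ?b1.
Qed.

Lemma Tm_eig e w t : nonreal w ->
  even_trace e w t = \sum_(z <- eigvals (pencil_product e w)) - z ^+ 2 * kfun [:: z; - z] t.
Proof.
move=> nw; rewrite /even_trace !tau_eig//.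
have -> : d%:R = \sum_(z <- eigvals (pencil_product e w)) (1 : C).
  by rewrite big_const_seq count_predT size_eigvals iter_addr_0.
rewrite -sumrB !mulr_sumr -big_split big_seq [RHS]big_seq; apply: eq_bigr => z zY /=.
have a0 := eigvals_Ym_line t nw zY; have b0 := eigvals_Ym_line (- t) nw zY.
rewrite !kfun_cons kfun_nil mulr1.
have -> : (- t)%:C = - t%:C :> C by rewrite rmorphN.
apply: even_kernel => //.
by move: b0; rewrite (_ : (- t)%:C = - t%:C :> C) ?opprK// rmorphN.
Qed.

Lemma Tm_int e w : 0 < im w ->
  cDom (even_trace e w) /\ re (cint (even_trace e w)) = pi * eigIm (pencil_product e w).
Proof.
move=> w0; have nw := nonreal_pos w0.
have nz z : z \in eigvals (pencil_product e w) -> nonreal z by exact: eigvals_Ym_nonreal.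
have nN (z : C) : nonreal z -> nonreal (- z) by rewrite /nonreal imN oppr_eq0.
have E : even_trace e w =1 (fun t => \sum_(z <- eigvals (pencil_product e w) | z \in eigvals (pencil_product e w))
    - z ^+ 2 * kfun [:: z; - z] t).
  by move=> t; rewrite Tm_eig// big_seq.
have Dz z : z \in eigvals (pencil_product e w) -> cDom (kfun [:: z; - z]).
  by move=> /nz zn; apply: kfun_Dom => //=; rewrite zn nN.
have DE z : z \in eigvals (pencil_product e w) -> cDom (fun t => - z ^+ 2 * kfun [:: z; - z] t).
  by move=> zY; apply: cDomZ; exact: Dz.
split; first by apply: (cDom_ext (fsym E)); exact: cDom_sum.
rewrite (eq_cint E) cint_sum// re_sum /eigIm mulr_sumr [RHS]big_seq.
apply: eq_bigr => z zY; have zn := nz z zY.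
have -> : cint (fun t => - z ^+ 2 * kfun [:: z; - z] t) = - z ^+ 2 * kap [:: z; - z].
  by apply: cintZ; exact: Dz.
rewrite kap2 ?nN//; last first.
  by rewrite -subr_eq0 opprK -mulr2n mulrn_eq0 /=; apply: contra zn => /eqP ->.
have z00 : z != 0 by apply: contra zn => /eqP ->.
have -> : - z ^+ 2 * ((pi * (sgI z - sgI (- z))) *i / (z - - z)) = - z * (pi * sgI z) *i.
  rewrite /sgI imN sgrN opprK.
  have -> : (pi * (Num.sg (im z) + Num.sg (im z))) *i = 2 * (pi * Num.sg (im z)) *i :> C.
    by apply: complex_ext => /=; ring.
  rewrite opprK -mulr2n -mulr_natl; field; exact: z00.
rewrite reM reN imN /= mulr0 sub0r mulNr opprK mulrC -mulrA; congr (_ * _).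
by rewrite /sgI normrEsg.
Qed.

End pencil.

Section pencil_bounds.
Variables (R : realType) (d : nat) (x : 'I_d -> R).
Hypothesis x0 : forall i, x i != 0.
Variable B : 'M[R[i]]_d.
Hypothesis hB : ctr B = B.
Local Notation C := R[i].
Local Notation re := (@complex.Re R).
Local Notation im := (@complex.Im R).
Local Notation Tm := (even_trace x B).
Local Notation Ym := (pencil_product x B).
Local Notation Hm := (pencil x B).
Local Notation tau := (res_trace x B).

Lemma mnorm_scalar (w : C) : mnorm (w%:M : 'M[C]_d) = d%:R * cm w.
Proof.
rewrite /mnorm (eq_bigr (fun=> cm w)) ?sumr_const ?card_ord ?mulr_natl// => i _.
rewrite (bigD1 i)//= big1 ?addr0 ?mxE ?eqxx//.
by move=> j ji; rewrite mxE eq_sym (negPf ji) cm0.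
Qed.

Lemma cm_rect (b eta : R) : cm (Complex b eta) <= `|b| + `|eta|.
Proof. exact: (cm_le (Complex b eta)). Qed.

Lemma shift_norm (e b eta : R) : 0 <= e <= 1 -> 0 <= eta <= 1 ->
  mnorm (e%:C *: B - (Complex b eta)%:M) <= (mnorm B + d%:R) * (1 + `|b|).
Proof.
move=> /andP[e0 e1] /andP[n0 n1]; apply: (le_trans (mnormD _ _)).
rewrite mnormN mnormZ cm_real ger0_norm// mnorm_scalar [leRHS]mulrDl lerD//.
  apply: (@le_trans _ _ (1 * mnorm B)); first by rewrite ler_wpM2r ?mnorm_ge0.
  by rewrite mul1r ler_peMr ?mnorm_ge0// lerDl.
rewrite ler_wpM2l//; apply: (le_trans (cm_rect _ _)).
by rewrite addrC lerD2r ger0_norm.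
Qed.

Lemma Tm_trace e w t : nonreal w ->
  2 * Tm e w t = \tr (Ym e w *m invmx (Ym e w - t%:C%:M) + Ym e w *m invmx (Ym e w - (- t)%:C%:M)).
Proof.
move=> nw.
have h s : \tr (Ym e w *m invmx (Ym e w - s%:C%:M)) = d%:R + s%:C * tau e w s.
  rewrite -[in LHS](subrK s%:C%:M (Ym e w)) addrK mulmxDl mulmxV ?Ym_unit// mul_scalar_mx.
  by rewrite mxtraceD mxtrace1 mxtraceZ Ym_inv.
rewrite mxtraceD !h /Tm (_ : (- t)%:C = - t%:C); last by rewrite rmorphN.
by move: (tau e w t) (tau e w (- t)) (t%:C) (d%:R : C) => a b u v; field.
Qed.

Lemma Tm_bound eta : 0 < eta -> eta <= 1 -> exists2 K : R, 0 <= K &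
  forall e b t, 0 <= e <= 1 -> (1 + t ^+ 2) * cm (Tm e (Complex b eta) t) <= K * (1 + `|b|) ^+ 3.
Proof.
move=> eta0 eta1.
pose kY := mnorm (diag_x x) * (mnorm B + d%:R).
pose kV := d%:R ^+ 5 / `|eta| * mnorm (diag_xinv x).
have kY0 : 0 <= kY by rewrite mulr_ge0 ?addr_ge0 ?mnorm_ge0.
have kV0 : 0 <= kV by rewrite mulr_ge0 ?mnorm_ge0// divr_ge0 ?exprn_ge0.
exists (kY * kV + (kY ^+ 2 * (kY * kV) + kY ^+ 2)).
  have p1 := mulr_ge0 kY0 kV0; have p2 := exprn_ge0 2 kY0.
  by rewrite addr_ge0// addr_ge0// mulr_ge0.
move=> e b t he; set w := Complex b eta; set c := 1 + `|b|.
have nw : nonreal w by apply: nonreal_pos.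
have c1 : 1 <= c by rewrite lerDl.
have c0 : 0 <= c by rewrite (le_trans _ c1).
set Y := Ym e w.
have hY : mnorm Y <= kY * c.
  apply: (le_trans (mnormM _ _)); rewrite /kY -mulrA; apply: ler_wpM2l; first exact: mnorm_ge0.
  by apply: shift_norm => //; rewrite (ltW eta0) eta1.
have hV s : mnorm (invmx (Y - s%:C%:M)) <= kV.
  rewrite Ym_inv// (le_trans (mnormM _ _))// ler_wpM2r ?mnorm_ge0//.
  by have [_] := resolvent_le (Hm_ctr x hB e s) nw.
set V := invmx (Y - t%:C%:M); set V' := invmx (Y - (- t)%:C%:M).
set U := Y *m V + Y *m V'.
have hU : mnorm U <= 2 * (kY * kV * c).
  apply: (le_trans (mnormD _ _)); rewrite mulr_natl mulr2n mulrAC lerD//;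
  by apply: (le_trans (mnormM _ _)); apply: ler_pM; rewrite ?mnorm_ge0 //; exact: hV.
have TU : Tm e w t = 2^-1 * \tr U by rewrite -Tm_trace// mulKf.
have half : cm (2^-1 : C) = 2^-1 :> R.
  have -> : (2^-1 : C) = (2^-1)%:C by rewrite fmorphV rmorph_nat.
  by rewrite cm_real ger0_norm.
have h1 : cm (Tm e w t) <= kY * kV * c.
  rewrite TU cmM half ler_pdivrMl//.
  exact: le_trans (mnorm_tr _) hU.
have tE : (- t)%:C = - t%:C by rewrite rmorphN.
have eU : t%:C ^+ 2 *: U = Y *m Y *m U - 2 *: (Y *m Y).
  apply: resolvent_even; first by rewrite mulmxV// Ym_unit.
  by rewrite -tE mulmxV// Ym_unit.
have hYY : mnorm (Y *m Y) <= kY ^+ 2 * c ^+ 2.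
  rewrite -exprMn expr2 (le_trans (mnormM _ _))// ler_pM ?mnorm_ge0//.
have h2 : t ^+ 2 * cm (Tm e w t) <= (kY ^+ 2 * (kY * kV) + kY ^+ 2) * c ^+ 3.
  have -> : t ^+ 2 * cm (Tm e w t) = 2^-1 * cm (\tr (t%:C ^+ 2 *: U)).
    rewrite mxtraceZ TU [in LHS]cmM half [in RHS]cmM cmX cm_real real_normK ?num_real//.
    by rewrite mulrCA.
  rewrite eU ler_pdivrMl//; apply: (le_trans (mnorm_tr _)).
  apply: (le_trans (mnormD _ _)); rewrite mnormN mnormZ.
  have -> : 2 * ((kY ^+ 2 * (kY * kV) + kY ^+ 2) * c ^+ 3) =
      2 * (kY ^+ 2 * (kY * kV) * c ^+ 3) + 2 * (kY ^+ 2 * c ^+ 3) by rewrite -mulrDr -mulrDl.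
  apply: lerD.
    apply: (le_trans (mnormM _ _)).
    apply: (@le_trans _ _ (kY ^+ 2 * c ^+ 2 * (2 * (kY * kV * c)))).
      by rewrite ler_pM ?mnorm_ge0.
    by rewrite le_eqVlt; apply/orP; left; apply/eqP; ring.
  have -> : cm (2 : C) = 2 :> R.
    have -> : (2 : C) = 2%:C by rewrite rmorph_nat.
    by rewrite cm_real ger0_norm.
  rewrite ler_wpM2l// (le_trans hYY)// ler_wpM2l ?exprn_ge0//.
  by rewrite (exprS c 2) ler_peMl// exprn_ge0.
rewrite mulrDl mul1r mulrDl lerD//.
apply: (le_trans h1); apply: ler_wpM2l; first exact: mulr_ge0.
exact: ler_eXnr.
Qed.

Lemma resolvent_meas (e eta s : R) : eta != 0 ->
  mmeas (fun p : R * R => invmx (Hm e (s * p.2) - (Complex p.1 eta)%:M)).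
Proof.
move=> eta0; apply: mmeas_inv; first by move=> p; apply: Hm_unit.
have m1 : measurable_fun setT (fun p : R * R => p.1) by exact: measurable_fst.
have m2 : measurable_fun setT (fun p : R * R => p.2) by exact: measurable_snd.
apply: mmeasB; last first.
  by apply: mmeas_scalar; split => //=; exact: measurable_cst.
apply: mmeasB; first exact: mmeas_cst.
apply: mmeasZ; last exact: mmeas_cst.
by apply: cmeas_real; exact: measurable_funM.
Qed.

Lemma snd_cmeas : cmeas (fun p : R * R => (p.2)%:C).
Proof. by apply: cmeas_real; exact: measurable_snd. Qed.

Lemma Tm_meas e eta : eta != 0 -> cmeas (fun p : R * R => Tm e (Complex p.1 eta) p.2).
Proof.
move=> eta0; rewrite /even_trace.
have mt s : cmeas (fun p : R * R => tau e (Complex p.1 eta) (s * p.2)).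
  apply: mmeas_tr; apply: mmeasM; [exact: resolvent_meas|exact: mmeas_cst].
apply: cmeasD; first exact: cmeas_cst.
apply: cmeasM; first exact: cmeas_cst.
apply: cmeasM; first exact: snd_cmeas.
apply: cmeasB.
  by apply: (cmeas_ext _ (mt 1)) => p; rewrite mul1r.
by apply: (cmeas_ext _ (mt (-1))) => p; rewrite mulN1r.
Qed.

End pencil_bounds.

Section weight_function.
Variable R : realType.
Local Notation C := R[i].
Local Notation re := (@complex.Re R).
Local Notation im := (@complex.Im R).
Variable l : nat.

Definition test_fun (w : C) : C := w ^+ l * (w - Complex 0 2)^-1 ^+ (l + 5).

Lemma gf_bound (b eta : R) : 0 <= eta <= 1 ->
  cm (test_fun (Complex b eta)) * (1 + `|b|) ^+ 3 <= 2 ^+ (l + 5) * hw b.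
Proof.
move=> /andP[e0 e1]; set w := Complex b eta; set c := 1 + `|b|.
have c0 : 0 < c by rewrite ltr_wpDr.
have q2 : c <= 2 * cm (w - Complex 0 2).
  have h1 : `|b| <= cm (w - Complex 0 2).
    by have := re_le_cm (w - Complex 0 2); rewrite reD reN /= subr0.
  have h2 : 1 <= cm (w - Complex 0 2).
    apply: le_trans (im_le_cm (w - Complex 0 2)).
    by rewrite imD imN /= ler0_norm ?opprB; lra.
  by rewrite /c; lra.
have q0 : 0 < cm (w - Complex 0 2) by rewrite -(pmulr_rgt0 _ (ltr0Sn R 1)) (lt_le_trans c0).
have wc : cm w <= c.
  by apply: (le_trans (cm_le w)); rewrite /= addrC lerD2r ger0_norm.
rewrite /test_fun cmM !cmX cmV exprVn /hw.
have b2 : 1 + b ^+ 2 <= c ^+ 2.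
  rewrite -(@real_normK _ b) ?num_real// /c.
  by have := normr_ge0 b; move: `|b| => u u0; nra.
rewrite ler_pdivlMr ?ltr_wpDr ?sqr_ge0//.
apply: (@le_trans _ _ (c ^+ l / cm (w - Complex 0 2) ^+ (l + 5) * c ^+ 3 * c ^+ 2)).
  rewrite ler_pM ?mulr_ge0 ?invr_ge0 ?exprn_ge0 ?cm_ge0 ?addr_ge0 ?sqr_ge0 ?(ltW c0)//.
  rewrite ler_wpM2r ?exprn_ge0 ?(ltW c0)// ler_wpM2r ?invr_ge0 ?exprn_ge0 ?cm_ge0//.
  by rewrite lerXn2r ?nnegrE ?cm_ge0 ?(ltW c0).
have -> : c ^+ l / cm (w - Complex 0 2) ^+ (l + 5) * c ^+ 3 * c ^+ 2 =
    c ^+ (l + 5) / cm (w - Complex 0 2) ^+ (l + 5).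
  have -> : c ^+ (l + 5) = c ^+ l * (c ^+ 3 * c ^+ 2) by rewrite -!exprD.
  by rewrite mulrAC -mulrA mulrAC !mulrA.
rewrite ler_pdivrMr ?exprn_gt0// -exprMn lerXn2r// nnegrE ?(ltW c0)//.
by rewrite mulr_ge0// cm_ge0.
Qed.

Definition gp (eta : R) : {poly C} := ('X + (Complex 0 eta)%:P) ^+ l.
Definition gnode (eta : R) : C := Complex 0 (2 - eta).

Lemma gf_kfun (b eta : R) :
  test_fun (Complex b eta) = (gp eta).[b%:C] * kfun (nseq (l + 5) (gnode eta)) b.
Proof.
rewrite kfun_nseq /test_fun /gp horner_exp hornerD hornerX hornerC.
by congr (_ ^+ _ * _^-1 ^+ _); apply: complex_ext; rewrite /= ?subr0 ?addr0 ?add0r ?sub0r ?opprB//.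
Qed.

Lemma size_gp eta : size (gp eta) = l.+1.
Proof.
rewrite /gp (_ : 'X + _ = 'X - (- Complex 0 eta)%:P) ?size_exp_XsubC//.
by rewrite polyCN opprK.
Qed.

Lemma gnode_pos eta : eta <= 1 -> 0 < im (gnode eta).
Proof. by move=> e1 /=; lra. Qed.

Lemma gf_meas eta : cmeas (fun b => test_fun (Complex b eta)).
Proof.
have mw : cmeas (fun b => Complex b eta) by split => //=; exact: measurable_cst.
rewrite /test_fun; apply: cmeasM; first exact: cmeasX.
by apply: cmeasX; apply: cmeasV; apply: cmeasB => //; exact: cmeas_cst.
Qed.

Lemma gf_int eta : 0 <= eta <= 1 ->
  cDom (fun b => test_fun (Complex b eta)) /\ cint (fun b => test_fun (Complex b eta)) = 0.
Proof.
move=> /andP[e0 e1].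
have ng : nonreal (gnode eta) by apply: nonreal_pos; exact: gnode_pos.
have E b : (gp eta).[b%:C] * kfun (nseq (l + 5) (gnode eta)) b = test_fun (Complex b eta).
  by rewrite gf_kfun.
have a1 : all (@nonreal R) (nseq (l + 5) (gnode eta)) by rewrite all_nseq ng orbT.
have s1 : (size (gp eta) < size (nseq (l + 5) (gnode eta)))%N.
  by rewrite size_gp size_nseq; lia.
split; first by apply: (cDom_ext E); exact: pfun_Dom.
rewrite -(eq_cint E); apply: (@pkap_same _ _ _ (sgI (gnode eta))) => //.
by rewrite all_nseq eqxx orbT.
Qed.

Lemma gf_pole (eta be : R) : 0 < eta -> eta <= 1 ->
  [/\ cDom (fun b => test_fun (Complex b eta) / (be%:C - Complex b eta)),
   cint (fun b => test_fun (Complex b eta) / (be%:C - Complex b eta)) = (2 * pi) *i * test_fun be%:C,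
   cDom (fun b => test_fun (Complex b eta) * ((be%:C - Complex b eta)^-1)^*%C) &
   cint (fun b => test_fun (Complex b eta) * ((be%:C - Complex b eta)^-1)^*%C) = 0].
Proof.
move=> e0 e1.
have l5 : (l + 5 = (l + 4).+1)%N by rewrite addnS.
have gpos := gnode_pos e1.
have ng : nonreal (gnode eta) by apply: nonreal_pos.
have a1 : all (@nonreal R) (nseq (l + 5) (gnode eta)) by rewrite all_nseq ng orbT.
pose u := Complex be (- eta); pose v := Complex be eta.
have u0 : im u < 0 by rewrite /= oppr_lt0.
have nu := nonreal_neg u0; have nv : nonreal v by apply: nonreal_pos.
have E1 b : -1 * ((gp eta).[b%:C] * kfun (u :: nseq (l + 5) (gnode eta)) b) =
    test_fun (Complex b eta) / (be%:C - Complex b eta).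
  rewrite gf_kfun kfun_cons.
  have -> : be%:C - Complex b eta = - (b%:C - u).
    by apply: complex_ext; rewrite /=; ring.
  by rewrite invrN mulrN mulN1r mulrCA mulrC.
have E2 b : -1 * ((gp eta).[b%:C] * kfun (v :: nseq (l + 5) (gnode eta)) b) =
    test_fun (Complex b eta) * ((be%:C - Complex b eta)^-1)^*%C.
  rewrite gf_kfun kfun_cons conjc_inv.
  have -> : (be%:C - Complex b eta)^*%C = - (b%:C - v).
    by apply: complex_ext; rewrite /=; ring.
  by rewrite invrN mulrN mulN1r mulrCA mulrC.
have D1 : cDom (fun b => (gp eta).[b%:C] * kfun (u :: nseq (l + 5) (gnode eta)) b).
  by apply: pfun_Dom => /=; [rewrite nu a1|rewrite size_gp size_nseq; lia].
have D2 : cDom (fun b => (gp eta).[b%:C] * kfun (v :: nseq (l + 5) (gnode eta)) b).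
  by apply: pfun_Dom => /=; [rewrite nv a1|rewrite size_gp size_nseq; lia].
split.
- by apply: (cDom_ext E1); exact: cDomZ.
- rewrite -(eq_cint E1) cintZ// {1}l5 pkap_pole//; last by rewrite size_gp; lia.
  have -> : (gp eta).[u] = be%:C ^+ l.
    rewrite /gp horner_exp hornerD hornerX hornerC; congr (_ ^+ _).
    by apply: complex_ext; rewrite /=; ring.
  have -> : u - gnode eta = be%:C - Complex 0 2.
    by apply: complex_ext; rewrite /=; ring.
  by rewrite -l5 /test_fun exprVn mulN1r !mulNr opprK mulrA.
- by apply: (cDom_ext E2); exact: cDomZ.
- rewrite -(eq_cint E2) cintZ// (@pkap_same _ _ _ 1) ?mulr0//.
  + by rewrite /= nv a1.
  + by rewrite /= /sgI gtr0_sg//= eqxx all_nseq /= gtr0_sg ?eqxx ?orbT.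
  + by rewrite size_gp /= size_nseq; lia.
Qed.

End weight_function.

Section strip.
Variables (R : realType) (d : nat) (x : 'I_d -> R).
Hypothesis x0 : forall i, x i != 0.
Variable B : 'M[R[i]]_d.
Hypothesis hB : ctr B = B.
Variable l : nat.
Local Notation C := R[i].
Local Notation re := (@complex.Re R).
Local Notation im := (@complex.Im R).
Local Notation Tm := (even_trace x B).
Local Notation Ym := (pencil_product x B).
Local Notation Hm := (pencil x B).
Local Notation tau := (res_trace x B).
Local Notation gf := (@test_fun R l).

Definition weighted_re (eta : R) (f : R * R -> C) : R * R -> C :=
  fun p => gf (Complex p.1 eta) * (re (f p))%:C.

Lemma gRe_Dom2 (eta : R) (f : R * R -> C) (K : R) : 0 <= eta <= 1 -> cmeas f ->
  (forall b t, (1 + t ^+ 2) * cm (f (b, t)) <= K * (1 + `|b|) ^+ 3) ->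
  cDom2 (weighted_re eta f) /\
  forall b t, cm (weighted_re eta f (b, t)) <= K * 2 ^+ (l + 5) * (hw b * hw t).
Proof.
move=> he mf fK.
have bound b t : cm (weighted_re eta f (b, t)) <= K * 2 ^+ (l + 5) * (hw b * hw t).
  have q0 : 0 < 1 + t ^+ 2 by rewrite ltr_wpDr ?sqr_ge0.
  have hf : cm (f (b, t)) <= K * (1 + `|b|) ^+ 3 * hw t.
    by rewrite /hw ler_pdivlMr// mulrC.
  rewrite /weighted_re cmM cm_real /=.
  apply: (@le_trans _ _ (cm (gf (Complex b eta)) * (K * (1 + `|b|) ^+ 3 * hw t))).
    by rewrite ler_wpM2l ?cm_ge0// (le_trans (re_le_cm _) hf).
  have K0 : 0 <= K.
    have := fK 0 0; rewrite normr0 addr0 !expr1n mulr1 expr0n addr0 mul1r.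
    exact: le_trans (cm_ge0 _).
  have -> : cm (gf (Complex b eta)) * (K * (1 + `|b|) ^+ 3 * hw t) =
     K * (cm (gf (Complex b eta)) * (1 + `|b|) ^+ 3) * hw t.
    move: (cm _) ((1 + `|b|) ^+ 3) (hw t) => u v s; ring.
  have -> : K * 2 ^+ (l + 5) * (hw b * hw t) = K * (2 ^+ (l + 5) * hw b) * hw t.
    by rewrite !mulrA.
  by rewrite ler_wpM2r ?hw_ge0// ler_wpM2l// gf_bound.
split=> //; split; last by exists (K * 2 ^+ (l + 5)).
apply: cmeasM; last by apply: cmeas_real; case: mf.
have [m1 m2] := gf_meas l eta.
by split; [exact: (measurableT_comp m1 measurable_fst)|exact: (measurableT_comp m2 measurable_fst)].
Qed.

Lemma tau_int e s : exists v : C, forall eta, 0 < eta -> eta <= 1 ->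
  [/\ cDom (fun b => gf (Complex b eta) * tau e (Complex b eta) s),
      cint (fun b => gf (Complex b eta) * tau e (Complex b eta) s) = v,
      cDom (fun b => gf (Complex b eta) * (tau e (Complex b eta) s)^*%C) &
      cint (fun b => gf (Complex b eta) * (tau e (Complex b eta) s)^*%C) = 0].
Proof.
have [be [c hc]] := resolvent_trace (diag_xinv x) (Hm_ctr x hB e s).
exists (\sum_k c k * ((2 * pi) *i * gf (be k)%:C)) => eta e0 e1.
have nw b : nonreal (Complex b eta) by apply: nonreal_pos.
have E1 b : \sum_k c k * (gf (Complex b eta) / ((be k)%:C - Complex b eta)) =
    gf (Complex b eta) * tau e (Complex b eta) s.
  rewrite /res_trace hc// mulr_sumr; apply: eq_bigr => k _; exact: mulrCA.
have E2 b : \sum_k (c k)^*%C * (gf (Complex b eta) * (((be k)%:C - Complex b eta)^-1)^*%C) =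
    gf (Complex b eta) * (tau e (Complex b eta) s)^*%C.
  rewrite /res_trace hc// rmorph_sum mulr_sumr; apply: eq_bigr => k _.
  by rewrite [in RHS]rmorphM /= mulrCA.
have P k := gf_pole l (be k) e0 e1.
split.
- by apply: (cDom_ext E1); apply: cDom_sum => k _; apply: cDomZ; case: (P k).
- rewrite -(eq_cint E1) cint_sum; last by move=> k _; apply: cDomZ; case: (P k).
  by apply: eq_bigr => k _; have [D1 <- _ _] := P k; rewrite cintZ.
- by apply: (cDom_ext E2); apply: cDom_sum => k _; apply: cDomZ; case: (P k).
- rewrite -(eq_cint E2) cint_sum; last by move=> k _; apply: cDomZ; case: (P k).
  by rewrite big1// => k _; have [_ _ D2 e2] := P k; rewrite cintZ// e2 mulr0.
Qed.

Lemma re_half (z : C) : (re z)%:C = 2^-1 * (z + z^*%C).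
Proof. by rewrite addcJ mulrA mulVf ?mul1r// pnatr_eq0. Qed.

Lemma cint_combination (n k cg ca cb ca' cb' : C) (g a b a' b' : R -> C) :
  cDom g -> cDom a -> cDom b -> cDom a' -> cDom b' ->
  cint g = cg -> cint a = ca -> cint b = cb -> cint a' = ca' -> cint b' = cb' ->
  cint (fun s => 2^-1 * (n * g s + k * (a s - b s) + k * (a' s - b' s))) =
  2^-1 * (n * cg + k * (ca - cb) + k * (ca' - cb')).
Proof.
move=> Dg Da Db Da' Db' <- <- <- <- <-.
have D1 := cDomB Da Db; have D2 := cDomB Da' Db'.
have D3 := cDomZ k D1; have D4 := cDomZ k D2; have D5 := cDomZ n Dg.
rewrite (cintZ _ (cDomD (cDomD D5 D3) D4)) (cintD (cDomD D5 D3) D4) (cintD D5 D3).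
by rewrite (cintZ _ D1) (cintZ _ D2) (cintZ _ Dg) (cintB Da Db) (cintB Da' Db').
Qed.

Lemma inner_const e t eta1 eta2 : 0 < eta1 -> eta1 <= 1 -> 0 < eta2 -> eta2 <= 1 ->
  cint (fun b => gf (Complex b eta1) * (re (Tm e (Complex b eta1) t))%:C) =
  cint (fun b => gf (Complex b eta2) * (re (Tm e (Complex b eta2) t))%:C).
Proof.
have [v1 h1] := tau_int e t; have [v2 h2] := tau_int e (- t).
suff H eta : 0 < eta -> eta <= 1 ->
  cint (fun b => gf (Complex b eta) * (re (Tm e (Complex b eta) t))%:C) =
  2^-1 * (2^-1 * (t%:C * (v1 - v2))).
  by move=> a1 b1 a2 b2; transitivity (2^-1 * (2^-1 * (t%:C * (v1 - v2)))); [exact: H|symmetry; exact: H].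
move=> e0 e1.
have [D1 i1 D1' i1'] := h1 eta e0 e1; have [D2 i2 D2' i2'] := h2 eta e0 e1.
have [Dg ig] : cDom (fun b => gf (Complex b eta)) /\ cint (fun b => gf (Complex b eta)) = 0.
  by apply: gf_int; rewrite (ltW e0).
pose k1 : C := 2^-1 * t%:C.
have E b : 2^-1 * (2 * d%:R * gf (Complex b eta) +
     k1 * (gf (Complex b eta) * tau e (Complex b eta) t - gf (Complex b eta) * tau e (Complex b eta) (- t)) +
     k1 * (gf (Complex b eta) * (tau e (Complex b eta) t)^*%C - gf (Complex b eta) * (tau e (Complex b eta) (- t))^*%C))
   = gf (Complex b eta) * (re (Tm e (Complex b eta) t))%:C.
  rewrite re_half /Tm /k1.
  have cD (u v : C) : (u + v)^*%C = u^*%C + v^*%C by exact: rmorphD.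
  have cN (u v : C) : (u - v)^*%C = u^*%C - v^*%C by exact: rmorphB.
  have cM (u v : C) : (u * v)^*%C = u^*%C * v^*%C by exact: rmorphM.
  rewrite cD !cM cN conjc_nat conjc_real.
  have -> : (2^-1 : C)^*%C = 2^-1 by rewrite conjc_inv conjc_nat.
  move: (gf _) (tau e _ t) (tau e _ (- t)) (t%:C) (d%:R : C) => g a b' s n.
  move: (a^*%C) (b'^*%C) => a2 b2.
  by field.
transitivity (2^-1 * (2 * d%:R * 0 + k1 * (v1 - v2) + k1 * (0 - 0))); last first.
  by rewrite subrr !mulr0 add0r addr0 /k1 -!mulrA.
rewrite -(eq_cint E).
exact: (cint_combination _ _ Dg D1 D2 D1' D2' ig i1 i2 i1' i2').
Qed.

Lemma strip_const e eta1 eta2 : 0 <= e <= 1 -> 0 < eta1 -> eta1 <= 1 -> 0 < eta2 -> eta2 <= 1 ->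
  cint (fun b => gf (Complex b eta1) * (pi * eigIm (Ym e (Complex b eta1)))%:C) =
  cint (fun b => gf (Complex b eta2) * (pi * eigIm (Ym e (Complex b eta2)))%:C).
Proof.
move=> he a1 b1 a2 b2.
have key eta : 0 < eta -> eta <= 1 ->
   cint (fun b => gf (Complex b eta) * (pi * eigIm (Ym e (Complex b eta)))%:C) =
   cint (fun t => cint (fun b => gf (Complex b eta) * (re (Tm e (Complex b eta) t))%:C)).
  move=> e0 e1.
  have [K K0 hK] := Tm_bound x0 hB e0 e1.
  have he' : 0 <= eta <= 1 by rewrite (ltW e0).
  have mT : cmeas (fun p : R * R => Tm e (Complex p.1 eta) p.2).
    by apply: Tm_meas => //; exact: lt0r_neq0.
  have [D2 _] := gRe_Dom2 he' mT (fun b t => hK e b t he).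
  rewrite -(cFubini D2); apply: eq_cint => b; rewrite /weighted_re /=.
  have [DT iT] := Tm_int x0 hB e (e0 : 0 < im (Complex b eta)).
  have Dre : cDom (fun t => (re (Tm e (Complex b eta) t))%:C).
    apply: (@cDom_ext R (fun t => 2^-1 * (Tm e (Complex b eta) t + (Tm e (Complex b eta) t)^*%C))).
      by move=> t; rewrite re_half.
    by apply: cDomZ; apply: cDomD => //; exact: cDom_conj.
  rewrite cintZ//; congr (_ * _); rewrite -iT; apply: complex_ext => //=.
  by rewrite /Rintegral integral0_eq.
apply: etrans (key eta1 a1 b1) _; apply: etrans _ (esym (key eta2 a2 b2)).
by apply: eq_cint => t; exact: inner_const.
Qed.

Lemma Ym_mcvg (T : Type) (F : set_system T) {FF : ProperFilter F} e (w : T -> C) (w0 : C) :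
  ccvg F w w0 -> mcvg F (fun s => Ym e (w s)) (Ym e w0).
Proof.
move=> ww; apply: mcvgM; first exact: mcvg_cst.
by apply: mcvgB; [exact: mcvg_cst|exact: mcvg_scalar].
Qed.

Lemma eigIm_Ym_continuous e eta : continuous (fun b => eigIm (Ym e (Complex b eta))).
Proof.
move=> b.
have FF := @nbhs_pfilter R b.
have h : mcvg (nbhs b) (fun s => Ym e (Complex s eta)) (Ym e (Complex b eta)).
  by apply: Ym_mcvg; split => /=; [exact: cvg_id|exact: cvg_cst].
exact: (eigIm_cvg h).
Qed.

Lemma eigIm_Ym_le e b eta : 0 <= e <= 1 -> 0 <= eta <= 1 ->
  eigIm (Ym e (Complex b eta)) <= d%:R * (mnorm (diag_x x) * (mnorm B + d%:R)) * (1 + `|b|) ^+ 3.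
Proof.
move=> he hn; apply: (le_trans (eigIm_le _)); rewrite -!mulrA ler_wpM2l//.
apply: (le_trans (mnormM _ _)); rewrite ler_wpM2l ?mnorm_ge0//.
apply: (le_trans (shift_norm B b he hn)); rewrite ler_wpM2l ?addr_ge0 ?mnorm_ge0//.
by apply: ler_eXnr => //; rewrite lerDl.
Qed.

Lemma gf_eigIm_bound e b eta : 0 <= e <= 1 -> 0 <= eta <= 1 ->
  cm (gf (Complex b eta) * (pi * eigIm (Ym e (Complex b eta)))%:C) <=
  pi * (d%:R * (mnorm (diag_x x) * (mnorm B + d%:R))) * 2 ^+ (l + 5) * hw b.
Proof.
move=> he hn.
rewrite cmM cm_real ger0_norm ?mulr_ge0 ?pi_ge0 ?eigIm_ge0//.
set M := d%:R * (mnorm (diag_x x) * (mnorm B + d%:R)).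
have M0 : 0 <= M by rewrite !mulr_ge0 ?addr_ge0 ?mnorm_ge0.
apply: (@le_trans _ _ (cm (gf (Complex b eta)) * (pi * (M * (1 + `|b|) ^+ 3)))).
  by rewrite ler_wpM2l ?cm_ge0// ler_wpM2l ?pi_ge0// eigIm_Ym_le.
have -> : cm (gf (Complex b eta)) * (pi * (M * (1 + `|b|) ^+ 3)) =
   pi * M * (cm (gf (Complex b eta)) * (1 + `|b|) ^+ 3).
  by move: (cm _) ((1 + `|b|) ^+ 3) => u v; ring.
have p0 : 0 <= pi * M by exact: mulr_ge0 (pi_ge0 R) M0.
rewrite -[leRHS]mulrA; apply: ler_wpM2l => //.
by apply: gf_bound.
Qed.

Lemma strip_limit e : 0 <= e <= 1 ->
  cint (fun b => gf b%:C * (pi * eigIm (Ym e b%:C))%:C) =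
  cint (fun b => gf (Complex b 1) * (pi * eigIm (Ym e (Complex b 1)))%:C).
Proof.
move=> he.
pose f_ n b := gf (Complex b (epsn R n)) * (pi * eigIm (Ym e (Complex b (epsn R n))))%:C.
pose f b := gf b%:C * (pi * eigIm (Ym e b%:C))%:C.
pose K := pi * (d%:R * (mnorm (diag_x x) * (mnorm B + d%:R))) * 2 ^+ (l + 5).
have en n : 0 <= epsn R n <= 1 by rewrite (ltW (epsn_gt0 _ _)) epsn_le1.
have mf n : cmeas (f_ n).
  apply: cmeasM; first exact: gf_meas.
  apply: cmeas_real; apply: measurable_funM => //.
  by apply: continuous_measurable_fun; exact: eigIm_Ym_continuous.
have bf n b : cm (f_ n b) <= K * hw b by exact: gf_eigIm_bound.
have cf b : ccvg \oo (fun n => f_ n b) (f b).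
  have cw : ccvg \oo (fun n => Complex b (epsn R n)) b%:C.
    by split => /=; [exact: cvg_cst|exact: epsn_cvg].
  apply: ccvgM.
    apply: ccvgM; first exact: ccvgX.
    apply: ccvgX; apply: ccvgV; last by apply: ccvgD => //; exact: ccvg_cst.
    by apply: line_neq0; apply: nonreal_pos => /=; exact: ltr0n.
  apply: ccvg_real; apply: cvgM; first exact: cvg_cst.
  by apply: eigIm_cvg; apply: (@Ym_mcvg nat \oo _ e (fun n => Complex b (epsn R n)) b%:C).
have [c1 c2] := @cint_cvg R f_ f K mf bf (fun b => (cf b).1) (fun b => (cf b).2).
apply: (@ccvg_unique R nat \oo _ (fun n => cint (f_ n))); first by split.
rewrite (_ : (fun n => _) = fun=> cint (fun b => gf (Complex b 1) * (pi * eigIm (Ym e (Complex b 1)))%:C)).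
  exact: ccvg_cst.
by apply/funext => n; apply: strip_const => //; rewrite ?epsn_gt0 ?epsn_le1.
Qed.

End strip.

Section tame_functional.
Variables (R : realType) (l : nat).
Local Notation C := R[i].
Local Notation re := (@complex.Re R).
Local Notation mu := (@lebesgue_measure R).
Local Notation gRe := (@weighted_re R l 1).

Definition tame_by (K : R) (f : R * R -> C) :=
  cmeas f /\ forall b t, (1 + t ^+ 2) * cm (f (b, t)) <= K * (1 + `|b|) ^+ 3.
Definition tame (f : R * R -> C) := exists K, tame_by K f.

Lemma tame_by_Dom2 K f : tame_by K f -> cDom2 (gRe f) /\
  forall b t, cm (gRe f (b, t)) <= K * 2 ^+ (l + 5) * (hw b * hw t).
Proof. by move=> [mf fK]; apply: gRe_Dom2 => //; rewrite ler01 lexx. Qed.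

Lemma tame_ext f g : f =1 g -> tame f -> tame g.
Proof. by move=> /funext ->. Qed.

Lemma tameD f g : tame f -> tame g -> tame (fun p => f p + g p).
Proof.
move=> [K [mf hf]] [L [mg hg]]; exists (K + L); split; first exact: cmeasD.
move=> b t; rewrite [leRHS]mulrDl; apply: le_trans _ (lerD (hf b t) (hg b t)).
by rewrite -mulrDr ler_wpM2l ?cmD// addr_ge0// sqr_ge0.
Qed.

Lemma tameZ c f : tame f -> tame (fun p => c * f p).
Proof.
move=> [K [mf hf]]; exists (cm c * K); split; first by apply: cmeasM => //; exact: cmeas_cst.
by move=> b t; rewrite cmM mulrCA -mulrA ler_wpM2l ?cm_ge0.
Qed.

Lemma tame0 : tame (fun=> 0).
Proof. by exists 0; split => [|b t]; [exact: cmeas_cst|rewrite cm0 mulr0 mul0r]. Qed.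

Lemma tame_sum n (F : 'I_n -> R * R -> C) : (forall q, tame (F q)) ->
  tame (fun p => \sum_(q < n) F q p).
Proof.
elim: n F => [F _|n IH F hF].
  by apply: tame_ext tame0 => p; rewrite big_ord0.
apply: tame_ext (tameD (hF ord0) (IH (fun q => F (lift ord0 q)) (fun q => hF _))) => p.
by rewrite big_ord_recl.
Qed.

Definition double_int (f : R * R -> C) : C := cint (fun b => cint (fun t => gRe f (b, t))).

Lemma Jf_ext f g : f =1 g -> double_int f = double_int g.
Proof. by move=> /funext ->. Qed.

Lemma tame_Dom2 f : tame f -> cDom2 (gRe f).
Proof. by move=> [K /tame_by_Dom2[]]. Qed.

Lemma JfD f g : tame f -> tame g -> double_int (fun p => f p + g p) = double_int f + double_int g.
Proof.
move=> /tame_Dom2 hf /tame_Dom2 hg; rewrite /double_int -cintD; [|exact: cDom2_int..].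
apply: eq_cint => b; rewrite -cintD; [|exact: cDom2_slice1..].
by apply: eq_cint => t; rewrite /weighted_re reD rmorphD /= mulrDr.
Qed.

Lemma JfZ (c : R) f : tame f -> double_int (fun p => c%:C * f p) = c%:C * double_int f.
Proof.
move=> /tame_Dom2 hf; rewrite /double_int -cintZ; last exact: cDom2_int.
apply: eq_cint => b; rewrite -cintZ; last exact: cDom2_slice1.
by apply: eq_cint => t; rewrite /weighted_re reM /= mul0r subr0 rmorphM /= mulrCA.
Qed.

Lemma Jf0 : double_int (fun=> 0) = 0.
Proof.
rewrite /double_int -[RHS](@cint0 R); apply: eq_cint => b; rewrite -[RHS](@cint0 R).
by apply: eq_cint => t; rewrite /weighted_re mulr0.
Qed.

Lemma Jf_sum n (F : 'I_n -> R * R -> C) : (forall q, tame (F q)) ->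
  double_int (fun p => \sum_(q < n) F q p) = \sum_(q < n) double_int (F q).
Proof.
elim: n F => [F _|n IH F hF].
  by rewrite big_ord0 -[RHS]Jf0; apply: Jf_ext => p; rewrite big_ord0.
transitivity (double_int (fun p => F ord0 p + \sum_(q < n) F (lift ord0 q) p)).
  by apply: Jf_ext => p; rewrite big_ord_recl.
transitivity (double_int (F ord0) + double_int (fun p => \sum_(q < n) F (lift ord0 q) p)).
  by apply: JfD; [exact: hF|apply: tame_sum => q; exact: hF].
rewrite big_ord_recl; congr (_ + _).
exact: (IH (fun q => F (lift ord0 q)) (fun q => hF _)).
Qed.

Lemma Jf_combine f0 f1 f2 f3 (c r : R) : tame f0 -> tame f1 -> tame f2 -> tame f3 ->
  double_int (fun p => f0 p + (c%:C * f1 p + (f2 p + r%:C * f3 p))) =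
  double_int f0 + (c%:C * double_int f1 + (double_int f2 + r%:C * double_int f3)).
Proof.
move=> h0 h1 h2 h3; have h1' := tameZ c%:C h1; have h3' := tameZ r%:C h3.
have h23 := tameD h2 h3'; have h123 := tameD h1' h23.
by rewrite (JfD h0 h123) (JfD h1' h23) (JfD h2 h3') (JfZ _ h1) (JfZ _ h3).
Qed.

Lemma Jf_sumZ n (c : 'I_n -> R) (F : 'I_n -> R * R -> C) : (forall q, tame (F q)) ->
  double_int (fun p => \sum_(q < n) (c q)%:C * F q p) = \sum_(q < n) (c q)%:C * double_int (F q).
Proof.
move=> h; rewrite (Jf_sum (F := fun q p => (c q)%:C * F q p)); last by move=> q; exact: tameZ.
by apply: eq_bigr => q _; exact: JfZ.
Qed.

Lemma Jf_bound K f : tame_by K f ->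
  cm (double_int f) <= K * 2 ^+ (l + 5) * (2 * \int[mu]_x hw x) * (2 * \int[mu]_x hw x).
Proof.
move=> /tame_by_Dom2[D hK]; apply: cint_bound; first by case: (cDom2_int D).
move=> b; rewrite -mulrA [_ * hw b]mulrC mulrA.
by apply: cint_bound; [case: (cDom2_slice1 b D)|move=> t; rewrite -mulrA].
Qed.

End tame_functional.

Section expansion.
Variables (R : realType) (d : nat) (x : 'I_d -> R).
Hypothesis x0 : forall i, x i != 0.
Variable B : 'M[R[i]]_d.
Hypothesis hB : ctr B = B.
Variable l : nat.
Local Notation C := R[i].
Local Notation re := (@complex.Re R).
Local Notation im := (@complex.Im R).
Local Notation mu := (@lebesgue_measure R).
Local Notation Tm := (even_trace x B).
Local Notation Ym := (pencil_product x B).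
Local Notation Hm := (pencil x B).
Local Notation tau := (res_trace x B).
Local Notation Dm := (diag_xinv x).
Local Notation Xm := (diag_x x).

Definition free_res (w : C) (t : R) : 'M[C]_d := invmx (Hm 0 t - w%:M).
Definition neumann_trace (n : nat) (e : R) (w : C) (t : R) : C :=
  \tr (invmx (Hm e t - w%:M) *m (B *m free_res w t) ^+ n *m Dm).
Definition evn (f : R -> C) (t : R) : C := 2^-1 * (t%:C * (f t - f (- t))).

Lemma tau_expand e w t n : nonreal w ->
  tau e w t = \sum_(q < n) (- e%:C) ^+ q * neumann_trace q 0 w t + (- e%:C) ^+ n * neumann_trace n e w t.
Proof.
move=> nw; have E : Hm e t - w%:M = (Hm 0 t - w%:M) + e%:C *: B.
  have -> : Hm 0 t = - (t%:C *: Dm) by rewrite /pencil scale0r sub0r.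
  by rewrite [RHS]addrC addrA.
have u0 := Hm_unit x hB 0 t nw; have ue := Hm_unit x hB e t nw.
have ue' : (Hm 0 t - w%:M) + e%:C *: B \in unitmx by rewrite -E.
rewrite /res_trace E (neumann n u0 ue') mulmxDl linearD /= mulmx_suml raddf_sum /=.
congr (_ + _); last by rewrite -scalemxAl mxtraceZ -E.
by apply: eq_bigr => q _; rewrite -scalemxAl mxtraceZ.
Qed.

Lemma evn_sum n (a : 'I_n -> C) (F : 'I_n -> R -> C) t :
  evn (fun s => \sum_q a q * F q s) t = \sum_q a q * evn (F q) t.
Proof.
rewrite /evn -sumrB !mulr_sumr; apply: eq_bigr => q _.
by rewrite -mulrBr; ring.
Qed.

Lemma evnD (f g : R -> C) t : evn (fun s => f s + g s) t = evn f t + evn g t.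
Proof.
rewrite /evn; move: (f t) (f (- t)) (g t) (g (- t)) => a b a' b'.
by rewrite opprD addrACA !mulrDr.
Qed.

Lemma evnZ c (f : R -> C) t : evn (fun s => c * f s) t = c * evn f t.
Proof. rewrite /evn; move: (f t) (f (- t)) => a b; by ring. Qed.

Lemma evn_combine (f0 f1 f2 f3 : R -> C) c r t :
  evn (fun s => f0 s + (c * f1 s + (f2 s + r * f3 s))) t =
  evn f0 t + (c * evn f1 t + (evn f2 t + r * evn f3 t)).
Proof. by rewrite evnD (evnD (fun s => c * f1 s)) (evnD f2) !evnZ. Qed.

Lemma eq_evn (f g : R -> C) t : f =1 g -> evn f t = evn g t.
Proof. by rewrite /evn => E; rewrite !E. Qed.

Lemma Tm_expand e w t : nonreal w ->
  Tm e w t = Tm 0 w t + (- e%:C * evn (neumann_trace 1 0 w) t +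
    (\sum_(q < l.+1) (- e%:C) ^+ q.+2 * evn (neumann_trace q.+2 0 w) t +
    (- e%:C) ^+ l.+3 * evn (neumann_trace l.+3 e w) t)).
Proof.
move=> nw.
have E s : tau e w s = tau 0 w s + (- e%:C * neumann_trace 1 0 w s +
    (\sum_(q < l.+1) (- e%:C) ^+ q.+2 * neumann_trace q.+2 0 w s + (- e%:C) ^+ l.+3 * neumann_trace l.+3 e w s)).
  have E0 : tau 0 w s = neumann_trace 0 0 w s.
    by rewrite /neumann_trace expr0 mulmx1.
  rewrite E0 (tau_expand e s l.+3 nw) 2!big_ord_recl -!addrA expr0 mul1r.
  by [].
transitivity (d%:R + evn (tau e w) t); first by [].
rewrite (eq_evn t E).
set f0 := tau 0 w; set f1 := neumann_trace 1 0 w; set f2 := neumann_trace l.+3 e w.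
set fs := fun s : R => \sum_(q < l.+1) (- e%:C) ^+ q.+2 * neumann_trace q.+2 0 w s.
have -> : evn (fun s => f0 s + (- e%:C * f1 s + (fs s + (- e%:C) ^+ l.+3 * f2 s))) t =
  evn f0 t + (- e%:C * evn f1 t + (evn fs t + (- e%:C) ^+ l.+3 * evn f2 t)).
  exact: evn_combine.
have -> : evn fs t = \sum_(q < l.+1) (- e%:C) ^+ q.+2 * evn (neumann_trace q.+2 0 w) t by exact: evn_sum.
exact: addrA.
Qed.

Local Notation w1 b := (Complex b (1 : R)).

Definition klam : R := d%:R ^+ 5 + (d%:R + d%:R ^+ 5 * (mnorm B + d%:R)) * mnorm Xm.

Lemma klam_ge0 : 0 <= klam.
Proof.
by rewrite addr_ge0 ?exprn_ge0 ?mulr_ge0 ?addr_ge0 ?mnorm_ge0// mulr_ge0 ?exprn_ge0 ?addr_ge0 ?mnorm_ge0.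
Qed.

Lemma nonreal_w1 (b : R) : nonreal (w1 b).
Proof. by apply: nonreal_pos; exact: ltr01. Qed.

Lemma resolvent_le1 e b t : mnorm (invmx (Hm e t - (w1 b)%:M)) <= d%:R ^+ 5.
Proof.
have [_] := resolvent_le (Hm_ctr x hB e t) (nonreal_w1 b).
by rewrite /= normr1 divr1.
Qed.

(** The resolvent decays in t because the pencil is dominated by its t-part. *)
Lemma resolvent_decay e b t : 0 <= e <= 1 ->
  (1 + `|t|) * mnorm (invmx (Hm e t - (w1 b)%:M)) <= klam * (1 + `|b|).
Proof.
move=> he; have u := Hm_unit x hB e t (nonreal_w1 b).
set G := invmx _; have G5 : mnorm G <= d%:R ^+ 5 := resolvent_le1 e b t.
have tG : t%:C *: G = (G *m (e%:C *: B - (w1 b)%:M) - 1%:M) *m Xm.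
  have h : G *m (Hm e t - (w1 b)%:M) = 1%:M by rewrite mulVmx.
  have ab (a b' c : 'M[C]_d) : a - c - (a - b' - c) = b'.
    by rewrite (addrAC a (- b')) opprB [LHS]addrC subrK.
  rewrite -h -mulmxBr /pencil ab.
  by rewrite -scalemxAr -scalemxAl -mulmxA DmXm// mulmx1.
have d5 : 0 <= d%:R ^+ 5 :> R by exact: exprn_ge0.
have c1 : 1 <= 1 + `|b| by rewrite lerDl.
have n1 : 0 <= (1:R) <= 1 by rewrite ler01 lexx.
have tGle : `|t| * mnorm G <= (d%:R + d%:R ^+ 5 * (mnorm B + d%:R)) * (1 + `|b|) * mnorm Xm.
  rewrite -(cm_real t) -mnormZ tG; apply: (le_trans (mnormM _ _)).
  apply: ler_wpM2r; first exact: mnorm_ge0.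
  apply: (le_trans (mnormD _ _)).
  rewrite mnormN mnorm_scalar cm1 mulr1 addrC mulrDl; apply: lerD.
    by rewrite ler_peMr.
  apply: (le_trans (mnormM _ _)); rewrite -mulrA.
  apply: ler_pM; [exact: mnorm_ge0|exact: mnorm_ge0|exact: G5|].
  exact: shift_norm.
rewrite mulrDl mul1r /klam [leRHS]mulrDl; apply: lerD.
  by apply: (le_trans G5); rewrite ler_peMr.
by rewrite mulrAC.
Qed.

Lemma mnorm_mulX (G M : 'M[C]_d) k : mnorm (G *m M ^+ k) <= mnorm G * mnorm M ^+ k.
Proof.
elim: k => [|k IH]; first by rewrite !expr0 mulmx1 mulr1.
have -> : G *m M ^+ k.+1 = G *m M ^+ k *m M by rewrite exprSr mulmxA.
apply: (le_trans (mnormM _ _)); rewrite exprSr [leRHS]mulrA.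
by apply: ler_wpM2r IH; exact: mnorm_ge0.
Qed.

Lemma decay_product (s g v c kk k5 mB mD y : R) n :
  0 <= s -> 0 <= g -> 0 <= v -> 0 <= c -> 0 <= kk -> 0 <= mB -> 0 <= mD ->
  s * g <= kk * c -> s * v <= kk * c -> v <= k5 ->
  y <= g * (mB * v) ^+ n.+2 * mD ->
  s ^+ 3 * y <= kk ^+ 3 * (mB ^+ n.+2 * k5 ^+ n * mD) * c ^+ 3.
Proof.
move=> s0 g0 v0 c0 k0 mB0 mD0 hg hv h5 hy.
apply: (@le_trans _ _ ((s * g) * ((s * v) * (s * v)) * (mB ^+ n.+2 * v ^+ n * mD))).
  rewrite (_ : _ * (_ * v ^+ n * _) = s ^+ 3 * (g * (mB * v) ^+ n.+2 * mD)).
    by apply: ler_wpM2l hy; exact: exprn_ge0.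
  rewrite exprMn (exprSr v) (exprSr v n); move: (mB ^+ _) (v ^+ n) => q1 q2; ring.
have kc0 : 0 <= kk * c by exact: mulr_ge0.
rewrite (_ : kk ^+ 3 * _ * c ^+ 3 = (kk * c * (kk * c * (kk * c))) *
   (mB ^+ n.+2 * k5 ^+ n * mD)); last first.
  by move: (mB ^+ _) (k5 ^+ n) => q1 q2; ring.
have svv : s * v * (s * v) <= kk * c * (kk * c) by apply: ler_pM => //; exact: mulr_ge0.
apply: ler_pM.
- exact: mulr_ge0 (mulr_ge0 s0 g0) (mulr_ge0 (mulr_ge0 s0 v0) (mulr_ge0 s0 v0)).
- exact: mulr_ge0 (mulr_ge0 (exprn_ge0 _ mB0) (exprn_ge0 _ v0)) mD0.
- by apply: ler_pM => //; [exact: mulr_ge0|exact: mulr_ge0 (mulr_ge0 s0 v0) (mulr_ge0 s0 v0)].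
apply: ler_wpM2r => //; apply: ler_wpM2l; first exact: exprn_ge0.
by rewrite lerXn2r// nnegrE// (le_trans v0).
Qed.

Lemma rt_decay n (e b t : R) : 0 <= e <= 1 ->
  (1 + `|t|) ^+ 3 * cm (neumann_trace n.+2 e (w1 b) t) <=
  klam ^+ 3 * (mnorm B ^+ n.+2 * (d%:R ^+ 5) ^+ n * mnorm Dm) * (1 + `|b|) ^+ 3.
Proof.
move=> he; have he0 : 0 <= (0:R) <= 1 by rewrite lexx ler01.
apply: (decay_product _ _ _ _ _ _ _ (resolvent_decay b t he) (resolvent_decay b t he0)
  (resolvent_le1 0 b t)); rewrite ?klam_ge0 ?mnorm_ge0 ?addr_ge0//.
apply: (le_trans (mnorm_tr _)); apply: (le_trans (mnormM _ _)).
apply: ler_wpM2r; first exact: mnorm_ge0.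
apply: (le_trans (mnorm_mulX _ _ _)); apply: ler_wpM2l; first exact: mnorm_ge0.
by apply: lerXn2r; rewrite ?nnegrE ?mulr_ge0 ?mnorm_ge0//; exact: mnormM.
Qed.

Lemma evn_decay (K : R) (f : R -> C) t : (forall t, (1 + `|t|) ^+ 3 * cm (f t) <= K) ->
  (1 + t ^+ 2) * cm (evn f t) <= K.
Proof.
move=> hf; rewrite /evn !cmM cm_real.
have h2 : cm (2^-1 : C) = 2^-1.
  have -> : (2^-1 : C) = (2^-1 : R)%:C by rewrite fmorphV rmorph_nat.
  by rewrite cm_real ger0_norm.
have h3 : (1 + t ^+ 2) * `|t| <= (1 + `|t|) ^+ 3.
  rewrite -[t ^+ 2]real_normK ?num_real//; move: (normr_ge0 t); move: `|t| => u u0.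
  rewrite -subr_ge0 (_ : _ - _ = 1 + 2 * u + 3 * u ^+ 2); last by ring.
  by rewrite !addr_ge0// mulr_ge0// sqr_ge0.
have a := hf t; have a' := hf (- t); rewrite normrN in a'.
have h4 : cm (f t - f (- t)) <= cm (f t) + cm (f (- t)) by rewrite -(cmN (f (- t))) cmD.
rewrite h2; apply: (@le_trans _ _ (2^-1 * ((1 + `|t|) ^+ 3 * (cm (f t) + cm (f (- t)))))).
  rewrite mulrCA ler_wpM2l// mulrA; apply: ler_pM => //; last exact: cm_ge0.
  by apply: mulr_ge0 => //; apply: addr_ge0 => //; exact: sqr_ge0.
rewrite mulrDr; move: a a'; lra.
Qed.

Lemma rt_meas n e s : cmeas (fun p : R * R => neumann_trace n e (w1 p.1) (s * p.2)).
Proof.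
have h e' := @resolvent_meas R d x B hB e' 1 s (oner_neq0 _).
apply: mmeas_tr; apply: mmeasM; last exact: mmeas_cst.
apply: mmeasM; first exact: h.
by apply: mmeasX; apply: mmeasM; [exact: mmeas_cst|exact: h].
Qed.

Lemma rt_tame n : exists K, forall e, 0 <= e <= 1 ->
  tame_by K (fun p : R * R => evn (neumann_trace n.+2 e (w1 p.1)) p.2).
Proof.
exists (klam ^+ 3 * (mnorm B ^+ n.+2 * (d%:R ^+ 5) ^+ n * mnorm Dm)) => e he; split.
  have h s : cmeas (fun p : R * R => neumann_trace n.+2 e (w1 p.1) (s * p.2)) by exact: rt_meas.
  rewrite /evn; apply: cmeasM; first exact: cmeas_cst.
  apply: cmeasM; first exact: snd_cmeas.
  apply: cmeasB.
    by apply: (cmeas_ext _ (h 1)) => p; rewrite mul1r.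
  by apply: (cmeas_ext _ (h (- 1))) => p; rewrite mulN1r.
by move=> b t; apply: evn_decay => s; exact: rt_decay.
Qed.

End expansion.

Section compact_decay.
Variable R : realType.

Lemma supported_decay (rho K c y : R) : 0 <= K -> y <= K -> (rho < `|c| -> y = 0) ->
  y <= K * (1 + rho ^+ 2) * hw c.
Proof.
move=> K0 yK y0; have q0 : 0 < 1 + c ^+ 2 by rewrite ltr_wpDr ?sqr_ge0.
rewrite /hw ler_pdivlMr//; have [cr|rc] := leP `|c| rho.
  have h : c ^+ 2 <= rho ^+ 2.
    by rewrite -[c ^+ 2]real_normK ?num_real// lerXn2r ?nnegrE// (le_trans _ cr).
  apply: (@le_trans _ _ (K * (1 + c ^+ 2))); first by rewrite ler_wpM2r ?(ltW q0).
  by rewrite ler_wpM2l// lerD2l.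
by rewrite y0// mul0r mulr_ge0// addr_ge0 ?sqr_ge0.
Qed.

Lemma herm_definite_far d (H : 'M[R[i]]_d) : ctr H = H -> exists2 rho : R, 0 <= rho &
  forall a : R, rho < `|a| -> forall v, v != 0 -> qform (H - a%:C%:M) v != 0.
Proof.
move=> /hermP /herm_spectral[P [al [uP cP HE]]].
exists (\sum_i `|al i|); first exact: sumr_ge0.
move=> a ha; apply: (shift_definite uP cP HE).
have hi i : `|al i| < `|a|.
  apply: le_lt_trans ha; rewrite (bigD1 i)//= lerDl; exact: sumr_ge0.
have [a0|a0] := lerP 0 a; [left|right] => i; have := hi i.
  by rewrite (ger0_norm a0); exact/le_lt_trans/ler_norm.
rewrite (ltr0_norm a0) => h; rewrite -ltrN2; apply: le_lt_trans h.
by rewrite -normrN ler_norm.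
Qed.

Lemma cint_re (g : R[i]) (f : R -> R[i]) : cDom f ->
  cint (fun t => g * (complex.Re (f t))%:C) = g * (complex.Re (cint f))%:C.
Proof.
move=> Df; have Dre : cDom (fun t => (complex.Re (f t))%:C).
  apply: (@cDom_ext R (fun t => 2^-1 * (f t + (f t)^*%C))); first by move=> t; rewrite re_half.
  by apply: cDomZ; apply: cDomD => //; exact: cDom_conj.
rewrite cintZ//; congr (_ * _); apply: complex_ext => //=.
by rewrite /Rintegral integral0_eq.
Qed.

Lemma ccvg0_bounded (y : nat -> R[i]) (K : R) : (forall n, cm (y n) <= K) ->
  ccvg \oo (fun n => (epsn R n)%:C * y n) 0.
Proof.
move=> yK.
have K0 : 0 <= K by exact: le_trans (cm_ge0 _) (yK 0%N).
have h : epsn R n * K @[n --> \oo] --> (0:R).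
  by rewrite -[X in _ --> X](mul0r K); apply: cvgMl; exact: epsn_cvg.
have hN : - (epsn R n * K) @[n --> \oo] --> (0:R).
  by rewrite -[X in _ --> X]oppr0; exact: cvgN.
have b n : cm ((epsn R n)%:C * y n) <= epsn R n * K.
  by rewrite cmM cm_real ger0_norm ?(ltW (epsn_gt0 _ _))// ler_wpM2l ?(ltW (epsn_gt0 _ _)).
split; apply: (squeeze_cvgr _ hN h); apply: nearW => n; rewrite -ler_norml;
  apply: le_trans (b n); [exact: re_le_cm|exact: im_le_cm].
Qed.

End compact_decay.

Section coefficient.
Variables (R : realType) (d : nat) (x : 'I_d -> R).
Hypothesis x0 : forall i, x i != 0.
Variable B : 'M[R[i]]_d.
Hypothesis hB : ctr B = B.
Variable l : nat.
Local Notation C := R[i].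
Local Notation re := (@complex.Re R).
Local Notation im := (@complex.Im R).
Local Notation mu := (@lebesgue_measure R).
Local Notation Tm := (even_trace x B).
Local Notation Ym := (pencil_product x B).
Local Notation rt := (neumann_trace x B).
Local Notation gf := (@test_fun R l).
Local Notation w1 b := (Complex b (1 : R)).
Local Notation Jf := (@double_int R l).

Lemma Tm_tame e : 0 <= e <= 1 -> tame (fun p : R * R => Tm e (w1 p.1) p.2).
Proof.
move=> he; have [K K0 hK] := Tm_bound x0 hB (ltr01 : 0 < (1 : R)) (lexx 1).
exists K; split; last by move=> b t; exact: hK.
by apply: Tm_meas; last exact: oner_neq0.
Qed.

Lemma Jf_Tm e : 0 <= e <= 1 -> Jf (fun p => Tm e (w1 p.1) p.2) =
  cint (fun b => gf b%:C * (pi * eigIm (Ym e b%:C))%:C).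
Proof.
move=> he; rewrite (strip_limit x0 hB l he) /double_int; apply: eq_cint => b.
have [DT iT] := Tm_int x0 hB e (ltr01 : 0 < im (w1 b)).
by rewrite -iT -cint_re.
Qed.

Definition moment_b : C := cint (fun b => b%:C ^+ l * (eigIm (Ym 1 b%:C))%:C).

Lemma eigIm_Ym_real_le : exists K rho : R, [/\ 0 <= K, 0 <= rho,
  forall c, eigIm (Ym 1 c%:C) <= K & forall c : R, rho < `|c| -> eigIm (Ym 1 c%:C) = 0].
Proof.
have [rho r0 hr] := herm_definite_far hB.
have h1 : 0 <= (1:R) <= 1 by rewrite ler01 lexx.
have h0 : 0 <= (0:R) <= 1 by rewrite ler01 lexx.
pose K0 := d%:R * (mnorm (diag_x x) * (mnorm B + d%:R)).
have K00 : 0 <= K0 by rewrite mulr_ge0// mulr_ge0 ?addr_ge0 ?mnorm_ge0.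
have E0 c : rho < `|c| -> eigIm (Ym 1 c%:C) = 0.
  move=> hc; rewrite /pencil_product scale1r; apply: eigIm_definite_r (hr c hc).
    exact: (ctr_diag x).
  exact: shift_herm.
exists (K0 * (1 + rho) ^+ 3), rho; split => //.
  by rewrite mulr_ge0// exprn_ge0// addr_ge0.
move=> c; have [cr|rc] := leP `|c| rho; last first.
  by rewrite E0// mulr_ge0// exprn_ge0// addr_ge0.
apply: (le_trans (eigIm_Ym_le x B c h1 h0)); rewrite -/K0 ler_wpM2l//.
by rewrite lerXn2r ?nnegrE ?addr_ge0// lerD2l.
Qed.

Lemma eigIm_Ym_real_continuous e : continuous (fun b : R => eigIm (Ym e b%:C)).
Proof. exact: (@eigIm_Ym_continuous R d x B e 0). Qed.

Lemma Ym_rescale (e c : R) : Ym e (e * c)%:C = e%:C *: Ym 1 c%:C.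
Proof.
rewrite /pencil_product scale1r scalemxAr scalerBr; congr (_ *m (_ - _)).
by rewrite scale_scalar_mx rmorphM.
Qed.

Definition scaled_integrand (e c : R) : C :=
  c%:C ^+ l * (e%:C * c%:C - Complex 0 2)^-1 ^+ (l + 5) * (pi * eigIm (Ym 1 c%:C))%:C.

Lemma gf_real_cont : ccont (fun b : R => gf b%:C).
Proof.
have n2 : nonreal (Complex 0 (2 : R)) by apply: nonreal_pos => /=; exact: ltr0n.
have c1 : cder (fun b : R => (b%:C - Complex 0 2)^-1) _ := line_inv_cder n2.
have cX (f : R -> C) n : (exists f', cder f f') -> exists f', cder (fun t => f t ^+ n) f'.
  move=> [f' hf]; elim: n => [|n [g hg]].
    by exists (fun=> 0); apply: (cder_ext _ _ (cder_cst 1)) => t //; rewrite expr0.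
  by eexists; apply: (cder_ext _ _ (cderM hf hg)) => t; [rewrite exprS|reflexivity].
have [f1 h1] := cX _ l (ex_intro _ _ (@cder_id R)).
have [f2 h2] := cX _ (l + 5)%N (ex_intro _ _ c1).
exact: cder_cont (cderM h1 h2).
Qed.

Lemma scaled_bound : exists K : R, forall e, cmeas (scaled_integrand e) /\
  forall c, cm (scaled_integrand e c) <= K * hw c.
Proof.
have [K [rho [K0 r0 hK h0]]] := eigIm_Ym_real_le.
have n2 : nonreal (Complex 0 (2 : R)) by apply: nonreal_pos => /=; exact: ltr0n.
exists (rho ^+ l * (pi * K) * (1 + rho ^+ 2)) => e; split.
  have mc : cmeas (fun c : R => c%:C) by apply: cmeas_real; exact: measurable_id.
  apply: cmeasM; last first.
    apply: cmeas_real; apply: measurable_funM => //.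
    by apply: continuous_measurable_fun; exact: eigIm_Ym_real_continuous.
  apply: cmeasM; first exact: cmeasX.
  apply: cmeasX; apply: cmeasV; apply: cmeasB; last exact: cmeas_cst.
  by apply: cmeasM => //; exact: cmeas_cst.
move=> c; have pK0 : 0 <= pi * K by rewrite mulr_ge0 ?pi_ge0.
have inv1 : cm (e%:C * c%:C - Complex 0 2)^-1 <= 1.
  rewrite -rmorphM; apply: (le_trans (line_inv_le _ n2)).
  rewrite /= ger0_norm ?ler0n//; lra.
have hpE : 0 <= pi * eigIm (Ym 1 c%:C) by rewrite mulr_ge0 ?pi_ge0 ?eigIm_ge0.
have cmE : cm (scaled_integrand e c) <= `|c| ^+ l * (pi * eigIm (Ym 1 c%:C)).
  rewrite /scaled_integrand !cmM !cmX !cm_real (ger0_norm hpE).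
  rewrite ler_wpM2r// -[leRHS]mulr1 ler_wpM2l ?exprn_ge0//.
  by rewrite exprn_ile1 ?cm_ge0.
apply: supported_decay.
- by rewrite mulr_ge0// exprn_ge0.
- have [cr|rc] := leP `|c| rho.
    apply: (le_trans cmE); apply: ler_pM.
    - exact: exprn_ge0.
    - exact: hpE.
    - by rewrite lerXn2r ?nnegrE.
    - by apply: ler_wpM2l; [exact: pi_ge0|exact: hK].
  apply: (le_trans cmE); rewrite h0// !mulr0 mulr_ge0// exprn_ge0//.
- by move=> rc; rewrite /scaled_integrand h0// mulr0 mulr0 cm0.
Qed.

Lemma scaled_Dom e : cDom (scaled_integrand e).
Proof. by have [K hK] := scaled_bound; have [m b] := hK e; split => //; exists K. Qed.

Lemma mulr_exchange (a b p e : C) : a * b * (p * e) = b * p * (a * e).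
Proof. by ring. Qed.

Lemma scaled_limit : ccvg \oo (fun n => cint (scaled_integrand (epsn R n)))
  ((- Complex 0 2)^-1 ^+ (l + 5) * pi%:C * moment_b).
Proof.
have [K hK] := scaled_bound.
have lim c : ccvg \oo (fun n => scaled_integrand (epsn R n) c) (scaled_integrand 0 c).
  apply: ccvgM; last exact: ccvg_cst.
  apply: ccvgM; first exact: ccvg_cst.
  apply: ccvgX; apply: ccvgV.
    rewrite -rmorphM; apply: line_neq0; apply: nonreal_pos => /=; exact: ltr0n.
  apply: ccvgD; last exact: ccvg_cst.
  by apply: ccvgM; [apply: ccvg_real; exact: epsn_cvg|exact: ccvg_cst].
have [c1 c2] := @cint_cvg R _ (scaled_integrand 0) K (fun n => (hK (epsn R n)).1)
  (fun n => (hK (epsn R n)).2) (fun c => (lim c).1) (fun c => (lim c).2).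
suff <- : cint (scaled_integrand 0) = (- Complex 0 2)^-1 ^+ (l + 5) * pi%:C * moment_b by split.
have E c : scaled_integrand 0 c =
  (- Complex 0 2)^-1 ^+ (l + 5) * pi%:C * (c%:C ^+ l * (eigIm (Ym 1 c%:C))%:C).
  rewrite /scaled_integrand mul0r sub0r [(pi * _)%:C]rmorphM.
  exact: mulr_exchange.
rewrite (eq_cint E) cintZ//.
have k0 : (- Complex 0 2)^-1 ^+ (l + 5) * pi%:C != 0 :> C.
  rewrite mulf_neq0//.
    rewrite expf_neq0// invr_eq0 oppr_eq0; apply/negP => /eqP/(congr1 im)/= /eqP.
    by rewrite pnatr_eq0.
  by rewrite (inj_eq (@complexI R) _ 0) lt0r_neq0// pi_gt0.
apply: (@cDom_ext R (fun c => ((- Complex 0 2)^-1 ^+ (l + 5) * pi%:C)^-1 * scaled_integrand 0 c)).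
  by move=> c; rewrite E mulKf.
by apply: cDomZ; exact: scaled_Dom.
Qed.

Lemma lhs_rescale (e : R) : 0 < e -> e <= 1 ->
  cint (fun b => gf b%:C * (pi * eigIm (Ym e b%:C))%:C) =
  e%:C ^+ l.+2 * cint (scaled_integrand e).
Proof.
move=> e0 e1.
have [K [rho [K0 r0 hK h0]]] := eigIm_Ym_real_le.
have he : e != 0 by exact: lt0r_neq0.
have cE : continuous (fun b : R => eigIm (Ym e b%:C)) by exact: eigIm_Ym_real_continuous.
have [g1 g2] := gf_real_cont.
have cf : ccont (fun b => gf b%:C * (pi * eigIm (Ym e b%:C))%:C).
  have cpe : continuous (fun b : R => pi * eigIm (Ym e b%:C) : R).
    by move=> b; apply: cvgM; [exact: cvg_cst|exact: cE].
  split=> b; [under eq_fun do rewrite reM /= mulr0 subr0|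
              under eq_fun do rewrite imM /= mulr0 add0r].
    by apply: cvgM; [exact: g1|exact: cpe].
  by apply: cvgM; [exact: g2|exact: cpe].
have Df : cDom (fun b => gf b%:C * (pi * eigIm (Ym e b%:C))%:C).
  split; first exact: ccont_meas.
  by eexists => b; apply: (@gf_eigIm_bound R d x B l e b 0); rewrite ?(ltW e0) ?lexx ?ler01.
transitivity (e%:C * cint (fun c => e%:C ^+ l.+1 * scaled_integrand e c)).
  transitivity (e%:C * cint (fun c => gf (e * c)%:C * (pi * eigIm (Ym e (e * c)%:C))%:C)).
    exact: cint_scale.
  congr (_ * _); apply: eq_cint => c; rewrite Ym_rescale eigIm_scale// gtr0_norm//.
  rewrite /test_fun /scaled_integrand; move: (eigIm _) => E.
  have -> : (e * c)%:C = e%:C * c%:C :> C by rewrite rmorphM.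
  have -> : (pi * (e * E))%:C = e%:C * (pi * E)%:C :> C by rewrite mulrCA rmorphM.
  rewrite exprMn exprS; move: (_ ^-1 ^+ _) (_ ^+ l) (_ ^+ l) (pi * E)%:C => a1 a2 a3 a4.
  by ring.
rewrite cintZ; first by rewrite mulrA -exprS.
exact: scaled_Dom.
Qed.

Local Notation E0 n := (fun p : R * R => evn (rt n 0 (w1 p.1)) p.2).

Lemma rt2_tame n e : 0 <= e <= 1 -> tame (fun p : R * R => evn (rt n.+2 e (w1 p.1)) p.2).
Proof. by move=> he; have [K hK] := rt_tame x0 hB n; exists K; exact: hK. Qed.

Lemma unit01 : (0 <= (0:R) <= 1) * (0 <= (1:R) <= 1).
Proof. by rewrite lexx ler01 lexx. Qed.

Lemma sum_rt_tame e (a : nat -> C) : 0 <= e <= 1 ->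
  tame (fun p : R * R => \sum_(q < l.+1) a q * evn (rt q.+2 e (w1 p.1)) p.2).
Proof.
move=> he; apply: tame_sum => q; apply: tameZ; exact: (rt2_tame q he).
Qed.

Lemma sign_scalar (e : R) n : (- e%:C) ^+ n = ((- e) ^+ n)%:C :> C.
Proof. by rewrite rmorphXn rmorphN. Qed.

Lemma Tm_expand_point (e : R) (p : R * R) :
  Tm e (w1 p.1) p.2 = Tm 0 (w1 p.1) p.2 + ((- e)%:C * evn (rt 1 0 (w1 p.1)) p.2 +
   (\sum_(q < l.+1) ((- e) ^+ q.+2)%:C * evn (rt q.+2 0 (w1 p.1)) p.2 +
    ((- e) ^+ l.+3)%:C * evn (rt l.+3 e (w1 p.1)) p.2)).
Proof.
rewrite (Tm_expand x hB l e p.2 (nonreal_w1 p.1)) sign_scalar.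
have -> : - e%:C = (- e)%:C :> C by rewrite rmorphN.
congr (_ + (_ + (_ + _))); apply: eq_bigr => q _; congr (_ * _).
by rewrite rmorphXn.
Qed.

(** The term of order one does not decay fast enough by itself, but all the other terms do. *)
Lemma rt1_tame : tame (E0 1).
Proof.
have [u0 u1] := unit01.
have T1 := Tm_tame u1; have T0 := Tm_tame u0.
have TS := sum_rt_tame (fun q => ((- 1) ^+ q.+2)%:C) u0.
have TR := tameZ ((- 1) ^+ l.+3)%:C (rt2_tame l.+1 u1).
apply: tame_ext (tameD T0 (tameD TS (tameD TR (tameZ (-1) T1)))) => p.
rewrite (Tm_expand_point 1).
have -> : (-1)%:C = -1 :> C by rewrite rmorphN.
have h (a b c e : C) : a + (b + (c + -1 * (a + (-1 * e + (b + c))))) = e by ring.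
exact: h.
Qed.

Definition coef (q : nat) : C :=
  match q with
  | 0 => Jf (fun p : R * R => Tm 0 (w1 p.1) p.2)
  | q'.+1 => (-1) ^+ q * Jf (E0 q)
  end.

Lemma Jf_expand (e : R) : 0 <= e <= 1 -> Jf (fun p : R * R => Tm e (w1 p.1) p.2) =
  \sum_(q < l.+3) coef q * e%:C ^+ q +
  e%:C ^+ l.+3 * ((-1) ^+ l.+3 * Jf (fun p : R * R => evn (rt l.+3 e (w1 p.1)) p.2)).
Proof.
move=> he; have [u0 u1] := unit01.
have T0 := Tm_tame u0;
have TS := sum_rt_tame (fun q => ((- e) ^+ q.+2)%:C) u0.
apply: etrans (Jf_ext l (Tm_expand_point e)) _.
have -> := Jf_combine l (- e) ((- e) ^+ l.+3) T0 rt1_tame TS (rt2_tame l.+1 he).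
have -> := Jf_sumZ l (fun q : 'I_l.+1 => (- e) ^+ q.+2) (fun q : 'I_l.+1 => rt2_tame q u0).
rewrite 2![in RHS]big_ord_recl expr0 mulr1 -!addrA; congr (_ + (_ + (_ + _))).
- have h (a b : C) : - b * a = (-1) ^+ 1 * a * b ^+ 1 by rewrite !expr1; ring.
  have -> : (- e)%:C = - e%:C :> C by rewrite rmorphN.
  exact: h.
- apply: eq_bigr => q _; rewrite -sign_scalar (exprNn e%:C).
  have h (a b c : C) : a * b * c = a * c * b by ring.
  exact: h.
- rewrite -sign_scalar (exprNn e%:C).
  have h (a b c : C) : a * b * c = b * (a * c) by ring.
  exact: h.
Qed.

Lemma rearrange (S c j j2 e : C) : S + (-1) ^+ l.+2 * j2 * e ^+ l.+2 +
    e ^+ l.+3 * ((-1) ^+ l.+3 * j) = e ^+ l.+2 * c ->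
  S + e ^+ l.+2 * ((-1) ^+ l * j2 + e * ((-1) ^+ l.+3 * j) - c) = 0.
Proof.
move=> h; rewrite mulrBr -h !exprS; move: (_ ^+ l) (_ ^+ l) => u v.
by ring.
Qed.

Lemma moment_coef : (-1) ^+ l * Jf (E0 l.+2) = (- Complex 0 2)^-1 ^+ (l + 5) * pi%:C * moment_b.
Proof.
apply/eqP; rewrite -subr_eq0; apply/eqP.
pose J3 n := Jf (fun p : R * R => evn (rt l.+3 (epsn R n) (w1 p.1)) p.2).
apply: (@expansion_unique R l.+2 coef (fun n =>
  (-1) ^+ l * Jf (E0 l.+2) + (epsn R n)%:C * ((-1) ^+ l.+3 * J3 n)
  - cint (scaled_integrand (epsn R n)))).
  move=> n; have e0 := epsn_gt0 R n; have e1 := epsn_le1 R n.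
  have he : 0 <= epsn R n <= 1 by rewrite (ltW e0).
  have h1 := etrans (esym (Jf_expand he)) (etrans (Jf_Tm he) (lhs_rescale e0 e1)).
  rewrite big_ord_recr /= in h1.
  exact: (rearrange h1).
apply: ccvgD; last by apply: ccvgN; exact: scaled_limit.
rewrite -[X in ccvg _ _ X]addr0; apply: ccvgD; first exact: ccvg_cst.
have [K hK] := rt_tame x0 hB l.+1.
apply: (@ccvg0_bounded R _ (K * 2 ^+ (l + 5) * (2 * \int[mu]_x hw x) * (2 * \int[mu]_x hw x))) => n.
rewrite cmM cmX cmN cm1 expr1n mul1r; apply: Jf_bound; apply: hK.
by rewrite epsn_le1 (ltW (epsn_gt0 _ _)).
Qed.

End coefficient.

Section words.
Variables (K : comPzRingType) (d : nat) (B : 'M[K]_d).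

Fixpoint walk (a : 'I_d) (s : seq 'I_d) (b : 'I_d) : K :=
  if s is c :: s' then B a c * walk c s' b else B a b.
Definition cyc (s : seq 'I_d) : K := if s is a :: s' then walk a s' a else 0.
Definition wprod (fs : seq ('I_d -> K)) (p : seq 'I_d) : K :=
  \prod_(u <- zip fs p) u.1 u.2.
Definition fdiag (f : 'I_d -> K) : 'M[K]_d := diag_mx (\row_i f i).

Lemma walk_rcons a s c b : walk a (rcons s c) b = walk a s c * B c b.
Proof. by elim: s a => [|e s IH] a //=; rewrite IH mulrA. Qed.

Lemma cyc_rot k s : cyc (rot k s) = cyc s.
Proof.
have h1 t : cyc (rot 1 t) = cyc t.
  case: t => [|a [|c t]] //; rewrite rot1_cons /=.
  by rewrite walk_rcons mulrC.
have [ks|ks] := ltnP k (size s); last by rewrite rot_oversize.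
elim: k ks => [|k IH] ks; first by rewrite rot0.
by rewrite -add1n rotD ?h1 ?IH// ltnW.
Qed.

Lemma sum_tuple_cons (V : nmodType) (T : finType) n (F : seq T -> V) :
  \sum_(p : n.+1.-tuple T) F p = \sum_a \sum_(p : n.-tuple T) F (a :: p).
Proof.
rewrite pair_big /=.
rewrite (reindex (fun u : T * n.-tuple T => cons_tuple u.1 u.2)) //=.
exists (fun p : n.+1.-tuple T => (thead p, behead_tuple p)) => [[a p]|p] _ /=.
  by rewrite theadE; congr (_, _); apply: val_inj.
by rewrite [RHS]tuple_eta; apply: val_inj.
Qed.

Lemma sum_tuple0 (V : nmodType) (T : finType) (F : seq T -> V) : \sum_(p : 0.-tuple T) F p = F [::].
Proof.
rewrite (big_pred1 [tuple]) // => p; apply/esym/eqP.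
by rewrite [p]tuple0.
Qed.

Lemma walk_sum f fs a b : (\prod_(g <- f :: fs) (fdiag g *m B)) a b =
  \sum_(p : (size fs).-tuple 'I_d) f a * (wprod fs p * walk a p b).
Proof.
elim: fs f a => [|g fs IH] f a.
  rewrite big_seq1 /fdiag mul_diag_mx !mxE.
  rewrite (@sum_tuple0 K 'I_d (fun p => f a * (wprod [::] p * walk a p b))).
  by rewrite /wprod /= big_nil mul1r.
rewrite big_cons -mulmxE mxE.
rewrite (@sum_tuple_cons K 'I_d _ (fun p => f a * (wprod (g :: fs) p * walk a p b))).
apply: eq_bigr => c _; rewrite IH mulr_sumr; apply: eq_bigr => p _.
rewrite /fdiag mul_diag_mx !mxE /wprod /= big_cons /=.
by move: (walk _ _ _) (\prod_(u <- _) _) => u v; ring.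
Qed.

Lemma trace_words fs : (0 < size fs)%N -> \tr (\prod_(g <- fs) (fdiag g *m B)) =
  \sum_(p : (size fs).-tuple 'I_d) wprod fs p * cyc p.
Proof.
case: fs => [//|f fs] _.
rewrite (@sum_tuple_cons K 'I_d _ (fun p => wprod (f :: fs) p * cyc p)).
apply: eq_bigr => a _; rewrite walk_sum; apply: eq_bigr => p _.
by rewrite /wprod /= big_cons /= mulrA.
Qed.

End words.

Lemma sum_tuple_rot (K : comPzRingType) (T : finType) n (G : seq T -> K) (u : T -> K) :
  (forall k s, G (rot k s) = G s) ->
  n.+1%:R * \sum_(p : n.+1.-tuple T) G p * u (thead p) =
  \sum_(p : n.+1.-tuple T) G p * \sum_(i <- p) u i.
Proof.
move=> Grot.
have E (k : 'I_n.+1) : \sum_(p : n.+1.-tuple T) G p * u (thead p) =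
    \sum_(p : n.+1.-tuple T) G p * u (tnth p k).
  rewrite (reindex (fun p : n.+1.-tuple T => rot_tuple k p)) /=.
    apply: eq_bigr => p _; rewrite Grot; congr (_ * u _).
    rewrite /thead !(tnth_nth (thead p)) /= /rot nth_cat size_drop size_tuple.
    by rewrite subn_gt0 ltn_ord nth_drop addn0.
  exists (fun p : n.+1.-tuple T => rotr_tuple k p) => p _; apply: val_inj => /=; [exact: rotK|exact: rotrK].
transitivity (\sum_(k < n.+1) \sum_(p : n.+1.-tuple T) G p * u (tnth p k)).
  by rewrite -(eq_bigr _ (fun k _ => E k)) sumr_const card_ord mulr_natl.
rewrite exchange_big; apply: eq_bigr => p _ /=; rewrite -mulr_sumr; congr (_ * _).
by rewrite big_tuple.
Qed.

Section even_part.
Variable R : realType.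
Local Notation C := R[i].

Definition lkfun (s : seq C) (t : R) : C := (\sum_(z <- s) (t%:C - z)^-1) * kfun s t.

Lemma lkfun_opp s t : lkfun s (- t) = - ((-1) ^+ size s * lkfun [seq - z | z <- s] t).
Proof.
have h (z : C) : ((- t)%:C - z)^-1 = - (t%:C - - z)^-1.
  have -> : (- t)%:C = - t%:C :> C by exact: rmorphN.
  by rewrite opprK -invrN opprD.
rewrite /lkfun (eq_bigr (fun z => - (t%:C - - z)^-1)) ?sumrN; last by move=> z _; exact: h.
rewrite !big_map mulNr; congr (- _).
have -> : kfun s (- t) = (-1) ^+ size s * kfun [seq - z | z <- s] t.
  rewrite /kfun big_map; elim: s => [|z s IH]; first by rewrite !big_nil mulr1.
  rewrite !big_cons IH h /= exprS; move: (_^-1) (_ ^+ _) (\prod_(z <- _) _) => a b c.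
  by ring.
by rewrite mulrCA.
Qed.

Lemma evn_lkfun s : all (@nonreal R) s -> (1 < size s)%N ->
  cDom (evn (lkfun s)) /\ cint (evn (lkfun s)) = kap s.
Proof.
move=> ns ss; set s' := [seq - z | z <- s].
have ns' : all (@nonreal R) s'.
  by rewrite all_map; apply: sub_all ns => z /=; rewrite /nonreal imN oppr_eq0.
have ss' : (1 < size s')%N by rewrite size_map.
have [D1 i1] := kap_parts ns ss; have [D2 i2] := kap_parts ns' ss'.
pose sg : C := (-1) ^+ size s.
have E t : 2^-1 * (t%:C * (\sum_(z <- s) (t%:C - z)^-1) * kfun s t +
    sg * (t%:C * (\sum_(z <- s') (t%:C - z)^-1) * kfun s' t)) = evn (lkfun s) t.
  rewrite /evn lkfun_opp -/s' opprK -/sg /lkfun.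
  move: (\sum_(z <- s) _) (\sum_(z <- s') _) (kfun s t) (kfun s' t) => a b c e.
  by move: sg => q; ring.
have DD : cDom (fun t => t%:C * (\sum_(z <- s) (t%:C - z)^-1) * kfun s t +
    sg * (t%:C * (\sum_(z <- s') (t%:C - z)^-1) * kfun s' t)).
  by apply: cDomD => //; exact: cDomZ.
split; first by apply: (cDom_ext E); exact: cDomZ.
transitivity (2^-1 * (kap s + sg * kap s')).
  rewrite -(eq_cint E) cintZ//; congr (_ * _).
  rewrite cintD//; last exact: cDomZ.
  by rewrite cintZ// i1 i2.
have -> : sg * kap s' = kap s.
  by rewrite kap_opp// mulrA -exprMn mulrNN mul1r expr1n mul1r.
by move: (kap s) => k; field.
Qed.

End even_part.

Section diagonal.
Variables (R : realType) (d : nat) (x : 'I_d -> R).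
Hypothesis x0 : forall i, x i != 0.
Variable B : 'M[R[i]]_d.
Hypothesis hB : ctr B = B.
Local Notation C := R[i].
Local Notation re := (@complex.Re R).
Local Notation im := (@complex.Im R).
Local Notation rt := (neumann_trace x B).
Local Notation lam := (free_res x B).

Definition lamf (w : C) (t : R) (j : 'I_d) : C := - (x j)%:C * (t%:C - - (w * (x j)%:C))^-1.

Lemma xC0 j : (x j)%:C != 0 :> C.
Proof. by rewrite (inj_eq (@complexI R) _ 0). Qed.

Lemma node_nonreal w j : nonreal w -> nonreal (- (w * (x j)%:C)).
Proof.
by rewrite /nonreal imN imM /= mulr0 add0r oppr_eq0 => nw; rewrite mulf_neq0.
Qed.

Lemma fdiagM (f g : 'I_d -> C) : fdiag f *m fdiag g = fdiag (fun j => f j * g j).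
Proof. by rewrite /fdiag mulmx_diag; congr diag_mx; apply/rowP => j; rewrite !mxE. Qed.

Lemma lam_diag w t : nonreal w -> lam w t = fdiag (lamf w t).
Proof.
move=> nw; have u := Hm_unit x hB 0 t nw.
suff h : (pencil x B 0 t - w%:M) *m fdiag (lamf w t) = 1%:M by rewrite -[LHS]mulmx1 -h mulKmx.
have -> : pencil x B 0 t - w%:M = fdiag (fun j => - t%:C * (x j)^-1%:C - w).
  rewrite /pencil scale0r sub0r; apply/matrixP => i j; rewrite !mxE.
  case: eqP => [->|_]; first by rewrite !mulr1n mulNr.
  by rewrite !mulr0n mulr0 !oppr0 addr0.
rewrite fdiagM; apply/matrixP => i j; rewrite !mxE; case: eqP => [->|_]; rewrite ?mulr1n ?mulr0n//.
rewrite /lamf; have n0 := line_neq0 t (node_nonreal j nw).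
have -> : (x j)^-1%:C = (x j)%:C^-1 :> C by exact: fmorphV.
have := xC0 j; move: (x j)%:C t%:C n0 => y s n0 y0.
rewrite mulrA; have -> : (- s * y^-1 - w) * - y = s - - (w * y) by field.
exact: divff.
Qed.

Lemma prod_nseq (f g : 'I_d -> C) n :
  \prod_(h <- f :: nseq n g) (fdiag h *m B) = (fdiag f *m B) *m (fdiag g *m B) ^+ n.
Proof.
rewrite big_cons; congr (_ *m _); elim: n => [|n IH]; first by rewrite big_nil expr0.
by rewrite big_cons IH exprS.
Qed.

Lemma rt_trace n w t : nonreal w -> rt n.+1 0 w t =
  \tr (\prod_(h <- (fun j => lamf w t j * (x j)^-1%:C * lamf w t j) :: nseq n (lamf w t))
    (fdiag h *m B)).
Proof.
move=> nw; rewrite /neumann_trace -/(lam w t) lam_diag// prod_nseq.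
set L := fdiag (lamf w t).
have swap k : L *m (B *m L) ^+ k = (L *m B) ^+ k *m L.
  elim: k => [|k IH]; first by rewrite !expr0 mulmx1 mul1mx.
  have -> : L *m (B *m L) ^+ k.+1 = (L *m (B *m L) ^+ k) *m (B *m L) by rewrite exprSr mulmxA.
  by rewrite IH exprSr -!mulmxA.
have -> : fdiag (fun j => lamf w t j * (x j)^-1%:C * lamf w t j) = L *m diag_xinv x *m L.
  by rewrite -fdiagM -fdiagM.
rewrite swap.
have -> : (L *m B) ^+ n.+1 *m L *m diag_xinv x = (L *m B) ^+ n.+1 *m (L *m diag_xinv x) by rewrite mulmxA.
rewrite mxtrace_mulC exprS.
apply: (f_equal (@mxtrace C d)).
by rewrite -mulmxE !mulmxA.
Qed.

Definition cw (p : seq 'I_d) : C := cyc B p * \prod_(i <- p) (x i)%:C.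
Definition xnodes (w : C) (p : seq 'I_d) : seq C := rnodes w (map x p).

Lemma prod_lamf w t (p : seq 'I_d) : \prod_(i <- p) lamf w t i =
  (-1) ^+ size p * ((\prod_(i <- p) (x i)%:C) * \prod_(i <- p) (t%:C - - (w * (x i)%:C))^-1).
Proof.
elim: p => [|a p IH]; first by rewrite !big_nil !mulr1.
rewrite !big_cons IH /lamf [size _]/= exprS.
have h (b c e f g : C) : - c * b * (g * (e * f)) = -1 * g * (c * e * (b * f)) by ring.
exact: h.
Qed.

Lemma rt_sum n w t : nonreal w -> n.+1%:R * rt n.+1 0 w t =
  (-1) ^+ n * \sum_(p : n.+1.-tuple 'I_d) cw p * lkfun (xnodes w p) t.
Proof.
move=> nw; pose u (j : 'I_d) : C := - (t%:C - - (w * (x j)%:C))^-1.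
pose G (p : seq 'I_d) : C := cyc B p * \prod_(i <- p) lamf w t i.
have Grot k p : G (rot k p) = G p.
  by rewrite /G cyc_rot; congr (_ * _); apply: perm_big; rewrite perm_rot.
have -> : rt n.+1 0 w t = \sum_(p : n.+1.-tuple 'I_d) G p * u (thead p).
  rewrite rt_trace// trace_words//= size_nseq.
  apply: eq_bigr => p _; rewrite /G mulrC -mulrA; congr (_ * _).
  case/tupleP: p => a p; rewrite theadE /wprod /= !big_cons /=.
  have -> : \prod_(v <- zip (nseq n (lamf w t)) p) v.1 v.2 = \prod_(i <- p) lamf w t i.
    have := size_tuple p; move: (tval p) => q; elim: q n {p} => [|i q IH] [|n]//=.
      by rewrite !big_nil.
    by move=> [sq]; rewrite !big_cons /= (IH n sq).
  have hu : (x a)^-1%:C * lamf w t a = u a.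
    rewrite /lamf /u mulrA; have -> : (x a)^-1%:C = (x a)%:C^-1 :> C by exact: fmorphV.
    by rewrite mulrN mulVf ?xC0// mulN1r.
  by rewrite -(mulrA (lamf w t a)) hu mulrAC.
rewrite sum_tuple_rot// mulr_sumr; apply: eq_bigr => p _.
rewrite /lkfun /xnodes /rnodes /kfun -map_comp !big_map /cw /u sumrN /G.
have -> : \prod_(i <- p) lamf w t i = (-1) ^+ n.+1 * ((\prod_(i <- p) (x i)%:C) *
   \prod_(i <- p) (t%:C - - (w * (x i)%:C))^-1).
  by rewrite prod_lamf size_tuple.
move: (cyc B p) (\prod_(i <- p) _) (\prod_(i <- p) _) (\sum_(i <- p) _) => c X k s.
by rewrite exprS; move: (_ ^+ n) => e; ring.
Qed.

Lemma xnodes_nonreal w p : 0 < im w -> all (@nonreal R) (xnodes w p).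
Proof. by move=> w0; apply: rnodes_nonreal => //; rewrite all_map; apply/allP => i _ /=. Qed.

Lemma size_xnodes w p : size (xnodes w p) = size p.
Proof. by rewrite !size_map. Qed.

Definition nsum n (w : C) : C := \sum_(p : n.-tuple 'I_d) cw p * kap (xnodes w p).

Lemma evn_rt n w : 0 < im w -> cDom (evn (rt n.+2 0 w)) /\
  cint (evn (rt n.+2 0 w)) = (-1) ^+ n.+1 / n.+2%:R * nsum n.+2 w.
Proof.
move=> w0; have nw := nonreal_pos w0.
pose k : C := (-1) ^+ n.+1 / n.+2%:R.
have n0 : n.+2%:R != 0 :> C by rewrite pnatr_eq0.
have E t : \sum_(p : n.+2.-tuple 'I_d) (k * cw p) * evn (lkfun (xnodes w p)) t =
    evn (rt n.+2 0 w) t.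
  have F s : rt n.+2 0 w s = \sum_(p : n.+2.-tuple 'I_d) (k * cw p) * lkfun (xnodes w p) s.
    apply: (mulfI n0); rewrite (rt_sum n.+1 s nw) !mulr_sumr; apply: eq_bigr => p _.
    by rewrite /k; move: (lkfun _ _) (cw _) ((-1) ^+ _) => a b c; field; rewrite -natr1 -natr1 in n0.
  rewrite (eq_evn t F) /evn -sumrB !mulr_sumr; apply: eq_bigr => p _.
  by rewrite -mulrBr; move: (_ - _) (k * _) => a b; ring.
have D (p : n.+2.-tuple 'I_d) : cDom (evn (lkfun (xnodes w p))) /\
    cint (evn (lkfun (xnodes w p))) = kap (xnodes w p).
  by apply: evn_lkfun; [exact: xnodes_nonreal|rewrite size_xnodes size_tuple].
have D1 (p : n.+2.-tuple 'I_d) : cDom (fun t => (k * cw p) * evn (lkfun (xnodes w p)) t).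
  by apply: cDomZ; exact: (proj1 (D p)).
split; first by apply: (cDom_ext E); apply: cDom_sum => p _.
apply: etrans (esym (eq_cint E)) _; apply: etrans (cint_sum _ _) _; first by move=> p _.
rewrite /nsum mulr_sumr; apply: eq_bigr => p _.
have [d1 d2] := D p; apply: etrans (cintZ _ d1) _; rewrite d2.
by rewrite -/k -mulrA.
Qed.

Lemma nsum_homog n w w' : 0 < im w -> 0 < im w' ->
  w ^+ n.+1 * nsum n.+2 w = w' ^+ n.+1 * nsum n.+2 w'.
Proof.
move=> w0 w0'; rewrite /nsum !mulr_sumr; apply: eq_bigr => p _.
rewrite mulrCA [RHS]mulrCA; congr (_ * _).
have sp : size (map x p) = n.+2 by rewrite size_map size_tuple.
have := @kap_homog R w w' (map x p) w0 w0' _ _; rewrite sp; apply => //.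
by rewrite all_map; apply/allP => i _ /=.
Qed.

End diagonal.

Section moment.
Variables (R : realType) (d : nat) (x : 'I_d -> R).
Hypothesis x0 : forall i, x i != 0.
Variable B : 'M[R[i]]_d.
Hypothesis hB : ctr B = B.
Variable l : nat.
Local Notation C := R[i].
Local Notation re := (@complex.Re R).
Local Notation im := (@complex.Im R).
Local Notation w1 b := (Complex b (1 : R)).
Local Notation gf := (@test_fun R l).

Lemma gf_residue : [/\ cDom (fun b => gf (w1 b) * (w1 b) ^- l.+1),
   cint (fun b => gf (w1 b) * (w1 b) ^- l.+1) = - (2 * pi) *i / (- Complex 0 2) ^+ (l + 5),
   cDom (fun b => gf (w1 b) * ((w1 b) ^- l.+1)^*%C) &
   cint (fun b => gf (w1 b) * ((w1 b) ^- l.+1)^*%C) = 0].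
Proof.
pose v : C := Complex 0 1; pose u : C := Complex 0 (-1).
have v0 : 0 < im v by exact: ltr01.
have u0 : im u < 0 by rewrite /= oppr_lt0 ltr01.
have nv := nonreal_pos v0; have nu := nonreal_neg u0.
have w1E b : w1 b = b%:C - u by apply: complex_ext => /=; ring.
have w2E b : w1 b - Complex 0 2 = b%:C - v by apply: complex_ext => /=; ring.
have E1 b : kfun (u :: nseq (l + 5) v) b = gf (w1 b) * (w1 b) ^- l.+1.
  rewrite kfun_cons kfun_nseq /test_fun w2E -w1E.
  have w0 : w1 b != 0 by rewrite w1E line_neq0.
  rewrite exprS; have := expf_neq0 l w0; move: (_ ^+ l) (_^-1 ^+ _) => q r q0.
  by move: (w1 b) w0 => z z0; field; rewrite z0 q0.
have E2 b : (gp l (1:R)).[b%:C] * kfun (nseq (l + 5) v ++ nseq l.+1 v) b =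
    gf (w1 b) * ((w1 b) ^- l.+1)^*%C.
  have cat (s1 s2 : seq C) : kfun (s1 ++ s2) b = kfun s1 b * kfun s2 b by rewrite /kfun big_cat.
  rewrite gf_kfun -mulrA cat; congr (_ * _).
  have -> : gnode (1:R) = v by rewrite /gnode /v; congr Complex; ring.
  congr (_ * _); rewrite kfun_nseq exprVn conjc_inv; congr (_^-1).
  rewrite rmorphXn; congr (_ ^+ _).
  by apply: complex_ext => /=; ring.
have nn : all (@nonreal R) (nseq (l + 5) v ++ nseq l.+1 v).
  by rewrite all_cat !all_nseq nv !orbT.
have sz : (size (gp l (1:R)) < size (nseq (l + 5) v ++ nseq l.+1 v))%N.
  by rewrite size_gp size_cat !size_nseq; lia.
split.
- apply: (cDom_ext E1); apply: kfun_Dom => /=; first by rewrite nu all_nseq nv orbT.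
  by rewrite size_nseq; lia.
- rewrite -(eq_cint E1) addnS; apply: etrans (kap_pole _ u0 v0) _.
  by congr (_ / _ ^+ _); apply: complex_ext => /=; ring.
- by apply: (cDom_ext E2); exact: pfun_Dom.
- rewrite -(eq_cint E2); apply: (@pkap_same R _ _ (sgI v)) => //.
  by rewrite all_cat !all_nseq eqxx !orbT.
Qed.

(** Reading off the coefficient of order l + 2. *)
Theorem moment_b_nodes : moment_b x B l =
  (Complex 0 1) ^+ l.+2 / l.+2%:R * nsum x B l.+2 (Complex 0 1).
Proof.
have [D1 i1 D2 i2] := gf_residue.
pose i0 : C := Complex 0 1.
have i00 : 0 < im i0 by exact: ltr01.
pose k : C := (-1) ^+ l.+1 / l.+2%:R.
pose S0 := i0 ^+ l.+1 * nsum x B l.+2 i0.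
have nw b : nonreal (w1 b) by apply: nonreal_w1.
have w0 b : w1 b != 0.
  by apply: contra (nw b) => /eqP wb; rewrite wb.
have nsumE b : nsum x B l.+2 (w1 b) = S0 * (w1 b) ^- l.+1.
  have b0 : 0 < im (w1 b) by exact: ltr01.
  have h := nsum_homog x0 B l b0 i00; rewrite -/S0 in h.
  by rewrite -h mulrAC mulfV ?mul1r// expf_neq0.
have JE : double_int l (fun p : R * R => evn (neumann_trace x B l.+2 0 (w1 p.1)) p.2) =
   2^-1 * (k * S0 * (- (2 * pi) *i / (- Complex 0 2) ^+ (l + 5))).
  transitivity (cint (fun b => 2^-1 * (k * S0 * (gf (w1 b) * (w1 b) ^- l.+1) +
     (k * S0)^*%C * (gf (w1 b) * ((w1 b) ^- l.+1)^*%C)))).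
    apply: eq_cint => b.
    have [De ie] := evn_rt x0 hB l (ltr01 : 0 < im (w1 b)).
    apply: etrans (cint_re (gf (w1 b)) De) _.
    rewrite ie -/k nsumE re_half (mulrA k).
    have -> : (k * S0 * (w1 b) ^- l.+1)^*%C = (k * S0)^*%C * ((w1 b) ^- l.+1)^*%C by exact: rmorphM.
    have h (g a b' c e : C) : g * (2^-1 * (c * b' + e * a)) = 2^-1 * (c * (g * b') + e * (g * a)).
      by ring.
    exact: h.
  have Da := cDomZ (k * S0) D1; have Db := cDomZ (k * S0)^*%C D2.
  apply: etrans (cintZ _ (cDomD Da Db)) _; congr (_ * _).
  apply: etrans (cintD Da Db) _.
  by rewrite (cintZ _ D1) (cintZ _ D2) i1 i2 mulr0 addr0.
have := moment_coef x0 hB l; rewrite JE.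
have c0 : - Complex 0 2 != 0 :> C.
  by rewrite oppr_eq0; apply/negP => /eqP/(congr1 im)/= /eqP; rewrite pnatr_eq0.
have -> : - (2 * pi) *i = - (pi%:C * (2 * i0)) :> C by apply: complex_ext => /=; ring.
have p0 : pi%:C != 0 :> C by rewrite (inj_eq (@complexI R) _ 0) lt0r_neq0// pi_gt0.
rewrite exprVn; have := expf_neq0 (l + 5) c0; move: (_ ^+ (l + 5)) => q q0.
have s1 : (-1) ^+ l * (-1) ^+ l = 1 :> C by rewrite -exprMn mulrNN mul1r expr1n.
rewrite /k /S0 (exprS (-1)) (exprS i0 l.+1).
have n0 : l.+2%:R != 0 :> C by rewrite pnatr_eq0.
move: (pi%:C) (moment_b _ _ _) (nsum _ _ _ _) ((-1) ^+ l) (i0 ^+ _) (l.+2%:R) p0 n0 s1 => p M S s j n p0 n0 s1 h.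
have h2 : p * q^-1 * M = p * q^-1 * (s * s * (i0 * j / n * S)).
  have h3 : p * q^-1 * M = q^-1 * p * M by ring.
  by rewrite h3 -h; field; rewrite n0 q0.
have pq : p * q^-1 != 0 by rewrite mulf_neq0// invr_eq0.
by have := mulfI pq h2; rewrite s1 mul1r.
Qed.

End moment.

Section divided_difference.
Variable K : fieldType.
Implicit Types (s : seq K) (P Q : {poly K}).

Definition nodep s : {poly K} := \prod_(a <- s) ('X - a%:P).
Definition dd s Q : K := (Q %% nodep s)`_(size s).-1.

Lemma size_nodep s : size (nodep s) = (size s).+1.
Proof. exact: size_prod_XsubC. Qed.

Lemma nodep_neq0 s : nodep s != 0.
Proof. by rewrite -size_poly_eq0 size_nodep. Qed.

Lemma dd_perm s s' Q : perm_eq s s' -> dd s Q = dd s' Q.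
Proof.
by move=> p; rewrite /dd (perm_size p) (_ : nodep s = nodep s')//; exact: perm_big.
Qed.

Lemma ddD s Q Q' : dd s (Q + Q') = dd s Q + dd s Q'.
Proof. by rewrite /dd modpD coefD. Qed.

Lemma ddZ s c Q : dd s (c *: Q) = c * dd s Q.
Proof. by rewrite /dd modpZl coefZ. Qed.

Lemma dd_small s Q : (size Q <= size s)%N -> dd s Q = Q`_(size s).-1.
Proof. by move=> h; rewrite /dd modp_small// size_nodep ltnS. Qed.

Lemma size_mod_nodep s Q : (size (Q %% nodep s)%R <= size s)%N.
Proof. by rewrite -ltnS -size_nodep ltn_modp nodep_neq0. Qed.

Lemma dd_factor a s Q : dd (a :: s) (('X - a%:P) * Q) = dd s Q.
Proof.
rewrite /dd; have -> : ('X - a%:P) * Q %% nodep (a :: s) = ('X - a%:P) * (Q %% nodep s).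
  apply/esym/(@modpP _ _ (Q %/ nodep s)).
    by rewrite /nodep big_cons -/(nodep s) mulrCA -mulrDr -divp_eq.
  rewrite size_nodep /=; have [->|r0] := eqVneq (Q %% nodep s) 0; first by rewrite mulr0 size_poly0.
  rewrite size_monicM ?monicXsubC// size_XsubC /= ltnS.
  exact: size_mod_nodep.
have h : (size (Q %% nodep s)%R <= size s)%N by exact: size_mod_nodep.
rewrite mulrBl coefB coefXM coefCM /=; case: s h => [|b s] h /=.
  move: h; rewrite leqn0 size_poly_eq0 => /eqP ->.
  by rewrite !coef0 mulr0 subrr.
by rewrite [X in a * X]nth_default ?mulr0 ?subr0.
Qed.

Lemma dd_rec a b s Q : (a - b) * dd [:: a, b & s] Q = dd (a :: s) Q - dd (b :: s) Q.
Proof.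
have pE : perm_eq [:: b, a & s] [:: a, b & s].
  by apply/permP => q /=; rewrite addnCA.
rewrite -(dd_factor b (a :: s)) (dd_perm _ pE) -(dd_factor a (b :: s)).
have -> : ('X - b%:P) * Q = ('X - a%:P) * Q + (a - b) *: Q.
  by rewrite -mul_polyC polyCB -mulrDl addrA subrK.
by rewrite ddD ddZ addrAC subrr add0r.
Qed.

Lemma dd_const s c : (1 < size s)%N -> dd s c%:P = 0.
Proof.
move=> s1; rewrite dd_small; last by rewrite (leq_trans (size_polyC_leq1 _))// ltnW.
by rewrite coefC -subn1 subn_eq0 leqNgt s1.
Qed.

Lemma dd_sum s I (r : seq I) (F : I -> {poly K}) :
  dd s (\sum_(i <- r) F i) = \sum_(i <- r) dd s (F i).
Proof.
elim: r => [|i r IH]; last by rewrite !big_cons ddD IH.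
by rewrite !big_nil /dd mod0p coef0.
Qed.

End divided_difference.

Section node_kernel.
Variable R : realType.
Local Notation C := R[i].
Local Notation mu := (@lebesgue_measure R).
Local Notation im := (@complex.Im R).

Lemma poly_primitive_power (Q : {poly R}) (a : R) m :
  ('X - a%:P) ^+ m %| Q^`() -> ('X - a%:P) ^+ m %| Q - Q.[a]%:P.
Proof.
move=> hQ; pose T := Q - Q.[a]%:P.
have hT : ('X - a%:P) ^+ m %| T^`() by rewrite /T derivB derivC subr0.
suff h j : (j <= m)%N -> ('X - a%:P) ^+ j %| T by exact: h.
elim: j => [|j IH] jm; first by rewrite expr0 dvd1p.
case: j IH jm => [|j] IH jm.
  by rewrite expr1 dvdp_XsubCl /root /T hornerD hornerN hornerC subrr.
have /dvdpP[q Tq] := IH (ltnW jm).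
have : ('X - a%:P) ^+ j.+1 %| T^`() by apply: dvdp_trans hT; apply: dvdp_exp2l; exact: ltnW.
rewrite {1}Tq derivM deriv_exp derivXsubC mul1r /=.
rewrite dvdp_addr; last exact: dvdp_mull.
rewrite mulrnAr -mulr_natl -polyC_natr mul_polyC dvdpZr ?pnatr_eq0// exprS.
rewrite dvdp_mul2r ?expf_neq0 ?polyXsubC_eq0// => qa.
by rewrite Tq (exprS _ j.+1) dvdp_mul.
Qed.

Lemma dd_nseq (Q : {poly R}) (a : R) n : nodep (nseq n.+2 a) %| Q^`() -> dd (nseq n.+2 a) Q = 0.
Proof.
have nE m : nodep (nseq m a) = ('X - a%:P) ^+ m.
  by rewrite /nodep; elim: m => [|m IH]; rewrite ?big_nil ?expr0// big_cons IH exprS.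
rewrite nE => /poly_primitive_power h; rewrite -[Q](subrK Q.[a]%:P) ddD dd_const ?addr0; last first.
  by rewrite size_nseq.
rewrite /dd; have -> : (Q - Q.[a]%:P) %% nodep (nseq n.+2 a) = 0; last by rewrite coef0.
by apply/modp_eq0P; rewrite nE.
Qed.

(** What is retained of the function of a that the contour integral defines. *)
Definition kernel_spec (s : seq R) (phi : R -> R) :=
  [/\ forall P : {poly R}, Dom (fun a => P.[a] * phi a),
   forall a, a \notin s ->
     kap (rnodes (Complex 0 1) [seq al - a | al <- s]) =
     (Complex 0 1) ^+ (size s - 2) * (phi a)%:C &
   forall P Q : {poly R}, Q^`() = P -> nodep s %| P ->
     \int[mu]_a (P.[a] * phi a) = 2 * pi * dd s Q].

Lemma poly_is_derive (P : {poly R}) (t : R) : is_derive t (1 : R) (fun u : R => P.[u]) P^`().[t].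
Proof.
elim/poly_ind: P => [|p c IH].
  rewrite (_ : (fun u : R => _) = cst 0); last by apply/funext => u; rewrite horner0.
  by rewrite deriv0 horner0; exact: is_derive_cst.
rewrite (_ : (fun u : R => _) = (fun u => p.[u]) * id + cst c); last first.
  by apply/funext => u; rewrite !hornerE.
apply: is_derive_eq; rewrite derivD derivM derivX derivC !hornerE /GRing.scale /=.
by ring.
Qed.

Lemma poly_continuous (P : {poly R}) : continuous (fun u : R => P.[u]).
Proof.
move=> t; apply: differentiable_continuous; apply/derivable1_diffP.
by have := poly_is_derive P t; case.
Qed.

Lemma poly_bounded (P : {poly R}) (r t : R) : `|t| <= r ->
  `|P.[t]| <= \sum_(i < size P) `|P`_i| * r ^+ i.
Proof.
move=> tr; rewrite horner_coef; apply: (le_trans (ler_norm_sum _ _ _)).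
apply: ler_sum => i _; rewrite normrM normrX ler_wpM2l// lerXn2r// nnegrE//.
exact: le_trans tr.
Qed.

Definition segment_kernel (c a b t : R) : R := c * \1_(`[a, b]%classic) t.

Lemma segment_kernel_Dom (c a b : R) (P : {poly R}) :
  Dom (fun t => P.[t] * segment_kernel c a b t).
Proof.
split.
  apply: measurable_funM; first by apply: continuous_measurable_fun; exact: poly_continuous.
  by apply: measurable_funM => //; exact: measurable_indic.
pose r := `|a| + `|b|; pose K := `|c| * \sum_(i < size P) `|P`_i| * r ^+ i.
have r0 : 0 <= r by rewrite addr_ge0.
have K0 : 0 <= K.
  by rewrite mulr_ge0//; apply: sumr_ge0 => i _; rewrite mulr_ge0// exprn_ge0.
have out t : r < `|t| -> segment_kernel c a b t = 0.
  move=> neumann_trace; rewrite /segment_kernel indicE memNset ?mulr0//= in_itv /= => /andP[h1 h2].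
  move: neumann_trace; rewrite ltNge => /negP; apply; rewrite /r ler_norml.
  have := ler_norm b; have := ler_norm (- a); rewrite normrN.
  by have := normr_ge0 a; have := normr_ge0 b; lra.
exists (K * (1 + r ^+ 2)) => t; apply: supported_decay => //.
- rewrite normrM /segment_kernel; have [tr|neumann_trace] := leP `|t| r; last first.
    by rewrite -/(segment_kernel c a b t) out// normr0 mulr0.
  rewrite mulrC /K; apply: ler_pM => //; last exact: poly_bounded.
  rewrite normrM ler_piMr// indicE; by case: (_ \in _); rewrite ?normr1 ?normr0.
- by move=> /out ->; rewrite mulr0 normr0.
Qed.

Lemma segment_kernel_int (c a b : R) (P Q : {poly R}) : a < b -> Q^`() = P ->
  \int[mu]_t (P.[t] * segment_kernel c a b t) = c * (Q.[b] - Q.[a]).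
Proof.
move=> ab QP.
have -> : (fun t => P.[t] * segment_kernel c a b t) = ((fun t => (c *: P).[t]) \_ `[a, b]%classic).
  apply/funext => t; rewrite /segment_kernel patchE indicE; case: ifP => _.
    by rewrite mulr1 hornerZ mulrC.
  by rewrite !mulr0.
rewrite -Rintegral_mkcond /Rintegral.
have dG t : is_derive t (1:R) (fun u : R => (c *: Q).[u]) (c *: P).[t].
  by rewrite -QP -derivZ; exact: poly_is_derive.
rewrite (@continuous_FTC2 _ (fun t => (c *: P).[t]) (fun t => (c *: Q).[t]))//.
- by rewrite /= !hornerZ mulrBr.
- by apply: continuous_subspaceT; exact: poly_continuous.
- have cG := @poly_continuous (c *: Q).
  split.
  + by move=> x _; have := dG x; case.
  + by apply: cvg_at_right_filter; exact: cG.
  + by apply: cvg_at_left_filter; exact: cG.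
- by move=> x _; rewrite derive1E; have := dG x; case.
Qed.

Lemma rnodes_split (a : R) (s : seq R) : a \notin s ->
  all (@nonreal R) (rnodes (Complex 0 1) [seq al - a | al <- s]).
Proof.
move=> h; apply: rnodes_nonreal; first exact: ltr01.
rewrite all_map; apply/allP => al als /=; rewrite subr_eq0.
by apply: contra h => /eqP <-.
Qed.

Lemma node_diff (a b t : R) : - (Complex 0 1 * (a - t)%:C) - - (Complex 0 1 * (b - t)%:C) =
  - Complex 0 1 * (a - b)%:C.
Proof. by apply: complex_ext => /=; ring. Qed.

Lemma node_diff_neq0 (a b : R) : a != b -> - Complex 0 1 * (a - b)%:C != 0 :> C.
Proof.
move=> ab; rewrite mulf_neq0//; last by rewrite (inj_eq (@complexI R) _ 0) subr_eq0.
by rewrite oppr_eq0; apply/negP => /eqP/(congr1 im)/= /eqP; rewrite oner_eq0.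
Qed.

Lemma sg_diff (a b t : R) : a < b -> t != a -> t != b ->
  Num.sg (t - a) - Num.sg (t - b) = 2 * \1_(`[a, b]%classic) t.
Proof.
move=> ab ta tb; rewrite indicE; have [at1|at1] := ltP a t; last first.
  have {}ta : t < a by rewrite lt_neqAle ta.
  rewrite memNset; last by rewrite /= in_itv /= leNgt ta.
  have h1 : t - a < 0 by rewrite subr_lt0.
  have h2 : t - b < 0 by rewrite subr_lt0 (lt_trans ta).
  by rewrite (ltr0_sg h1) (ltr0_sg h2) subrr mulr0.
rewrite gtr0_sg ?subr_gt0//; have [bt|tb'] := ltP b t.
  by rewrite gtr0_sg ?subr_gt0// memNset ?subrr ?mulr0//= in_itv /= [t <= b]leNgt bt andbF.
rewrite mem_set ?ltr0_sg ?subr_lt0 ?lt_neqAle ?tb ?opprK ?mulr1//.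
by rewrite /= in_itv /= (ltW at1).
Qed.

Lemma kernel_perm (s s' : seq R) phi : perm_eq s s' -> kernel_spec s phi -> kernel_spec s' phi.
Proof.
move=> ss' [h1 h2 h3]; split=> //.
- move=> a; rewrite -(perm_mem ss') => /h2.
  by rewrite (kap_perm (perm_map _ (perm_map _ ss'))) (perm_size ss').
- move=> P Q QP; rewrite -(dd_perm Q ss') => h; apply: h3 => //.
  by rewrite (_ : nodep s = nodep s')//; exact: perm_big.
Qed.

Lemma kernel_pair (a b : R) : a < b ->
  kernel_spec [:: a; b] (segment_kernel (2 * pi / (b - a)) a b).
Proof.
move=> ab; have ab0 : b - a != 0 by rewrite subr_eq0 gt_eqF.
split; first exact: segment_kernel_Dom.
  move=> t th; have /and3P[n1 n2 _] := rnodes_split th.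
  move: th; rewrite !inE negb_or => /andP[ta tb].
  rewrite expr0 mul1r /=.
  have d0 : - Complex 0 1 * (a - b)%:C != 0 :> C by apply: node_diff_neq0; rewrite lt_eqF.
  rewrite kap2//; last by rewrite -subr_eq0 node_diff.
  rewrite node_diff /sgI !im_rnode [im _]/= !mulr1 !opprB (sg_diff ab ta tb).
  apply: (mulIf d0); rewrite mulfVK//.
  have e : (b - a)^-1 * (b - a) = 1 by rewrite mulVf.
  rewrite /segment_kernel; move: (\1_ _ t) e; move: (b - a)^-1 => r i e.
  apply: complex_ext => /=; rewrite ?oppr0 ?mul0r ?mulr0 ?subr0 ?add0r ?addr0 ?mulr0//.
  by rewrite mulN1r opprB -[in LHS](mul1r i) -e; ring.
move=> P Q QP _; rewrite (segment_kernel_int _ ab QP).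
have h := dd_rec b a [::] Q.
have d1 c : dd [:: c] Q = Q.[c].
  by rewrite /dd /nodep big_seq1 modp_XsubC coefC.
have pE : perm_eq [:: b; a] [:: a; b] by rewrite (perm_catC [:: b] [:: a]).
rewrite (dd_perm _ pE) !d1 in h.
by rewrite -h; field.
Qed.

Lemma kernel_zero (a : R) n : kernel_spec (nseq n.+2 a) (fun=> 0).
Proof.
split.
- move=> P; split; last by exists 0 => t; rewrite mulr0 normr0 mul0r.
  apply: measurable_funM => //; apply: continuous_measurable_fun; exact: poly_continuous.
- move=> t ta; rewrite mulr0 /rnodes map_nseq map_nseq; apply: kap_nseq.
  by have := rnodes_split ta; rewrite /rnodes map_nseq map_nseq /= => /andP[].
- move=> P Q QP h; rewrite dd_nseq ?QP// mulr0 /Rintegral integral0_eq// => t _.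
  by rewrite mulr0.
Qed.

Lemma kernel_exists (s : seq R) : (1 < size s)%N -> exists phi, kernel_spec s phi.
Proof.
move: s; apply: nodes_ind.
- by move=> s s' ss' [phi h]; exists phi; exact: kernel_perm h.
- by move=> n z; exists (fun=> 0); exact: kernel_zero.
- move=> a b; rewrite neq_lt => /orP[ab|ba].
    by eexists; exact: kernel_pair.
  eexists; apply: kernel_perm (kernel_pair ba).
  by rewrite (perm_catC [:: b] [:: a]).
- move=> a b s ab s0 [f [f1 f2 f3]] [g [g1 g2 g3]].
  have ab0 : a - b != 0 by rewrite subr_eq0.
  have E (P : {poly R}) t : ((a - b)^-1 *: P).[t] * f t - ((a - b)^-1 *: P).[t] * g t =
      P.[t] * ((f t - g t) / (a - b)).
    by rewrite hornerZ; move: (P.[t]) => u; field.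
  exists (fun t => (f t - g t) / (a - b)); split.
  + move=> P; have [mf [Cf hf]] := f1 ((a - b)^-1 *: P).
    have [mg [Cg hg]] := g1 ((a - b)^-1 *: P).
    split.
      have -> : (fun t => P.[t] * ((f t - g t) / (a - b))) =
        (fun t => ((a - b)^-1 *: P).[t] * f t - ((a - b)^-1 *: P).[t] * g t).
        by apply/funext => t; rewrite E.
      exact: measurable_funB.
    exists (Cf + Cg) => t; rewrite -E mulrDl; apply: (le_trans (ler_normB _ _)).
    exact: lerD.
  + move=> t th; have /and3P[n1 n2 _] := rnodes_split th.
    move: th; rewrite !inE !negb_or => /and3P[ta tb ts].
    have tas : t \notin a :: s by rewrite inE negb_or ta.
    have tbs : t \notin b :: s by rewrite inE negb_or tb.
    have ss : (0 < size (rnodes (Complex 0 1) [seq al - t | al <- s])%R)%N by rewrite !size_map.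
    have ns : all (@nonreal R) (rnodes (Complex 0 1) [seq al - t | al <- s]).
      exact: rnodes_split.
    have h := kap_rec n1 n2 ns ss; rewrite node_diff in h.
    have {}h : - Complex 0 1 * (a - b)%:C *
        kap (rnodes (Complex 0 1) [seq al - t | al <- [:: a, b & s]]) =
        kap (rnodes (Complex 0 1) [seq al - t | al <- a :: s]) -
        kap (rnodes (Complex 0 1) [seq al - t | al <- b :: s]) by exact: h.
    rewrite (f2 t tas) (g2 t tbs) in h.
    apply: (mulfI (node_diff_neq0 ab)); rewrite h.
    have -> : (size [:: a, b & s] - 2)%N = (size s - 1).+1 by rewrite /= !subSS subn0 subnSK ?subn0.
    have -> : (size (a :: s) - 2)%N = (size s - 1)%N by rewrite /= subSS.
    have h2 : (a - b)%:C * ((f t - g t) / (a - b))%:C = (f t)%:C - (g t)%:C :> C.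
      by rewrite -rmorphM -rmorphB mulrC divfK.
    have h1 : Complex 0 1 * Complex 0 1 = -1 :> C by apply: complex_ext => /=; ring.
    have fin (i0 j y z u v : C) : i0 * i0 = -1 -> y * z = u - v ->
        j * u - j * v = - i0 * y * (i0 * j * z).
      move=> e1 e2; have -> : - i0 * y * (i0 * j * z) = - (i0 * i0) * (j * (y * z)) by ring.
      by rewrite e1 e2 opprK mul1r mulrBr.
    by rewrite exprS; exact: fin.
  + move=> P Q QP dv.
    have da : nodep (a :: s) %| (a - b)^-1 *: P.
      rewrite dvdpZr ?invr_eq0//; apply: dvdp_trans dv.
      by rewrite /nodep !big_cons mulrCA; exact: dvdp_mulIr.
    have db : nodep (b :: s) %| (a - b)^-1 *: P.
      rewrite dvdpZr ?invr_eq0//; apply: dvdp_trans dv.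
      by rewrite /nodep !big_cons; exact: dvdp_mulIr.
    have QP' : ((a - b)^-1 *: Q)^`() = (a - b)^-1 *: P by rewrite derivZ QP.
    transitivity (\int[mu]_t (((a - b)^-1 *: P).[t] * f t - ((a - b)^-1 *: P).[t] * g t)).
      by apply: eq_Rintegral => t _; rewrite E.
    rewrite RintegralB//; [|exact: Dom_integrable (f1 _)|exact: Dom_integrable (g1 _)].
    rewrite (f3 _ _ QP' da) (g3 _ _ QP' db) -mulrBr; congr (_ * _).
    by apply: (mulfI ab0); rewrite dd_rec !ddZ -mulrBr mulVKf.
Qed.

End node_kernel.

Section primitive.
Variable K : numFieldType.
Implicit Types (p q P Q : {poly K}) (s : seq K) (th a : K).

(* the coefficient of degree 0 is p`_0 / 0 = 0 *)
Definition prim p : {poly K} := \poly_(i < (size p).+1) (p`_i.-1 / i%:R).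

Lemma coef_prim p i : (prim p)`_i = p`_i.-1 / i%:R.
Proof.
rewrite coef_poly; case: ltnP => // h; case: i h => [//|i] h.
by rewrite nth_default ?mul0r.
Qed.

Lemma primD p q : prim (p + q) = prim p + prim q.
Proof. by apply/polyP => i; rewrite coefD !coef_prim coefD mulrDl. Qed.

Lemma primZ a p : prim (a *: p) = a *: prim p.
Proof. by apply/polyP => i; rewrite coefZ !coef_prim coefZ mulrA. Qed.

Lemma prim_sum (I : Type) (r : seq I) (F : I -> {poly K}) :
  prim (\sum_(i <- r) F i) = \sum_(i <- r) prim (F i).
Proof.
elim: r => [|i r IH]; last by rewrite !big_cons primD IH.
by rewrite !big_nil; apply/polyP => i; rewrite coef_prim !coef0 mul0r.
Qed.

Lemma primXn n : prim 'X^n = n.+1%:R^-1 *: 'X^(n.+1).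
Proof.
apply/polyP => i; rewrite coef_prim coefZ !coefXn; case: i => [|i] /=.
  by rewrite invr0 !mulr0.
by rewrite eqSS; case: eqP => [->|_]; rewrite ?mulr1 ?mul1r ?mulr0 ?mul0r.
Qed.

Lemma prim_deriv P : prim P^`() = P - (P`_0)%:P.
Proof.
apply/polyP => -[|i]; rewrite coef_prim coefB coefC /=.
  by rewrite invr0 mulr0 subrr.
rewrite coef_deriv subr0 -[X in X / _]mulr_natr mulfK ?pnatr_eq0//.
Qed.

Definition int01 p : K := (prim p).[1].

Lemma int01D p q : int01 (p + q) = int01 p + int01 q.
Proof. by rewrite /int01 primD hornerD. Qed.

Lemma int01Z a p : int01 (a *: p) = a * int01 p.
Proof. by rewrite /int01 primZ hornerZ. Qed.

Lemma int01_sum (I : Type) (r : seq I) (F : I -> {poly K}) :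
  int01 (\sum_(i <- r) F i) = \sum_(i <- r) int01 (F i).
Proof. by rewrite /int01 prim_sum horner_sum. Qed.

Lemma int01Xn n : int01 'X^n = n.+1%:R^-1.
Proof. by rewrite /int01 primXn hornerZ hornerXn expr1n mulr1. Qed.

Lemma int01_deriv P : int01 P^`() = P.[1] - P.[0].
Proof. by rewrite /int01 prim_deriv !hornerE horner_coef0. Qed.

Lemma beta_int01 (a b : nat) : int01 ('X^a * ('X - 1) ^+ b) =
  (-1) ^+ b * (a`! * b`!)%:R / (a + b).+1`!%:R.
Proof.
elim: b a => [|b IH] a.
  have f0 : a`!%:R != 0 :> K by rewrite pnatr_eq0 -lt0n fact_gt0.
  by rewrite expr0 mulr1 int01Xn mul1r fact0 muln1 addn0 factS natrM invfM mulrCA mulfV ?mulr1.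
pose P : {poly K} := 'X^(a.+1) * ('X - 1) ^+ b.+1.
have e1 : int01 P^`() = 0.
  rewrite int01_deriv /P !hornerM !hornerXn !horner_exp !hornerE.
  by rewrite subrr !expr0n /= mulr0 mul0r subrr.
have e2 : P^`() = a.+1%:R *: ('X^a * ('X - 1) ^+ b.+1) + b.+1%:R *: ('X^(a.+1) * ('X - 1) ^+ b).
  rewrite /P derivM derivXn deriv_exp derivB derivX derivC subr0 mul1r /=.
  by rewrite !scaler_nat mulrnAl mulrnAr.
rewrite e2 int01D !int01Z IH in e1.
have a0 : a.+1%:R != 0 :> K by rewrite pnatr_eq0.
apply: (mulfI a0); apply: etrans (_ : _ = - (b.+1%:R * ((-1) ^+ b * (a.+1`! * b`!)%:R / (a.+1 + b).+1`!%:R))) _.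
  by apply/eqP; rewrite -addr_eq0 e1.
rewrite addSnnS (factS a) (factS b) !natrM exprS.
have h (q r u v n m : K) : - (m * (q * (n * u * v) * r)) = n * (-1 * q * (u * (m * v)) * r) by ring.
exact: h.
Qed.

Fixpoint zsum s (th : K) (q : nat) : K :=
  if s is a :: s' then \sum_(i < q.+1) a ^+ i * (if i == 0%N :> nat then th else th - 1) * zsum s' th (q - i)
  else (q == 0%N)%:R.

Definition scaled_nodes s th : {poly K} := \prod_(a <- s) (th *: 'X - a%:P).

Lemma size_scaled_nodes s th : (size (scaled_nodes s th) <= (size s).+1)%N.
Proof.
rewrite /scaled_nodes; elim: s => [|a s IH]; first by rewrite big_nil size_poly1.
rewrite big_cons; apply: (leq_trans (size_polyMleq _ _)).
have h : (size (th *: 'X - a%:P)%R <= 2)%N.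
  rewrite (leq_trans (size_polyD _ _))// geq_max size_polyN.
  by rewrite (leq_trans (size_polyC_leq1 _))// andbT (leq_trans (size_scale_leq _ _))// size_polyX.
by move: h IH => /=; lia.
Qed.

Lemma zsum0 s th : zsum s th 0 = th ^+ size s.
Proof.
elim: s => [|a s IH]; first by rewrite /= expr0.
by rewrite /= big_ord1 /= expr0 mul1r IH exprS.
Qed.

Lemma lead_scaled_nodes s th : (scaled_nodes s th)`_(size s) = th ^+ size s.
Proof.
elim: s => [|a s IH]; first by rewrite /scaled_nodes big_nil coef1.
rewrite /scaled_nodes big_cons -/(scaled_nodes s th) mulrBl -scalerAl coefB coefZ coefXM coefCM /= IH.
by rewrite [X in a * X]nth_default ?mulr0 ?subr0 ?exprS// size_scaled_nodes.
Qed.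

Lemma dd_power_factor a s (G : {poly K}) j : dd (a :: s) ('X^j * G) =
  \sum_(i < j) a ^+ i * dd s ('X^(j.-1 - i) * G) + a ^+ j * dd (a :: s) G.
Proof.
elim: j => [|j IH]; first by rewrite big_ord0 !expr0 !mul1r add0r.
have -> : 'X^(j.+1) * G = ('X - a%:P) * ('X^j * G) + a *: ('X^j * G).
  by rewrite -mul_polyC -mulrDl subrK exprS mulrA.
rewrite ddD ddZ dd_factor IH big_ord_recl expr0 mul1r subn0 mulrDr mulrA -exprS addrA.
congr (_ + _ + _); rewrite mulr_sumr; apply: eq_bigr => i _.
have -> : (j.+1.-1 - lift ord0 i = j.-1 - i)%N by rewrite lift0 /=; lia.
by rewrite mulrA -exprS lift0.
Qed.

Lemma zsum_cons a s th (q : nat) : zsum (a :: s) th q.+1 =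
  th * zsum s th q.+1 + (th - 1) * \sum_(i < q.+1) a ^+ i.+1 * zsum s th (q - i).
Proof.
rewrite [LHS]/= big_ord_recl /= mul1r; congr (_ + _).
rewrite mulr_sumr; apply: eq_bigr => i _.
by rewrite [bump 0 i](_ : _ = i.+1)// subSS /= [RHS]mulrCA mulrA.
Qed.

Lemma dd_zsum s th (q : nat) : dd s ('X^q * scaled_nodes s th) = zsum s th q.+1.
Proof.
elim: s q => [|a s IH] q.
  by rewrite /= /dd /nodep big_nil modp1 coef0.
have sE : scaled_nodes (a :: s) th = th *: (('X - a%:P) * scaled_nodes s th) +
    ((th - 1) * a) *: scaled_nodes s th.
  have -> : scaled_nodes (a :: s) th = (th *: 'X - a%:P) * scaled_nodes s th.
    by rewrite /scaled_nodes big_cons.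
  have -> : th *: 'X - a%:P = th *: ('X - a%:P) + ((th - 1) * a)%:P.
    by rewrite scalerBr -[th *: a%:P]mul_polyC -polyCM mulrBl mul1r polyCB -addrA addKr.
  by rewrite mulrDl -scalerAl mul_polyC.
have e1 : 'X^q * scaled_nodes (a :: s) th = th *: (('X - a%:P) * ('X^q * scaled_nodes s th)) +
    ((th - 1) * a) *: ('X^q * scaled_nodes s th).
  by rewrite sE mulrDr -!scalerAr (mulrCA ('X^q)).
rewrite e1 ddD !ddZ dd_factor IH dd_power_factor.
have -> : dd (a :: s) (scaled_nodes s th) = zsum s th 0.
  rewrite zsum0 -lead_scaled_nodes dd_small//; exact: size_scaled_nodes.
rewrite zsum_cons big_ord_recr /= subnn; congr (_ + _).
rewrite -mulrA mulrDr; congr (_ * (_ + _)); last by rewrite mulrA -exprS.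
rewrite mulr_sumr; apply: eq_bigr => i _; rewrite IH mulrA -exprS.
by congr (_ * zsum _ _ _); have := ltn_ord i; lia.
Qed.

Lemma comp_scaled_nodes s th k : ('X^k * nodep s) \Po (th *: 'X) = th ^+ k *: ('X^k * scaled_nodes s th).
Proof.
rewrite comp_polyM comp_Xn_poly exprZn -scalerAl; congr (_ *: (_ * _)).
rewrite /nodep /scaled_nodes rmorph_prod; apply: eq_bigr => a _ /=.
by rewrite comp_polyB comp_polyX comp_polyC.
Qed.

Lemma dd_primitive s (k : nat) (Q : {poly K}) (z : {poly K}) : (1 < size s)%N ->
  Q^`() = 'X^k * nodep s -> (forall th, z.[th] = zsum s th k.+2) ->
  dd s Q = int01 ('X^k * z).
Proof.
move=> s1 QN hz; set N := 'X^k * nodep s in QN.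
have QE : Q = prim N + (Q`_0)%:P by rewrite -QN prim_deriv subrK.
rewrite QE ddD dd_const// addr0.
pose D : {poly K} := \sum_(j < size N) (N`_j * dd s 'X^(j.+1)) *: 'X^j.
have NE : N = \sum_(j < size N) N`_j *: 'X^j by rewrite -poly_def coefK.
have -> : dd s (prim N) = int01 D.
  rewrite {1}NE prim_sum dd_sum /D int01_sum; apply: eq_bigr => j _.
  by rewrite primZ primXn !ddZ int01Z int01Xn -mulrA [_^-1 * _]mulrC.
congr int01; apply: poly_eq_nat => n; move: (n.+1%:R : K) => th.
rewrite hornerM hornerXn hz -dd_zsum -ddZ.
have -> : th ^+ k *: ('X^(k.+1) * scaled_nodes s th) = 'X * (N \Po (th *: 'X)).
  by rewrite /N comp_scaled_nodes -scalerAr exprS -mulrA.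
rewrite [in RHS]NE linear_sum /= mulr_sumr dd_sum horner_sum.
apply: eq_bigr => j _; rewrite hornerZ hornerXn linearZ /= comp_Xn_poly exprZn.
by rewrite -!scalerAr -exprS !ddZ -mulrA [dd _ _ * _]mulrC.
Qed.

End primitive.

Section block_words.
Variables (M : pzRingType) (A B : M) (Q Q' : nat).

Definition supp n (e : seq 'I_n) : nat := count (fun i : 'I_n => 0 < i)%N e.
Definition etotal n (e : seq 'I_n) : nat := (\sum_(i <- e) nat_of_ord i)%N.
Definition eword (e : seq 'I_Q.+1) : M := \prod_(i <- e) (A ^+ i * B).
Definition ecut K n (e : seq 'I_Q.+1) : M :=
  if (etotal e == K) && (supp e == n) then eword e else 0.

Definition csum m K n : M := \sum_(e : m.-tuple 'I_Q.+1) ecut K n e.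
Definition csum1 m K n : M :=
  if m is m'.+1 then \sum_(i : 'I_Q.+1 | (0 < i)%N) \sum_(e : m'.-tuple 'I_Q.+1) ecut K n (i :: e)
  else csum 0 K n.

Lemma etotal_cons n (i : 'I_n) e : etotal (i :: e) = (i + etotal e)%N.
Proof. by rewrite /etotal big_cons. Qed.

Lemma supp_cons n (i : 'I_n) e : supp (i :: e) = ((0 < i) + supp e)%N.
Proof. by []. Qed.

Lemma csum0 K n : csum 0 K n = ((K == 0) && (n == 0))%N%:R.
Proof.
rewrite /csum sum_tuple0 /ecut /etotal /supp /eword !big_nil /= eq_sym [0%N == n]eq_sym.
by case: ifP.
Qed.

Lemma ecut_pos K n (i : 'I_Q.+1) e : (0 < i)%N -> ecut K n.+1 (i :: e) =
  if (i <= K)%N then A ^+ i * B * ecut (K - i)%N n e else 0.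
Proof.
move=> i0; rewrite /ecut etotal_cons supp_cons i0 add1n eqSS /eword big_cons.
case: leqP => iK.
  rewrite -(eqn_add2l i (etotal e) (K - i)%N) subnKC//.
  by case: ifP => _; rewrite ?mulr0.
by rewrite (_ : (i + etotal e == K)%N = false)//; lia.
Qed.

Lemma ecut_pos0 K (i : 'I_Q.+1) e : (0 < i)%N -> ecut K 0 (i :: e) = 0.
Proof. by move=> i0; rewrite /ecut supp_cons i0 andbF. Qed.

Lemma ecut_zero K n e : ecut K n (ord0 :: e) = B * ecut K n e.
Proof.
rewrite /ecut etotal_cons supp_cons /= !add0n /eword big_cons expr0 mul1r.
by case: ifP => _; rewrite ?mulr0.
Qed.

Lemma csum_rec m K n : csum m.+1 K n = B * csum m K n + csum1 m.+1 K n.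
Proof.
rewrite /csum sum_tuple_cons (bigD1 ord0)//=; congr (_ + _).
  by rewrite mulr_sumr; apply: eq_bigr => e _; exact: ecut_zero.
by apply: eq_bigl => i; rewrite lt0n.
Qed.

Lemma csum_leading_zeros m K n : csum m K n = \sum_(q < m.+1) B ^+ q * csum1 (m - q)%N K n.
Proof.
elim: m => [|m IH]; first by rewrite big_ord1 expr0 mul1r.
rewrite csum_rec big_ord_recl expr0 mul1r subn0 addrC; congr (_ + _).
rewrite IH mulr_sumr; apply: eq_bigr => q _.
by rewrite lift0 subSS exprS mulrA.
Qed.

Lemma csum1_pos m K n : csum1 m.+1 K n.+1 =
  \sum_(i : 'I_Q.+1 | (0 < i <= K)%N) A ^+ i * B * csum m (K - i)%N n.
Proof.
rewrite /= [RHS]big_mkcondr; apply: eq_bigr => i i0.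
case: ifP => iK; last by rewrite big1// => e _; rewrite ecut_pos// iK.
by rewrite /csum mulr_sumr; apply: eq_bigr => e _; rewrite ecut_pos// iK.
Qed.

Lemma csum1_pos0 m K : csum1 m.+1 K 0 = 0.
Proof. by rewrite /= big1// => i i0; rewrite big1// => e _; exact: ecut_pos0. Qed.

Definition bword (t : seq 'I_Q.+1) (t' : seq 'I_Q'.+1) : M :=
  \prod_(u <- zip t t') (A ^+ u.1 * B ^+ u.2).
Definition iscomp n s (t : seq 'I_n) := all (fun i : 'I_n => 0 < i)%N t && (etotal t == s).
Definition bcut K m t t' : M := if iscomp K t && iscomp m t' then bword t t' else 0.
Definition bsum n m K : M := \sum_(t : n.-tuple 'I_Q.+1) \sum_(t' : n.-tuple 'I_Q'.+1) bcut K m t t'.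

Lemma bsum0 m K : bsum 0 m K = ((K == 0) && (m == 0))%N%:R.
Proof.
rewrite /bsum (sum_tuple0 (fun t => \sum_(t' : 0.-tuple 'I_Q'.+1) bcut K m t t')).
rewrite sum_tuple0 /bcut /iscomp /etotal /bword /= !big_nil eq_sym [0%N == m]eq_sym.
by case: ifP.
Qed.

Lemma iscomp_cons n s (i : 'I_n) t : iscomp s (i :: t) = (0 < i <= s)%N && iscomp (s - i)%N t.
Proof.
rewrite /iscomp /= etotal_cons; case: ltnP => //= _; case: leqP => is_ /=.
  by rewrite -[in RHS](eqn_add2l i) subnKC.
by rewrite (_ : (i + etotal t == s)%N = false) ?andbF//; lia.
Qed.

Lemma bcut_cons K m (i : 'I_Q.+1) (j : 'I_Q'.+1) t t' : bcut K m (i :: t) (j :: t') =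
  if (0 < i <= K)%N && (0 < j <= m)%N then A ^+ i * B ^+ j * bcut (K - i)%N (m - j)%N t t' else 0.
Proof.
rewrite /bcut !iscomp_cons; case: (0 < i <= K)%N; case: (0 < j <= m)%N; rewrite ?andbF//=.
by rewrite /bword /= big_cons; case: ifP => _; rewrite ?mulr0.
Qed.

Lemma bsum_rec n m K : bsum n.+1 m K =
  \sum_(i : 'I_Q.+1 | (0 < i <= K)%N) \sum_(j : 'I_Q'.+1 | (0 < j <= m)%N)
    A ^+ i * B ^+ j * bsum n (m - j)%N (K - i)%N.
Proof.
rewrite /bsum (@sum_tuple_cons M _ n (fun t => \sum_(t' : n.+1.-tuple 'I_Q'.+1) bcut K m t t')).
rewrite [RHS]big_mkcond; apply: eq_bigr => i _.
transitivity (\sum_(t : n.-tuple 'I_Q.+1) \sum_(j : 'I_Q'.+1) \sum_(t' : n.-tuple 'I_Q'.+1) bcut K m (i :: t) (j :: t')).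
  by apply: eq_bigr => t _; rewrite (@sum_tuple_cons M _ n (fun t' => bcut K m (i :: t) t')).
rewrite exchange_big /=; case: ifP => hi; last first.
  by rewrite big1// => j _; rewrite big1// => t _; rewrite big1// => t' _; rewrite bcut_cons hi.
rewrite [RHS]big_mkcond; apply: eq_bigr => j _; case: ifP => hj; last first.
  by rewrite big1// => t _; rewrite big1// => t' _; rewrite bcut_cons hi hj.
rewrite mulr_sumr; apply: eq_bigr => t _; rewrite mulr_sumr; apply: eq_bigr => t' _.
by rewrite bcut_cons hi hj.
Qed.

Lemma sum_pos_ord m (f : nat -> M) : (m <= Q')%N ->
  \sum_(j : 'I_Q'.+1 | (0 < j <= m)%N) f j = \sum_(q < m) f q.+1.
Proof.
move=> mQ; rewrite big_mkcond big_ord_recl /= add0r.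
rewrite (big_ord_widen Q' (fun q => f q.+1) mQ) [RHS]big_mkcond.
by apply: eq_bigr => j _.
Qed.

Lemma csum1_bsum n m K : (m <= Q')%N -> csum1 m K n = bsum n m K.
Proof.
elim: n m K => [|n IH] m K mQ.
  case: m mQ => [|m] _; first by rewrite bsum0 -csum0.
  have bsumE : bsum 0 m.+1 K = 0 by rewrite bsum0 andbF.
  by rewrite csum1_pos0 bsumE.
case: m mQ => [|m] mQ.
  rewrite /= csum0 andbF bsum_rec big1// => i _; rewrite big_pred0// => j.
  by case: (val j).
rewrite csum1_pos bsum_rec; apply: eq_bigr => i _.
rewrite (sum_pos_ord (fun j => A ^+ i * B ^+ j * bsum n (m.+1 - j)%N (K - i)%N))//.
rewrite csum_leading_zeros mulr_sumr; apply: eq_bigr => q _.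
rewrite exprS !mulrA subSS IH//.
by rewrite (leq_trans (leq_subr _ _))// ltnW.
Qed.

Lemma sum_ffun_tuple (V : nmodType) (T : finType) n (F : {ffun 'I_n -> T} -> V) :
  \sum_f F f = \sum_(t : n.-tuple T) F [ffun i => tnth t i].
Proof.
rewrite (reindex (fun t : n.-tuple T => [ffun i => tnth t i])) //=.
exists (fun f : {ffun 'I_n -> T} => [tuple f i | i < n]) => [t|f] _.
  by apply: eq_from_tnth => i; rewrite tnth_mktuple ffunE.
by apply/ffunP => i; rewrite ffunE tnth_mktuple.
Qed.

Lemma composition_tuple s n (t : n.-tuple 'I_s.+1) :
  composition [ffun i => tnth t i] = iscomp s t.
Proof.
rewrite /composition /iscomp; congr (_ && _).
  apply/forallP/all_tnthP => h i; have := h i; rewrite ?ffunE//.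
rewrite /etotal big_tuple; congr (_ == _).
by apply: eq_bigr => i _; rewrite ffunE.
Qed.

Lemma bword_tuple n (t : n.-tuple 'I_Q.+1) (t' : n.-tuple 'I_Q'.+1) :
  bword t t' = \prod_(m < n) (A ^+ tnth t m * B ^+ tnth t' m).
Proof.
rewrite /bword -[zip t t']/(tval (zip_tuple t t')) big_tuple; apply: eq_bigr => m _.
by rewrite !(tnth_nth (ord0, ord0)) /= nth_zip ?size_tuple// -!(tnth_nth _).
Qed.

End block_words.

Lemma word_sum (R : realType) d (A B : 'M[R[i]]_d) K m n :
  \sum_(i : {ffun 'I_n -> 'I_K.+1} | composition i)
    \sum_(j : {ffun 'I_n -> 'I_m.+1} | composition j) word A B i j = bsum A B K m n m K.
Proof.
rewrite big_mkcond sum_ffun_tuple /bsum; apply: eq_bigr => t _.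
rewrite composition_tuple /bcut; case: (iscomp K t) => /=; last by rewrite big1.
rewrite big_mkcond sum_ffun_tuple; apply: eq_bigr => t' _.
rewrite composition_tuple; case: ifP => // _.
rewrite bword_tuple /word; apply: eq_bigr => q _.
by rewrite !ffunE.
Qed.

Section expand_nodes.
Variable K : numFieldType.

Definition powp Q (s : seq K) (e : seq 'I_Q) : K := \prod_(u <- zip s e) u.1 ^+ u.2.

Lemma supp_le Q (e : seq 'I_Q) : (supp e <= size e)%N.
Proof. exact: count_size. Qed.

Lemma zsum_tuples (Q : nat) (s : seq K) (th : K) (q : nat) : (q <= Q)%N -> zsum s th q =
  \sum_(e : (size s).-tuple 'I_Q.+1)
    if etotal e == q then powp s e * (th ^+ (size s - supp e) * (th - 1) ^+ supp e) else 0.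
Proof.
elim: s q => [|a s IH] q qQ.
  rewrite (sum_tuple0 (fun e : seq 'I_Q.+1 => if etotal e == q then
    powp [::] e * (th ^+ (0 - supp e) * (th - 1) ^+ supp e) else 0)).
  rewrite /etotal /powp /= !big_nil eq_sym !expr0 !mul1r.
  by case: eqP.
rewrite (@sum_tuple_cons K _ (size s) (fun e : seq 'I_Q.+1 => if etotal e == q then
    powp (a :: s) e * (th ^+ (size (a :: s) - supp e) * (th - 1) ^+ supp e) else 0)).
have qQ' : (q.+1 <= Q.+1)%N by [].
rewrite [LHS]/= (big_ord_widen Q.+1
  (fun i => a ^+ i * (if i == 0%N :> nat then th else th - 1) * zsum s th (q - i)) qQ') big_mkcond.
apply: eq_bigr => i _; rewrite ltnS; case: leqP => iq; last first.
  by rewrite big1// => e _; rewrite etotal_cons (_ : (i + etotal e == q)%N = false)//; lia.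
rewrite IH ?(leq_trans (leq_subr _ _))// mulr_sumr; apply: eq_bigr => e _.
rewrite etotal_cons -(eqn_add2l i (etotal e)) subnKC//; case: (_ =P q) => _; last by rewrite mulr0.
rewrite supp_cons /powp /= big_cons /=.
have se : (supp e <= size s)%N by rewrite -[X in (_ <= X)%N](size_tuple e) supp_le.
move: (\prod_(u <- _) _) => P; case: eqP => [->|/eqP i0].
  by rewrite add0n subSn// exprS; move: (_ ^+ _) (_ ^+ _) (_ ^+ _) => u v w; ring.
rewrite lt0n i0 add1n subSS exprS; move: (_ ^+ _) (_ ^+ _) (_ ^+ _) => u v w; ring.
Qed.

Lemma deriv_prim (P : {poly K}) : (prim P)^`() = P.
Proof.
apply/polyP => i; rewrite coef_deriv coef_prim /= -[LHS]mulr_natr divfK// pnatr_eq0.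
Qed.

Definition betac (k m n : nat) : K := (-1) ^+ n * ((k + (m - n))`! * n`!)%:R / (k + m).+1`!%:R.

Lemma dd_tuples (k : nat) (s : seq K) : (1 < size s)%N ->
  dd s (prim ('X^k * nodep s)) = \sum_(e : (size s).-tuple 'I_k.+3)
    if etotal e == k.+2 then powp s e * betac k (size s) (supp e) else 0.
Proof.
move=> s1; pose z : {poly K} := \sum_(e : (size s).-tuple 'I_k.+3)
    if etotal e == k.+2 then powp s e *: ('X^(size s - supp e) * ('X - 1) ^+ supp e) else 0.
rewrite (@dd_primitive _ s k _ z s1 (deriv_prim _)).
  rewrite /z mulr_sumr int01_sum; apply: eq_bigr => e _; case: ifP => _; last first.
    by rewrite mulr0 -(scale0r 0) int01Z mul0r.
  rewrite -scalerAr int01Z mulrA -exprD beta_int01; congr (_ * _); rewrite /betac.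
  by rewrite -addnA subnK// -[X in (_ <= X)%N](size_tuple e) supp_le.
move=> th; rewrite (zsum_tuples s th (leqnn _)) /z horner_sum; apply: eq_bigr => e _.
case: ifP => _; last by rewrite horner0.
by rewrite hornerZ hornerM hornerXn horner_exp !hornerE.
Qed.

End expand_nodes.

Section moment_words.
Variables (R : realType) (d : nat) (al : 'I_d -> R) (B : 'M[R[i]]_d).
Local Notation C := R[i].

Definition Adiag : 'M[C]_d := fdiag (fun j => (al j)%:C).

Lemma Adiag_exp n : Adiag ^+ n = fdiag (fun j => (al j)%:C ^+ n).
Proof.
elim: n => [|n IH].
  apply/matrixP => i j; rewrite expr0 !mxE; case: eqP => [->|_]; by rewrite ?mulr1n ?mulr0n.
rewrite exprS IH; apply: etrans (fdiagM _ _) _.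
by congr (diag_mx _); apply/rowP => j; rewrite !mxE exprS.
Qed.

Lemma eword_prod Q (e : seq 'I_Q.+1) : eword Adiag B e =
  \prod_(g <- [seq (fun j => (al j)%:C ^+ nat_of_ord i) | i <- e]) (fdiag g *m B).
Proof.
rewrite /eword; elim: e => [|i e IH]; first by rewrite !big_nil.
by rewrite /= !big_cons IH Adiag_exp.
Qed.

Lemma trace_eword m Q (e : m.+1.-tuple 'I_Q.+1) : \tr (eword Adiag B e) =
  \sum_(p : m.+1.-tuple 'I_d) (powp (map al p) e)%:C * cyc B p.
Proof.
pose fs : m.+1.-tuple ('I_d -> C) := [tuple of [seq (fun j => (al j)%:C ^+ nat_of_ord i) | i <- e]].
have key n (fs' : seq ('I_d -> C)) : size fs' = n.+1 ->
    \tr (\prod_(g <- fs') (fdiag g *m B)) = \sum_(p : n.+1.-tuple 'I_d) wprod fs' p * cyc B p.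
  by move=> sf; rewrite -sf; apply: trace_words; rewrite sf.
rewrite eword_prod (key m); last by rewrite size_map size_tuple.
apply: eq_bigr => p _; congr (_ * _); rewrite /wprod /powp.
elim: (tval e) (tval p) => [|i e' IH] [|a p']; rewrite /= ?big_nil//.
by rewrite !big_cons /= IH rmorphM rmorphXn.
Qed.

Lemma cyc_dd_sum (k m : nat) :
  \sum_(p : m.+2.-tuple 'I_d) cyc B p * (dd (map al p) (prim ('X^k * nodep (map al p))))%:C =
  \sum_(e : m.+2.-tuple 'I_k.+3)
    if etotal e == k.+2 then (betac R k m.+2 (supp e))%:C * \tr (eword Adiag B e) else 0.
Proof.
have key n (s : seq R) : size s = n.+2 -> dd s (prim ('X^k * nodep s)) =
    \sum_(e : n.+2.-tuple 'I_k.+3)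
    if etotal e == k.+2 then powp s e * betac R k n.+2 (supp e) else 0.
  by move=> sn; rewrite dd_tuples sn.
transitivity (\sum_(p : m.+2.-tuple 'I_d) \sum_(e : m.+2.-tuple 'I_k.+3)
   if etotal e == k.+2 then (betac R k m.+2 (supp e))%:C * ((powp (map al p) e)%:C * cyc B p) else 0).
  apply: eq_bigr => p _; rewrite (key m); last by rewrite size_map size_tuple.
  rewrite rmorph_sum mulr_sumr; apply: eq_bigr => e _; case: ifP => _; last by rewrite mulr0.
  have h (c p' b : C) : c * (p' * b) = b * (p' * c) by ring.
  by rewrite rmorphM; exact: h.
rewrite exchange_big; apply: eq_bigr => e _; case: ifP => _; last by rewrite big1.
by rewrite trace_eword mulr_sumr.
Qed.

(** Among the m cyclic rotations of e, those that start with a positive entry are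
    as many as the positive entries. *)
Lemma rotate_to_block (m K Q N : nat) (g : nat -> C) : (m.+1 < N)%N ->
  \sum_(e : m.+1.-tuple 'I_Q.+1)
    (if etotal e == K then (supp e)%:R * g (supp e) * \tr (eword Adiag B e) else 0) =
  m.+1%:R * \sum_(n < N) g n * \tr (csum1 Adiag B Q m.+1 K n).
Proof.
move=> mN.
pose G (e : seq 'I_Q.+1) : C := if etotal e == K then g (supp e) * \tr (eword Adiag B e) else 0.
pose u (i : 'I_Q.+1) : C := (0 < i)%N%:R.
have Grot r e : G (rot r e) = G e.
  rewrite /G (_ : etotal (rot r e) = etotal e); last by apply: perm_big; rewrite perm_rot.
  rewrite (_ : supp (rot r e) = supp e); last by apply/permP; rewrite perm_rot.
  case: ifP => // _; congr (_ * _).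
  rewrite /eword /rot big_cat -[X in _ = \tr (\prod_(i <- X) _)](cat_take_drop r e) big_cat /=.
  by rewrite -!mulmxE mxtrace_mulC.
transitivity (\sum_(e : m.+1.-tuple 'I_Q.+1) G e * \sum_(i <- e) u i).
  apply: eq_bigr => e _; rewrite /G; case: ifP => _; last by rewrite mul0r.
  have -> : \sum_(i <- e) u i = (supp e)%:R.
    rewrite /supp; elim: (tval e) => [|i s IH]; first by rewrite big_nil.
    by rewrite big_cons IH /u -natrD.
  have h (a b c : C) : a * b * c = b * c * a by ring.
  exact: h.
rewrite -sum_tuple_rot//; congr (_ * _).
pose F (s : seq 'I_Q.+1) : C := if s is i :: s' then G s * u i else 0.
transitivity (\sum_(e : m.+1.-tuple 'I_Q.+1) F e).
  by apply: eq_bigr => e _; case/tupleP: e => i e; rewrite theadE.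
rewrite sum_tuple_cons /csum1.
transitivity (\sum_(i : 'I_Q.+1 | (0 < i)%N) \sum_(e : m.-tuple 'I_Q.+1)
    \sum_(n < N) g n * \tr (ecut Adiag B K n (i :: e))).
  rewrite [RHS]big_mkcond; apply: eq_bigr => i _; case: ifP => i0; last first.
    by rewrite big1// => e _; rewrite /F /u i0 mulr0.
  apply: eq_bigr => e _; rewrite /F /u i0 mulr1 /G /ecut; case: eqP => _ /=; last first.
    by rewrite big1// => n _; rewrite mxtrace0 mulr0.
  have sN : (supp (i :: e) < N)%N.
    by apply: leq_ltn_trans mN; rewrite (leq_trans (supp_le _))//= size_tuple.
  rewrite (bigD1 (Ordinal sN))//= eqxx big1 ?addr0// => n /negPf nE.
  by rewrite (_ : (supp (i :: e) == n) = false) ?mxtrace0 ?mulr0// eq_sym -nE.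
transitivity (\sum_(i : 'I_Q.+1 | (0 < i)%N) \sum_(n < N) \sum_(e : m.-tuple 'I_Q.+1)
    g n * \tr (ecut Adiag B K n (i :: e))).
  by apply: eq_bigr => i _; rewrite exchange_big.
rewrite exchange_big /=; apply: eq_bigr => n _.
rewrite raddf_sum mulr_sumr /=; apply: eq_bigr => i _.
by rewrite raddf_sum mulr_sumr.
Qed.

Lemma comp_size n s (t : seq 'I_n) : iscomp s t -> (size t <= s)%N.
Proof.
move=> /andP[pos /eqP <-]; elim: t pos => [//|i t IH] /= /andP[i0 /IH h].
by rewrite etotal_cons -add1n leq_add.
Qed.

Lemma bsum_large Q Q' n m K : (minn K m < n)%N -> bsum Adiag B Q Q' n m K = 0.
Proof.
move=> h; rewrite /bsum big1// => t _; rewrite big1// => t' _; rewrite /bcut.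
case: ifP => // /andP[/comp_size h1 /comp_size h2].
by rewrite !size_tuple in h1 h2; move: h; rewrite gtn_min !ltnNge h1 h2.
Qed.

Lemma supp_gt0 n (e : seq 'I_n) : (0 < etotal e)%N -> (0 < supp e)%N.
Proof.
elim: e => [|i e IH]; first by rewrite /etotal big_nil.
by rewrite etotal_cons supp_cons; case: (val i) => [|j] /=.
Qed.

Lemma beta_binomial (k l n : nat) : (0 < n)%N -> (n <= l.+2)%N ->
  - (betac R k l.+2 n / n%:R) =
  ((k + l + 2) * (k + l + 3))%:R^-1 * ((-1) ^+ n.-1 / 'C(k + l + 1, n.-1)%:R).
Proof.
case: n => [//|n] _ nl /=; rewrite /betac.
have nkl : (n <= k + l + 1)%N by lia.
have -> : (k + (l.+2 - n.+1) = k + l + 1 - n)%N by lia.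
have -> : ((k + l.+2).+1`! = (k + l + 3) * ((k + l + 2) * (k + l + 1)`!))%N.
  by rewrite !addnS !addn0 !factS.
have -> : ((k + l + 1)`! = 'C(k + l + 1, n) * (n`! * (k + l + 1 - n)`!))%N by rewrite bin_fact.
have n0 (j : nat) : (0 < j)%N -> j%:R != 0 :> R by move=> j0; rewrite pnatr_eq0 -lt0n.
have c0 : 'C(k + l + 1, n)%:R != 0 :> R by apply: n0; rewrite bin_gt0.
have f0 := n0 _ (fact_gt0 n); have f1 := n0 _ (fact_gt0 (k + l + 1 - n)).
have p0 : (n.+1)%:R != 0 :> R by exact: n0.
have a0 : (k + l + 2)%:R != 0 :> R by apply: n0; lia.
have a1 : (k + l + 3)%:R != 0 :> R by apply: n0; lia.
rewrite exprS factS !natrM.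
move: ('C(_, _)%:R) (n`!%:R) ((_ - n)`!%:R) (n.+1%:R) ((k + l + 2)%:R) ((k + l + 3)%:R) c0 f0 f1 p0 a0 a1
  => c f g p a b c0 f0 f1 p0 a0 a1.
by move: (_ ^+ n) => e; field; rewrite c0 f0 f1 p0 a0 a1.
Qed.

(** The combinatorial content of the moment formula. *)
Lemma node_sum_words (k l : nat) :
  - (l.+2%:R^-1 * \sum_(p : l.+2.-tuple 'I_d)
    cyc B p * (dd (map al p) (prim ('X^k * nodep (map al p))))%:C) =
  ((k + l + 2) * (k + l + 3))%:R^-1 *
  \sum_(1 <= n < (minn k l).+3) (-1) ^+ n.-1 / 'C(k + l + 1, n.-1)%:R *
    \sum_(i : {ffun 'I_n -> 'I_k.+3} | composition i)
      \sum_(j : {ffun 'I_n -> 'I_l.+3} | composition j) \tr (word Adiag B i j) :> C.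
Proof.
pose g (n : nat) : C := (betac R k l.+2 n / n%:R)%:C.
pose b (n : nat) : C := \tr (bsum Adiag B k.+2 l.+2 n l.+2 k.+2).
rewrite cyc_dd_sum.
transitivity (- (l.+2%:R^-1 * (l.+2%:R * \sum_(n < l.+3) g n * b n))).
  congr (- (_ * _)).
  transitivity (\sum_(e : l.+2.-tuple 'I_k.+3) (if etotal e == k.+2 then
      (supp e)%:R * g (supp e) * \tr (eword Adiag B e) else 0)).
    apply: eq_bigr => e _; case: eqP => // he; congr (_ * _); rewrite /g.
    have s0 : (0 < supp e)%N by apply: supp_gt0; rewrite he.
    have -> : (supp e)%:R = ((supp e)%:R : R)%:C :> C by rewrite rmorph_nat.
    by rewrite -rmorphM mulrC divfK// pnatr_eq0 -lt0n.
  rewrite (@rotate_to_block l.+1 k.+2 k.+2 l.+3 g)//; congr (_ * _).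
  by apply: eq_bigr => n _; rewrite (@csum1_bsum _ _ _ _ l.+2).
rewrite mulKf ?pnatr_eq0// -(big_mkord xpredT (fun n => g n * b n)) big_ltn//.
have -> : g 0%N * b 0%N = 0 by rewrite /g invr0 mulr0 mul0r.
rewrite add0r (@big_cat_nat _ _ _ (minn k l).+3)//=; last by rewrite !ltnS geq_minr.
rewrite [X in _ + X]big_nat_cond [X in _ + X]big1 ?addr0; last first.
  by move=> n /andP[/andP[h _] _]; rewrite /b bsum_large ?mxtrace0 ?mulr0//; lia.
rewrite -sumrN mulr_sumr big_nat_cond [RHS]big_nat_cond; apply: eq_bigr => n /andP[/andP[n1 n2] _].
have nl : (n <= l.+2)%N by move: n2; lia.
rewrite -mulNr mulrA; congr (_ * _).
  rewrite /g -rmorphN (beta_binomial k n1 nl).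
  rewrite rmorphM fmorphV rmorph_nat; congr (_ * _).
  by rewrite rmorphM rmorphXn rmorphN rmorph1 fmorphV rmorph_nat.
rewrite /b -word_sum raddf_sum /=; apply: eq_bigr => i _.
by rewrite raddf_sum.
Qed.

End moment_words.

Section continuous_on_plane.
Variable R : realType.

Definition grid_point (n : nat) (a : R) : R := (Num.floor (a * n.+1%:R))%:~R / n.+1%:R.

Lemma grid_point_near n a : `|a - grid_point n a| <= epsn R n.
Proof.
have n0 : 0 < n.+1%:R :> R by rewrite ltr0n.
have /andP[h1 h2] := real_floor_itv (num_real (a * n.+1%:R)).
rewrite /grid_point /epsn; set z := (Num.floor _)%:~R in h1 *.
have -> : a - z / n.+1%:R = (a * n.+1%:R - z) / n.+1%:R by field.
rewrite normrM (ger0_norm (x := _^-1)) ?invr_ge0 ?(ltW n0)// ler_piMl ?invr_ge0 ?(ltW n0)//.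
rewrite ger0_norm ?subr_ge0// lerBlDl; rewrite intrD in h2; exact: ltW.
Qed.

Lemma grid_point_cvg a : grid_point n a @[n --> \oo] --> a.
Proof.
apply/cvgrPdist_le => e e0.
have /cvgrPdist_le /(_ e e0) := @epsn_cvg R.
apply: filterS => n; rewrite sub0r normrN ger0_norm ?(ltW (epsn_gt0 _ _))//.
exact/le_trans/grid_point_near.
Qed.

Lemma grid_measurable (f : R * R -> R) n : (forall a, continuous (fun b => f (a, b))) ->
  measurable_fun setT (fun p : R * R => f (grid_point n p.1, p.2)).
Proof.
move=> cf _ Y mY; rewrite setTI.
pose I (z : int) : set R := `[z%:~R / n.+1%:R, (z + 1)%:~R / n.+1%:R[%classic.
have -> : (fun p : R * R => f (grid_point n p.1, p.2)) @^-1` Y =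
   \bigcup_(z : int) (I z `*` ((fun b => f (z%:~R / n.+1%:R, b)) @^-1` Y)).
  have n0 : 0 < n.+1%:R :> R by rewrite ltr0n.
  have Ifloor (z : int) (a : R) : I z a <-> Num.floor (a * n.+1%:R) = z.
    rewrite /I /= in_itv /= ler_pdivrMr// ltr_pdivlMr//; split.
      by move=> h; apply: floor_def.
    by move=> <-; apply: real_floor_itv; exact: num_real.
  apply/seteqP; split => [[a b] /= h|[a b] /= [z _ [/= /Ifloor az h]]].
    by exists (Num.floor (a * n.+1%:R)) => //; split => //=; apply/Ifloor.
  by rewrite /grid_point az.
apply: countable_bigcupT_measurable => // z; apply: measurableX.
  exact: measurable_itv.
rewrite -[X in measurable X]setTI.
have m : measurable_fun setT (fun b => f (z%:~R / n.+1%:R, b)).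
  exact: continuous_measurable_fun.
exact: m.
Qed.

Lemma continuous_measurable2 (f : R * R -> R) : continuous f -> measurable_fun setT f.
Proof.
move=> cf.
have slice a : continuous (fun b => f (a, b)).
  by move=> b; apply: (@cvg_comp _ _ _ (fun b => (a, b)) f _ _ _ _ (cf (a, b))); exact: cvg_pair (cvg_cst a) cvg_id.
apply: (@measurable_fun_cvg _ _ _ _ (fun n (p : R * R) => f (grid_point n p.1, p.2))).
  by move=> n; exact: grid_measurable.
move=> [a b] _.
have h : (grid_point n a, b) @[n --> \oo] --> (a, b).
  exact: cvg_pair (@grid_point_cvg a) (cvg_cst b).
exact: (cvg_comp _ _ h (cf (a, b))).
Qed.

End continuous_on_plane.

Section omega_support.
Variables (R : realType) (d : nat).
Local Notation C := R[i].
Implicit Types (A B : 'M[C]_d).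

Lemma omegaE A B p : omega A B p = (2 * pi)^-1 * eigIm ((A - (p.1)%:C%:M) *m (B - (p.2)%:C%:M)).
Proof. by []. Qed.

Lemma omega_continuous A B : continuous (omega A B).
Proof.
move=> p; have FF := @nbhs_pfilter _ p.
have shift (M : 'M[C]_d) (f : R * R -> R) : f x @[x --> p] --> f p ->
    mcvg (nbhs p) (fun x => M - (f x)%:C%:M) (M - (f p)%:C%:M).
  by move=> fp; apply: mcvgB; [exact: mcvg_cst|apply: mcvg_scalar; exact: ccvg_real].
have h : mcvg (nbhs p) (fun x : R * R => (A - (x.1)%:C%:M) *m (B - (x.2)%:C%:M))
    ((A - (p.1)%:C%:M) *m (B - (p.2)%:C%:M)).
  by apply: mcvgM; apply: shift; [exact: cvg_fst|exact: cvg_snd].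
by apply: cvgM; [exact: cvg_cst|exact: (eigIm_cvg h)].
Qed.

Lemma omega_definite_l A B p : ctr A = A -> ctr B = B ->
  (forall v, v != 0 -> qform (A - (p.1)%:C%:M) v != 0) -> omega A B p = 0.
Proof.
by move=> hA hB h; rewrite omegaE (eigIm_definite_l (shift_herm p.1 hA) (shift_herm p.2 hB) h) mulr0.
Qed.

Lemma omega_definite_r A B p : ctr A = A -> ctr B = B ->
  (forall v, v != 0 -> qform (B - (p.2)%:C%:M) v != 0) -> omega A B p = 0.
Proof.
by move=> hA hB h; rewrite omegaE (eigIm_definite_r (shift_herm p.1 hA) (shift_herm p.2 hB) h) mulr0.
Qed.

Lemma omega_ge0 A B p : 0 <= omega A B p.
Proof. by rewrite omegaE mulr_ge0 ?eigIm_ge0// invr_ge0 mulr_ge0// pi_ge0. Qed.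

Lemma omega_moment_Dom2 A B k l : ctr A = A -> ctr B = B ->
  Dom2 (fun p : R * R => p.1 ^+ k * p.2 ^+ l * omega A B p).
Proof.
move=> hA hB; have [rA rA0 hrA] := herm_definite_far hA; have [rB rB0 hrB] := herm_definite_far hB.
have m1 : measurable_fun setT (fun p : R * R => p.1) by exact: measurable_fst.
have m2 : measurable_fun setT (fun p : R * R => p.2) by exact: measurable_snd.
split.
  apply: measurable_funM; last by apply: continuous_measurable2; exact: omega_continuous.
  by apply: measurable_funM; apply: measurable_funX.
pose N (r : R) (M : 'M[C]_d) := mnorm M + d%:R * r.
pose K := rA ^+ k * rB ^+ l * ((2 * pi)^-1 * (d%:R * (N rA A * N rB B))).
have pi2 : 0 <= (2 * pi)^-1 :> R by rewrite invr_ge0 mulr_ge0// pi_ge0.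
have N0 r M : 0 <= r -> 0 <= N r M by move=> r0; rewrite addr_ge0 ?mnorm_ge0// mulr_ge0.
have K0 : 0 <= K by rewrite !mulr_ge0 ?exprn_ge0 ?N0.
have hN (r a : R) (M : 'M[C]_d) : `|a| <= r -> mnorm (M - a%:C%:M) <= N r M.
  move=> ar; apply: (le_trans (mnormD _ _)); rewrite mnormN mnorm_scalar cm_real.
  by rewrite lerD2l ler_wpM2l.
have outA a b : rA < `|a| -> omega A B (a, b) = 0.
  by move=> ra; apply: omega_definite_l => //; exact: hrA.
have outB a b : rB < `|b| -> omega A B (a, b) = 0.
  by move=> rb; apply: omega_definite_r => //; exact: hrB.
exists (K * (1 + rA ^+ 2) * (1 + rB ^+ 2)) => a b.
have yA : rA < `|a| -> `|a ^+ k * b ^+ l * omega A B (a, b)| = 0.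
  by move=> ra; rewrite outA// mulr0 normr0.
have yB : rB < `|b| -> `|a ^+ k * b ^+ l * omega A B (a, b)| = 0.
  by move=> rb; rewrite outB// mulr0 normr0.
have yK : `|a ^+ k * b ^+ l * omega A B (a, b)| <= K.
  have [ar|/yA ->//] := leP `|a| rA; have [br|/yB ->//] := leP `|b| rB.
  rewrite normrM (ger0_norm (omega_ge0 A B (a, b))) normrM !normrX.
  apply: ler_pM; [|exact: omega_ge0| |].
  - by apply: mulr_ge0; exact: exprn_ge0.
  - by apply: ler_pM; [exact: exprn_ge0|exact: exprn_ge0|rewrite lerXn2r// nnegrE|rewrite lerXn2r// nnegrE].
  rewrite omegaE; apply: ler_wpM2l => //; apply: (le_trans (eigIm_le _)).
  apply: ler_wpM2l => //; apply: (le_trans (mnormM _ _)).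
  by apply: ler_pM; [exact: mnorm_ge0|exact: mnorm_ge0|exact: hN|exact: hN].
have h1 := supported_decay K0 yK yA.
have K1 : 0 <= K * (1 + rA ^+ 2) * hw a.
  have q : 0 <= 1 + rA ^+ 2 by rewrite addr_ge0// sqr_ge0.
  exact: mulr_ge0 (mulr_ge0 K0 q) (hw_ge0 _).
have := supported_decay K1 h1 yB.
suff -> : K * (1 + rA ^+ 2) * hw a * (1 + rB ^+ 2) * hw b =
  K * (1 + rA ^+ 2) * (1 + rB ^+ 2) * (hw a * hw b) by [].
by move: (hw a) (hw b); clearbody K => v w; ring.
Qed.

Lemma herm_range A : ctr A = A -> (0 < d)%N -> exists lo hi : R,
  [/\ lo%:C \in eigvals A, hi%:C \in eigvals A &
   forall a, ~~ (lo <= a <= hi) -> forall v, v != 0 -> qform (A - a%:C%:M) v != 0].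
Proof.
move=> /hermP /herm_spectral[P [al [uP cP AE]]] d0.
pose i0 : 'I_d := Ordinal d0.
have ein i : (al i)%:C \in eigvals A.
  by rewrite (perm_mem (eigvals_diag uP AE)); apply: map_f; rewrite mem_enum.
case: (@arg_minP _ _ _ i0 xpredT al) => // i1 _ h1.
case: (@arg_maxP _ _ _ i0 xpredT al) => // i2 _ h2.
exists (al i1), (al i2); split=> // a; rewrite negb_and -!ltNge => h.
apply: (shift_definite uP cP AE); case/orP: h => h; [right|left] => i.
  exact: lt_le_trans h (h1 i isT).
exact: le_lt_trans (h2 i isT) h.
Qed.

Lemma conv_hull_segment (s : seq C) (lo hi a : R) : lo%:C \in s -> hi%:C \in s ->
  lo <= a <= hi -> conv_hull s a%:C.
Proof.
move=> slo shi /andP[h1 h2].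
have i1s : (index lo%:C s < size s)%N by rewrite index_mem.
have i2s : (index hi%:C s < size s)%N by rewrite index_mem.
pose i1 := Ordinal i1s; pose i2 := Ordinal i2s.
have [t t01 aE] : exists2 t : R, 0 <= t <= 1 & a = (1 - t) * lo + t * hi.
  have [e|ne] := eqVneq lo hi.
    by exists 0; rewrite ?lexx ?ler01// subr0 mul1r mul0r addr0; apply/eqP; rewrite eq_le h1 e h2.
  have lh : 0 < hi - lo by rewrite subr_gt0 lt_neqAle ne (le_trans h1).
  exists ((a - lo) / (hi - lo)); last by field; rewrite lt0r_neq0.
  apply/andP; split; first by apply: divr_ge0; [rewrite subr_ge0|exact: ltW].
  by rewrite ler_pdivrMr// mul1r lerD2r.
exists (fun j => (1 - t) * (j == i1)%:R + t * (j == i2)%:R); move/andP: t01 => [t0 t1].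
have delta (f : 'I_(size s) -> C) (i : 'I_(size s)) : \sum_j ((j == i)%:R : R)%:C * f j = f i.
  rewrite (bigD1 i)//= eqxx mul1r big1 ?addr0// => j /negPf ->.
  by rewrite mul0r.
split.
- by move=> j; rewrite addr_ge0// mulr_ge0// subr_ge0.
- rewrite big_split /= -!mulr_sumr.
  have d1 (i : 'I_(size s)) : \sum_j ((j == i)%:R : R) = 1.
    by rewrite (bigD1 i)//= eqxx big1 ?addr0// => j /negPf ->.
  by rewrite !d1 !mulr1 subrK.
- rewrite (eq_bigr (fun j => (1 - t)%:C * (((j == i1)%:R : R)%:C * s`_j) +
     t%:C * (((j == i2)%:R : R)%:C * s`_j))); last first.
    by move=> j _; rewrite rmorphD !rmorphM mulrDl !mulrA.
  rewrite big_split /= -!mulr_sumr (delta (fun j => s`_j)) (delta (fun j => s`_j)).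
  by rewrite !nth_index// -!rmorphM -rmorphD -aE.
Qed.

Lemma omega_box A B : ctr A = A -> ctr B = B -> (0 < d)%N -> exists lo hi lo' hi' : R,
  [/\ [set p | omega A B p != 0] `<=` `[lo, hi]%classic `*` `[lo', hi']%classic,
      (forall a, lo <= a <= hi -> conv_hull (eigvals A) a%:C) &
      (forall b, lo' <= b <= hi' -> conv_hull (eigvals B) b%:C)].
Proof.
move=> hA hB d0; have [lo [hi [m1 m2 hr]]] := herm_range hA d0.
have [lo' [hi' [m1' m2' hr']]] := herm_range hB d0.
exists lo, hi, lo', hi'; split.
- move=> p /= op; split; rewrite /= in_itv /=; apply: contraT => h.
    by move/eqP: op; rewrite omega_definite_l//; exact: hr.
  by move/eqP: op; rewrite omega_definite_r//; exact: hr'.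
- by move=> a; exact: conv_hull_segment.
- by move=> b; exact: conv_hull_segment.
Qed.

Lemma omega_supported A B : ctr A = A -> ctr B = B ->
  compact (fsupport (omega A B)) /\
  fsupport (omega A B) `<=` [set p | conv_hull (eigvals A) (p.1)%:C /\ conv_hull (eigvals B) (p.2)%:C].
Proof.
move=> hA hB; have [d0|d0] := posnP d.
  suff -> : fsupport (omega A B) = set0 by split; [exact: compact0|].
  rewrite /fsupport (_ : [set p | _] = set0) ?closure0//.
  apply/seteqP; split=> // p /=; rewrite omegaE /eigIm.
  have sz : size (eigvals ((A - (p.1)%:C%:M) *m (B - (p.2)%:C%:M))) = 0%N.
    exact: etrans (size_eigvals _) d0.
  by rewrite (size0nil sz) big_nil mulr0 eqxx.
have [lo [hi [lo' [hi' [sub cA cB]]]]] := omega_box hA hB d0.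
have cbox : compact (`[lo, hi]%classic `*` `[lo', hi']%classic : set (R * R)).
  by apply: compact_setX; exact: segment_compact.
have clbox : closed (`[lo, hi]%classic `*` `[lo', hi']%classic : set (R * R)).
  have -> : (`[lo, hi]%classic `*` `[lo', hi']%classic : set (R * R)) =
     (fst @^-1` `[lo, hi]%classic) `&` (snd @^-1` `[lo', hi']%classic) by [].
  apply: closedI; apply: closed_comp => [p _|]; try exact: interval_closed.
    exact: cvg_fst.
  exact: cvg_snd.
have fsub : fsupport (omega A B) `<=` `[lo, hi]%classic `*` `[lo', hi']%classic.
  by rewrite [X in _ `<=` X](iffLR (closure_id _) clbox); exact: closureS.
split; first by apply: subclosed_compact fsub => //; exact: closed_closure.
move=> p hp; have [h1 h2] := fsub p hp.
by split; [apply: cA; move: h1|apply: cB; move: h2]; rewrite /= in_itv.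
Qed.

End omega_support.

Section diagonal_moment.
Variables (R : realType) (d : nat) (al : 'I_d -> R) (B : 'M[R[i]]_d).
Hypothesis hB : ctr B = B.
Variables k l : nat.
Local Notation C := R[i].
Local Notation mu := (@lebesgue_measure R).
Local Notation i0 := (Complex (0 : R) (1 : R)).
Local Notation A := (Adiag al).

Definition inner_moment (a : R) : R :=
  \int[mu]_b (b ^+ l * eigIm ((A - a%:C%:M) *m (B - b%:C%:M))).

Lemma inner_moment_cint a :
  moment_b (fun j => al j - a) B l = (inner_moment a)%:C.
Proof.
have E b : pencil_product (fun j => al j - a) B 1 b%:C = (A - a%:C%:M) *m (B - b%:C%:M).
  rewrite /pencil_product scale1r; congr (_ *m _); apply/matrixP => i j; rewrite !mxE.
  by case: (i == j); rewrite ?mulr1n ?mulr0n ?subr0// rmorphB.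
rewrite /moment_b /inner_moment.
have F b : b%:C ^+ l * (eigIm (pencil_product (fun j => al j - a) B 1 b%:C))%:C =
    (b ^+ l * eigIm ((A - a%:C%:M) *m (B - b%:C%:M)))%:C :> C.
  by rewrite E rmorphM rmorphXn.
rewrite (eq_cint F); apply: complex_ext => //=.
by rewrite /Rintegral integral0_eq.
Qed.

Lemma prod_shift (p : seq 'I_d) a : \prod_(i <- p) (al i - a)%:C =
  (-1) ^+ size p * (nodep (map al p)).[a]%:C :> C.
Proof.
rewrite /nodep; elim: p => [|i p IH]; first by rewrite !big_nil hornerC mulr1.
rewrite /= !big_cons IH hornerM hornerXsubC rmorphM exprS -(opprB a) rmorphN.
have h (e v w : C) : - w * (e * v) = -1 * e * (w * v) by ring.
exact: h.
Qed.

Lemma i0_power : i0 ^+ l.+2 * i0 ^+ l = (-1) ^+ l.+1.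
Proof.
have i2 : i0 * i0 = -1 by apply: complex_ext => /=; ring.
have -> : i0 ^+ l.+2 * i0 ^+ l = (i0 * i0) ^+ l.+1.
  by rewrite -exprD -expr2 -exprM; congr (_ ^+ _); lia.
by rewrite i2.
Qed.

(** The inner moment is, away from the eigenvalues of A, a piecewise polynomial. *)
Lemma inner_moment_kernel : exists phi : l.+2.-tuple 'I_d -> R -> R,
  (forall p : l.+2.-tuple 'I_d, kernel_spec (map al p) (phi p)) /\
  forall a, a \notin [seq al i | i <- enum 'I_d] ->
    (a ^+ k * inner_moment a)%:C = \sum_(p : l.+2.-tuple 'I_d)
      - (l.+2%:R^-1 * cyc B p) * (('X^k * nodep (map al p)).[a] * phi p a)%:C.
Proof.
have /choice[phi hphi] (p : l.+2.-tuple 'I_d) : exists f, kernel_spec (map al p) f.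
  by apply: kernel_exists; rewrite size_map size_tuple.
exists phi; split=> // a ha.
have xa i : al i - a != 0.
  rewrite subr_eq0; apply: contra ha => /eqP <-; apply: map_f; exact: mem_enum.
have -> : (a ^+ k * inner_moment a)%:C = a%:C ^+ k * moment_b (fun j => al j - a) B l :> C.
  by rewrite inner_moment_cint -rmorphXn -rmorphM.
rewrite (moment_b_nodes xa hB l) /nsum !mulr_sumr.
apply: eq_bigr => p _; have [_ h _] := hphi p.
have pa : a \notin map al p.
  by apply: contra ha => /mapP[i _ ->]; apply: map_f; exact: mem_enum.
have := h a pa; rewrite size_map size_tuple subn2 /= => hk.
have -> : kap (xnodes (fun j => al j - a) i0 p) = i0 ^+ l * (phi p a)%:C.
  by rewrite -hk /xnodes /rnodes -!map_comp.
rewrite /cw prod_shift size_tuple hornerM hornerXn !rmorphM rmorphXn.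
have s1 : (-1) ^+ l.+1 * (-1) ^+ l.+2 = -1 :> C.
  by rewrite (exprS _ l.+1) mulrCA -exprMn mulrNN mul1r expr1n mulr1.
have h0 (u v w f q c n s s' : C) : u * v = s' -> s' * s = -1 ->
    q * (u * n * (c * (s * w) * (v * f))) = - (n * c) * (q * w * f).
  move=> e1 e2; transitivity ((u * v) * s * (q * n * c * w * f)); first by ring.
  by rewrite e1 e2; ring.
exact: h0 i0_power s1.
Qed.

Lemma cint_ae (f g : R -> C) (s : seq R) : cmeas f -> cmeas g ->
  (forall a, a \notin s -> f a = g a) -> cint f = cint g.
Proof.
move=> [f1 f2] [g1 g2] fg.
have key (u v : R -> R) : measurable_fun setT u -> measurable_fun setT v ->
    (forall a, a \notin s -> u a = v a) -> \int[mu]_a u a = \int[mu]_a v a.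
  move=> mu' mv uv; congr fine; apply: ae_eq_integral => //; [exact/measurable_EFinP|exact/measurable_EFinP|].
  exists [set` s]; split.
  - by apply: countable_measurable => //; apply: finite_set_countable; exact: finite_seq.
  - apply: countable_lebesgue_measure0; apply: finite_set_countable; exact: finite_seq.
  - move=> a /= h; have [//|as_] := boolP (a \in s).
    by exfalso; apply: h => _; rewrite uv.
by apply: complex_ext; apply: key => // a /fg ->.
Qed.

Lemma cint_real (f : R -> R) : cint (fun a => (f a)%:C) = (\int[mu]_a f a)%:C.
Proof. by apply: complex_ext => //=; rewrite /Rintegral integral0_eq. Qed.

Lemma cDom_real (f : R -> R) : Dom f -> cDom (fun a => (f a)%:C).
Proof.
move=> [mf [K hK]]; split; first exact: cmeas_real.
by exists K => a; rewrite cm_real.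
Qed.

Lemma Dom2_slice (f : R * R -> R) a : Dom2 f -> Dom (fun b => f (a, b)).
Proof.
move=> [mf [K hK]]; split; first exact: (measurableT_comp mf (measurable_pair1 a)).
by exists (K * hw a) => b; rewrite -mulrA.
Qed.

Theorem diagonal_moment :
  (\int[(mu \x mu)%E]_p (p.1 ^+ k * p.2 ^+ l * omega A B p))%:C =
  ((k + l + 2) * (k + l + 3))%:R^-1 *
  \sum_(1 <= n < (minn k l).+3) (-1) ^+ n.-1 / 'C(k + l + 1, n.-1)%:R *
    \sum_(i : {ffun 'I_n -> 'I_k.+3} | composition i)
      \sum_(j : {ffun 'I_n -> 'I_l.+3} | composition j) \tr (word A B i j) :> C.
Proof.
have hA : ctr A = A by exact: ctr_diag.
have D2 := omega_moment_Dom2 k l hA hB.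
have [diag_xinv _ E] := Dom2_Fubini D2.
have [phi [hphi hker]] := inner_moment_kernel.
have pi0 : 2 * pi != 0 :> R by rewrite mulf_neq0// lt0r_neq0// pi_gt0.
have D20 := omega_moment_Dom2 0 l hA hB.
pose g (a b : R) := a ^+ 0 * b ^+ l * omega A B (a, b).
have ig a : mu.-integrable setT (EFin \o g a) by exact: Dom_integrable (Dom2_slice a D20).
have inner a : \int[mu]_b (a ^+ k * b ^+ l * omega A B (a, b)) =
    (2 * pi)^-1 * (a ^+ k * inner_moment a).
  have -> : inner_moment a = 2 * pi * \int[mu]_b g a b.
    rewrite -RintegralZl//; apply: eq_Rintegral => b _.
    by rewrite /g omegaE expr0 mul1r mulrCA mulVKf.
  transitivity (a ^+ k * \int[mu]_b g a b).
    by rewrite -RintegralZl//; apply: eq_Rintegral => b _; rewrite /g expr0 mul1r mulrA.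
  by rewrite (mulrCA (a ^+ k)) mulKf.
pose m1 : C := l.+2%:R^-1.
have Dp (p : l.+2.-tuple 'I_d) :
    cDom (fun a => (('X^k * nodep (map al p)).[a] * phi p a)%:C).
  by apply: cDom_real; have [h _ _] := hphi p; exact: h.
have DS : cDom (fun a => \sum_(p : l.+2.-tuple 'I_d)
    - (m1 * cyc B p) * (('X^k * nodep (map al p)).[a] * phi p a)%:C).
  by apply: cDom_sum => p _; exact: cDomZ.
rewrite -E /= -cint_real.
transitivity (cint (fun a => ((2 * pi)^-1)%:C * (\sum_(p : l.+2.-tuple 'I_d)
    - (m1 * cyc B p) * (('X^k * nodep (map al p)).[a] * phi p a)%:C))).
  apply: (@cint_ae _ _ [seq al i | i <- enum 'I_d]).
  - by apply: cmeas_real; case: diag_xinv.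
  - by case: (cDomZ ((2 * pi)^-1)%:C DS).
  - move=> a ha; apply: etrans (f_equal (real_complex R) (inner a)) _.
    apply: etrans (rmorphM _ _ _) _.
    exact: (f_equal ( *%R ((2 * pi)^-1)%:C) (hker a ha)).
apply: etrans (cintZ _ DS) _.
rewrite -node_sum_words mulr_sumr -sumrN.
have -> : cint (fun a => \sum_(p : l.+2.-tuple 'I_d)
    - (m1 * cyc B p) * (('X^k * nodep (map al p)).[a] * phi p a)%:C) =
  \sum_(p : l.+2.-tuple 'I_d) cint (fun a =>
    - (m1 * cyc B p) * (('X^k * nodep (map al p)).[a] * phi p a)%:C).
  by apply: cint_sum => p _; exact: cDomZ.
rewrite mulr_sumr; apply: eq_bigr => p _.
rewrite (cintZ _ (Dp p)) cint_real; have [_ _ h3] := hphi p.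
rewrite (h3 _ _ (deriv_prim _) (dvdp_mulIr _ _)).
rewrite rmorphM -/m1; have -> : ((2 * pi)^-1)%:C = ((2 * pi)%:C)^-1 :> C by exact: fmorphV.
have : (2 * pi)%:C != 0 :> C by rewrite (inj_eq (@complexI R) _ 0).
have h (t c n y : C) : t != 0 -> t^-1 * (- (n * c) * (t * y)) = - (n * (c * y)).
  by move=> t0; field.
by move=> t0; exact: h.
Qed.

End diagonal_moment.

Section main.
Variables (R : realType) (d : nat).
Local Notation C := R[i].

Lemma unitary_conj_shift (P M : 'M[C]_d) (c : C) : P \in unitmx ->
  P *m M *m invmx P - c%:M = P *m (M - c%:M) *m invmx P.
Proof.
by move=> uP; rewrite mulmxBr mulmxBl scalar_mxC mulmxK.
Qed.

Lemma word_conj (P A B : 'M[C]_d) s t n (i : {ffun 'I_n -> 'I_s.+1}) (j : {ffun 'I_n -> 'I_t.+1}) :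
  P \in unitmx ->
  \tr (word (P *m A *m invmx P) (P *m B *m invmx P) i j) = \tr (word A B i j).
Proof.
move=> uP.
have conjM (M N : 'M[C]_d) : P *m M *m invmx P *m (P *m N *m invmx P) = P *m (M *m N) *m invmx P.
  by rewrite !mulmxA mulmxKV.
have conj1 : P *m (1 : 'M[C]_d) *m invmx P = 1 by rewrite mulmx1 mulmxV.
have conjX (M : 'M[C]_d) e : (P *m M *m invmx P) ^+ e = P *m M ^+ e *m invmx P.
  elim: e => [|e IH]; first by rewrite !expr0 conj1.
  by rewrite !exprS IH; exact: conjM.
have -> : word (P *m A *m invmx P) (P *m B *m invmx P) i j = P *m word A B i j *m invmx P.
  rewrite /word; elim/big_ind2: _ => [|M1 M2 N1 N2 -> ->|q _]; first by rewrite conj1.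
    exact: conjM.
  by rewrite !conjX conjM.
by rewrite mxtrace_mulC mulmxA mulVmx// mul1mx.
Qed.

Lemma omega_conj (P A B : 'M[C]_d) : P \in unitmx ->
  omega (P *m A *m invmx P) (P *m B *m invmx P) = omega A B.
Proof.
move=> uP; apply/funext => p.
have h (M N : 'M[C]_d) : P *m M *m invmx P *m (P *m N *m invmx P) = P *m (M *m N) *m invmx P.
  by rewrite !mulmxA mulmxKV.
have e : eigIm ((P *m A *m invmx P - (p.1)%:C%:M) *m (P *m B *m invmx P - (p.2)%:C%:M)) =
    eigIm ((A - (p.1)%:C%:M) *m (B - (p.2)%:C%:M)).
  by apply: (eigIm_similar uP); rewrite !unitary_conj_shift// h.
exact: (f_equal ( *%R (2 * pi)^-1) e).
Qed.

End main.

Theorem lemma2p5 (R : realType) (d : nat) (A B : 'M[R[i]]_d)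
    (hA : A \is hermsymmx) (hB : B \is hermsymmx) :
  [/\ continuous (omega A B),
      compact (fsupport (omega A B)),
      fsupport (omega A B) `<=`
        [set p | conv_hull (eigvals A) (p.1)%:C /\
                 conv_hull (eigvals B) (p.2)%:C]
    & forall k l : nat,
        (lebesgue_measure2 R).-integrable setT
          (EFin \o (fun p => p.1 ^+ k * p.2 ^+ l * omega A B p)) /\
        (\int[lebesgue_measure2 R]_p (p.1 ^+ k * p.2 ^+ l * omega A B p))%:C =
        ((k + l + 2) * (k + l + 3))%:R^-1 *
        \sum_(1 <= n < (minn k l).+3)
          (-1) ^+ n.-1 / 'C(k + l + 1, n.-1)%:R *
          \sum_(i : {ffun 'I_n -> 'I_k.+3} | composition i)
            \sum_(j : {ffun 'I_n -> 'I_l.+3} | composition j)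
              \tr (word A B i j)].
Proof.
have cA : ctr A = A by exact/hermP.
have cB : ctr B = B by exact/hermP.
have [sc sub] := omega_supported cA cB.
split=> //; first exact: omega_continuous.
move=> k l; split; first exact: Dom2_integrable (omega_moment_Dom2 k l cA cB).
have [P [al [uP cP AE]]] := herm_spectral hA.
pose B' := P *m B *m invmx P.
have cB' : ctr B' = B' by rewrite /B' -cP !ctrM cB ctrK mulmxA.
have Pi : invmx (invmx P) = P by exact: invmxK.
have uPi : invmx P \in unitmx by rewrite unitmx_inv.
have BE : B = invmx P *m B' *m invmx (invmx P).
  by rewrite Pi /B' !mulmxA mulVmx// mul1mx mulmxKV.
have {}AE : A = invmx P *m Adiag al *m invmx (invmx P) by rewrite Pi.
clearbody B'.
have -> : omega A B = omega (Adiag al) B'.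
  by apply: etrans (f_equal2 (@omega R d) AE BE) _; exact: omega_conj.
apply: etrans (diagonal_moment al cB' k l) _.
apply: (f_equal ( *%R _)); apply: eq_bigr => n _; apply: (f_equal ( *%R _)).
apply: eq_bigr => i _; apply: eq_bigr => j _.
by rewrite AE BE word_conj.
Qed.
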